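(* Let $\sigma_1,\sigma_2>0$ and let $M=\{(z,w)\in\mathbb{C}^2\times\mathbb{C}:\ \operatorname{Im} w=\sigma_1|z_1|^2+\sigma_2|z_2|^2\}$, whose points $(z,w)$ are identified with $(z,t)\in\mathbb{C}^2\times\mathbb{R}$, $t=\operatorname{Re} w$. Then, on the space of differential $(0,1)$-forms spanned by $d\bar z_1$ (forms $f\,d\bar z_1$), $\Box_b$ is solvable via convolution with the kernel $$N(z,t)=\frac{1}{\pi^3}\int_0^1\frac{\sigma_1\sigma_2}{\left(it+s_1(r)\sigma_1|z_1|^2+s_2(r)\sigma_2|z_2|^2\right)^2}\,\frac{r^{\sigma_1-1}\,dr}{(1-r^{\sigma_1})(1-r^{\sigma_2})}+\frac{1}{\pi^3}\int_0^1\frac{\sigma_1\sigma_2}{\left(-it+s_1(r)\sigma_1|z_1|^2+s_2(r)\sigma_2|z_2|^2\right)^2}\,\frac{r^{\sigma_2-1}\,dr}{(1-r^{\sigma_1})(1-r^{\sigma_2})},$$ where $$s_j(r)=\frac{1+r^{\sigma_j}}{1-r^{\sigma_j}},\qquad j=1,2.$$ On the space of $(0,1)$-forms spanned by $d\bar z_2$ (forms $f\,d\bar z_2$), $\Box_b$ is solvable via convolution with the kernel (again denoted $N$) $$N(z,t)=\frac{1}{\pi^3}\int_0^1\frac{\sigma_1\sigma_2}{\left(it+s_1(r)\sigma_1|z_1|^2+s_2(r)\sigma_2|z_2|^2\right)^2}\,\frac{r^{\sigma_2-1}\,dr}{(1-r^{\sigma_1})(1-r^{\sigma_2})}+\frac{1}{\pi^3}\int_0^1\frac{\sigma_1\sigma_2}{\left(-it+s_1(r)\sigma_1|z_1|^2+s_2(r)\sigma_2|z_2|^2\right)^2}\,\frac{r^{\sigma_1-1}\,dr}{(1-r^{\sigma_1})(1-r^{\sigma_2})},$$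 with the same functions $s_1(r),s_2(r)$.
   Context: Group structure: $G=\mathbb{C}^2\times\mathbb{R}$ carries the group law $(z,t)(z',t')=(z+z',\,t+t'+2\operatorname{Im}\phi(z,z'))$ with $\phi(z,z')=\sigma_1z_1\overline{z_1'}+\sigma_2z_2\overline{z_2'}$; the identity is $(0,0)$ and $(z,t)^{-1}=(-z,-t)$. Haar measure is Lebesgue measure $dx\,dy\,dt$, $z=x+iy$. Vector fields: the right invariant vector fields used to define the CR structure and $\Box_b$ are $$Z_j=\partial_{z_j}-i\sigma_j\bar z_j\,\partial_t,\qquad \bar Z_j=\partial_{\bar z_j}+i\sigma_jz_j\,\partial_t,\qquad [Z_j,\bar Z_k]=2i\delta_{jk}\sigma_j\partial_t .$$ Kohn Laplacian on $(0,1)$-forms: $\Box_b$ is diagonal, $\Box_b(f_1\,d\bar z_1+f_2\,d\bar z_2)=(\Box_1f_1)\,d\bar z_1+(\Box_2f_2)\,d\bar z_2$, where $$\Box_k=-\frac12\sum_{j=1}^2(\bar Z_jZ_j+Z_j\bar Z_j)+\frac12\Big([Z_k,\bar Z_k]-\sum_{j\neq k}[Z_j,\bar Z_j]\Big).$$ ''Solvable via convolution with the kernel $N$'' on forms $f\,d\bar z_k$ means that $N$ (a locally integrable function on $G$, given by the formula when $z_1,z_2\ne0$, hence almost everywhere) is a fundamental solution, $\Box_kN=\delta_0$ in the sense of distributions; equivalently, for $f\in C_c^\infty(G)$ the function $(N*f)(g)=\int_GN(gh^{-1})f(h)\,dh$ satisfies $\Box_b\big((N*f)\,d\bar z_k\big)=f\,d\bar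 z_k$. *)

(* Defs.v *)
From HB Require Import structures.
From mathcomp Require Export all_boot all_order all_algebra.
From mathcomp Require Export complex.
From mathcomp Require Export all_classical all_reals all_analysis.
Import Order.TTheory GRing.Theory Num.Theory.
Import numFieldNormedType.Exports.

Set Implicit Arguments.
Unset Strict Implicit.
Unset Printing Implicit Defensive.

Local Open Scope classical_set_scope.
Local Open Scope ring_scope.
Local Open Scope complex_scope.

(* The point (z_1, z_2, t) of C^2 x R, with z_j = x_j + i y_j, is the tuple
   (((x_1, y_1), (x_2, y_2)), t); this gives C^2 x R the product norm, topology
   and sigma-algebra. The subscripts 1 and 2 are ord0 and ord_max in 'I_2. *)
Notation G R := (((R * R) * (R * R)) * R)%type.

Definition zc (R : realType) (j : 'I_2) (g : G R) : R[i] :=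
  let p := if j == ord0 then g.1.1 else g.1.2 in p.1 +i* p.2.

Definition tc (R : realType) (g : G R) : R := g.2.

Definition normsq (R : realType) (z : R[i]) : R :=
  complex.Re z ^+ 2 + complex.Im z ^+ 2.

Definition quadric (R : realType) (sigma : 'I_2 -> R)
    : set (R[i] * R[i] * R[i]) :=
  [set p | complex.Im p.2 =
           sigma ord0 * normsq p.1.1 + sigma ord_max * normsq p.1.2].

Definition quadric_point (R : realType) (sigma : 'I_2 -> R) (g : G R)
    : R[i] * R[i] * R[i] :=
  (zc ord0 g, zc ord_max g,
   tc g +i* (\sum_(j < 2) sigma j * normsq (zc j g))).

(* The identification of the quadric with C^2 x R, where t = Re w. *)
Lemma quadric_point_bij (R : realType) (sigma : 'I_2 -> R) :
  set_bij setT (quadric sigma) (quadric_point sigma).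
Proof.
split.
- move=> g _; rewrite /quadric /quadric_point /= !big_ord_recl big_ord0 addr0.
  by congr (_ + sigma _ * normsq (zc _ _)); apply/val_inj.
- by move=> [[[a b] [c d]] t] [[[a' b'] [c' d']] t'] _ _ [] -> -> -> -> ->.
- move=> [[[a b] [c d]] [t u]]; rewrite /quadric /= => ->.
  exists (((a, b), (c, d)), t) => //.
  rewrite /quadric_point !big_ord_recl big_ord0 addr0 /zc /tc /=.
  by congr (_, Complex _ (_ + sigma _ * _)); apply/val_inj.
Qed.

Definition phi (R : realType) (sigma : 'I_2 -> R) (g h : G R) : R[i] :=
  \sum_(j < 2) (sigma j)%:C * zc j g * (zc j h)^*%C.

Definition mulG (R : realType) (sigma : 'I_2 -> R) (g h : G R) : G R :=
  (g.1 + h.1, tc g + tc h + 2 * complex.Im (phi sigma g h)).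

Definition invG (R : realType) (g : G R) : G R := (- g.1, - tc g).

(* The library's sigma-finite instance of products is shadowed by the one of
   subprobabilities, so it is redeclared below on named products. *)
Lemma product_sigma_finite (d1 d2 : measure_display) (T1 : measurableType d1)
    (T2 : measurableType d2) (R : realType)
    (m1 : {sigma_finite_measure set T1 -> \bar R})
    (m2 : {sigma_finite_measure set T2 -> \bar R}) :
  sigma_finite setT (m1 \x m2)%E.
Proof.
have /sigma_finiteP[A [TA ndA Aoo]] := sigma_finiteT m1.
have /sigma_finiteP[B [TB ndB Boo]] := sigma_finiteT m2.
exists (fun n => A n `*` B n).
  rewrite -setXTT TA TB predeqE => -[x y]; split.
    move=> [/= [n _ Anx] [k _ Bky]]; exists (maxn n k) => //; split.
    - by move: x Anx; exact/subsetPset/ndA/leq_maxl.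
    - by move: y Bky; exact/subsetPset/ndB/leq_maxr.
  by move=> [n _ []/= ? ?]; split; exists n.
move=> k; have [? ?] := Aoo k; have [? ?] := Boo k.
split; first exact: measurableX.
by rewrite product_measure1E// lte_mul_pinfty// ge0_fin_numE.
Qed.

Definition lebesgueC (R : realType) :=
  (@lebesgue_measure R \x @lebesgue_measure R)%E.

HB.instance Definition _ (R : realType) := Measure.on (@lebesgueC R).
HB.instance Definition _ (R : realType) :=
  Measure_isSigmaFinite.Build _ _ _ (@lebesgueC R)
    (product_sigma_finite (@lebesgue_measure R) (@lebesgue_measure R)).

Definition lebesgueC2 (R : realType) := (@lebesgueC R \x @lebesgueC R)%E.

HB.instance Definition _ (R : realType) := Measure.on (@lebesgueC2 R).
HB.instance Definition _ (R : realType) :=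
  Measure_isSigmaFinite.Build _ _ _ (@lebesgueC2 R)
    (product_sigma_finite (@lebesgueC R) (@lebesgueC R)).

Definition haar (R : realType) := (@lebesgueC2 R \x @lebesgue_measure R)%E.

HB.instance Definition _ (R : realType) := Measure.on (@haar R).
HB.instance Definition _ (R : realType) :=
  Measure_isSigmaFinite.Build _ _ _ (@haar R)
    (product_sigma_finite (@lebesgueC2 R) (@lebesgue_measure R)).

Definition Cintegrable (d : measure_display) (T : measurableType d)
    (R : realType) (mu : {measure set T -> \bar R}) (D : set T)
    (f : T -> R[i]) : Prop :=
  mu.-integrable D (EFin \o (fun x => complex.Re (f x))) /\
  mu.-integrable D (EFin \o (fun x => complex.Im (f x))).

Definition Cintegral (d : measure_display) (T : measurableType d)
    (R : realType) (mu : {measure set T -> \bar R}) (D : set T)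
    (f : T -> R[i]) : R[i] :=
  Rintegral mu D (fun x => complex.Re (f x)) +i*
  Rintegral mu D (fun x => complex.Im (f x)).

(* C^n functions: the derivatives in all directions, up to order n, exist
   everywhere and are continuous. *)
Fixpoint Cn (R : realType) (n : nat) (u : G R -> R) : Prop :=
  continuous u /\
  (if n is n'.+1
   then forall v : G R, (forall g, derivable u g v) /\ Cn n' ('D_v u)
   else True).

Definition CCn (R : realType) (n : nat) (f : G R -> R[i]) : Prop :=
  Cn n (fun g => complex.Re (f g)) /\ Cn n (fun g => complex.Im (f g)).

Definition test_function (R : realType) (f : G R -> R[i]) : Prop :=
  (forall n, CCn n f) /\ compact (closure [set g | f g != 0]).

Definition locally_integrableG (R : realType) (N : G R -> R[i]) : Prop :=
  forall K : set (G R), compact K -> Cintegrable (@haar R) K N.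

Definition conv (R : realType) (sigma : 'I_2 -> R) (N f : G R -> R[i])
    : G R -> R[i] :=
  fun g => Cintegral (@haar R) setT (fun h => N (mulG sigma g (invG h)) * f h).

Definition e_x (R : realType) (j : 'I_2) : G R :=
  (if j == ord0 then ((1, 0), (0, 0)) else ((0, 0), (1, 0)), 0).
Definition e_y (R : realType) (j : 'I_2) : G R :=
  (if j == ord0 then ((0, 1), (0, 0)) else ((0, 0), (0, 1)), 0).
Definition e_t (R : realType) : G R := (0, 1).

(* The differential operators act both on functions G -> R[i] and on
   distributions, i.e. functionals (G -> R[i]) -> R[i]. Both are functions
   X -> R[i], so each operator is defined once, from the directional
   derivatives [D v] and the multiplications [mul a] by functions [a]. *)
Definition dz (R : realType) (X : Type) (D : G R -> (X -> R[i]) -> X -> R[i])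
    (j : 'I_2) (u : X -> R[i]) : X -> R[i] :=
  fun x => 2^-1 * (D (e_x R j) u x - 'i%C * D (e_y R j) u x).

Definition dzbar (R : realType) (X : Type)
    (D : G R -> (X -> R[i]) -> X -> R[i])
    (j : 'I_2) (u : X -> R[i]) : X -> R[i] :=
  fun x => 2^-1 * (D (e_x R j) u x + 'i%C * D (e_y R j) u x).

Definition vecZ (R : realType) (X : Type) (D : G R -> (X -> R[i]) -> X -> R[i])
    (mul : (G R -> R[i]) -> (X -> R[i]) -> X -> R[i]) (sigma : 'I_2 -> R)
    (j : 'I_2) (u : X -> R[i]) : X -> R[i] :=
  fun x => dz D j u x
    - mul (fun g => 'i%C * (sigma j)%:C * (zc j g)^*%C) (D (e_t R) u) x.

Definition vecZbar (R : realType) (X : Type)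
    (D : G R -> (X -> R[i]) -> X -> R[i])
    (mul : (G R -> R[i]) -> (X -> R[i]) -> X -> R[i]) (sigma : 'I_2 -> R)
    (j : 'I_2) (u : X -> R[i]) : X -> R[i] :=
  fun x => dzbar D j u x
    + mul (fun g => 'i%C * (sigma j)%:C * zc j g) (D (e_t R) u) x.

Definition Box (R : realType) (X : Type)
    (D : G R -> (X -> R[i]) -> X -> R[i])
    (mul : (G R -> R[i]) -> (X -> R[i]) -> X -> R[i]) (sigma : 'I_2 -> R)
    (k : 'I_2) (u : X -> R[i]) : X -> R[i] :=
  let L j := vecZ D mul sigma j in
  let Lbar j := vecZbar D mul sigma j in
  let comm j x := L j (Lbar j u) x - Lbar j (L j u) x in
  fun x =>
    - 2^-1 * \sum_(j < 2) (Lbar j (L j u) x + L j (Lbar j u) x)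
    + 2^-1 * (comm k x - \sum_(j < 2 | j != k) comm j x).

Definition fun_D (R : realType) (v : G R) (f : G R -> R[i]) : G R -> R[i] :=
  fun g => 'D_v (fun h => complex.Re (f h)) g +i*
           'D_v (fun h => complex.Im (f h)) g.

Definition fun_mul (R : realType) (a f : G R -> R[i]) : G R -> R[i] :=
  fun g => a g * f g.

Definition distr_D (R : realType) (v : G R) (T : (G R -> R[i]) -> R[i])
    : (G R -> R[i]) -> R[i] :=
  fun f => - T (fun_D v f).

Definition distr_mul (R : realType) (a : G R -> R[i])
    (T : (G R -> R[i]) -> R[i]) : (G R -> R[i]) -> R[i] :=
  fun f => T (fun_mul a f).

Definition distr_of (R : realType) (N : G R -> R[i])
    : (G R -> R[i]) -> R[i] :=
  fun f => Cintegral (@haar R) setT (fun g => N g * f g).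

Definition delta0 (R : realType) : (G R -> R[i]) -> R[i] :=
  fun f => f (0 : G R).

Definition fundamental_solution (R : realType) (sigma : 'I_2 -> R) (k : 'I_2)
    (N : G R -> R[i]) : Prop :=
  forall f, test_function f ->
    Box (@distr_D R) (@distr_mul R) sigma k (distr_of N) f = delta0 f.

(* The (0,1)-form f_1 dzbar_1 + f_2 dzbar_2, given by its coefficients. *)
Definition form01 (R : realType) : Type := 'I_2 -> G R -> R[i].

Definition form_dzbar (R : realType) (k : 'I_2) (f : G R -> R[i]) : form01 R :=
  fun j => if j == k then f else fun=> 0.

Definition box_b (R : realType) (sigma : 'I_2 -> R) (w : form01 R) : form01 R :=
  fun k => Box (@fun_D R) (@fun_mul R) sigma k (w k).

(* The requirement that N * f be C^2 makes the classical derivatives in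
   box_b meaningful: the library's derivative is a total function. *)
Definition solvable_by_convolution (R : realType) (sigma : 'I_2 -> R)
    (k : 'I_2) (N : G R -> R[i]) : Prop :=
  [/\ locally_integrableG N,
      fundamental_solution sigma k N &
      forall f : G R -> R[i], test_function f ->
        CCn 2 (conv sigma N f) /\
        box_b sigma (form_dzbar k (conv sigma N f)) = form_dzbar k f].

Definition s_ (R : realType) (sigma : 'I_2 -> R) (j : 'I_2) (r : R) : R :=
  (1 + r `^ sigma j) / (1 - r `^ sigma j).

(* The integrand of the kernels, with [c] = i or -i, and r^(sigma_m - 1). *)
Definition kernel_integrand (R : realType) (sigma : 'I_2 -> R) (c : R[i])
    (m : 'I_2) (g : G R) (r : R) : R[i] :=
  (sigma ord0 * sigma ord_max)%:C
  / (c * (tc g)%:C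
     + (\sum_(j < 2) s_ sigma j r * sigma j * normsq (zc j g))%:C) ^+ 2
  * (r `^ (sigma m - 1)
     / ((1 - r `^ sigma ord0) * (1 - r `^ sigma ord_max)))%:C.

Definition kernel_integral (R : realType) (sigma : 'I_2 -> R) (c : R[i])
    (m : 'I_2) (g : G R) : R[i] :=
  Cintegral (@lebesgue_measure R) `]0, 1[ (kernel_integrand sigma c m g).

Definition kernel1 (R : realType) (sigma : 'I_2 -> R) (g : G R) : R[i] :=
  ((pi ^+ 3)^-1)%:C * kernel_integral sigma 'i%C ord0 g
  + ((pi ^+ 3)^-1)%:C * kernel_integral sigma (- 'i%C) ord_max g.

Definition kernel2 (R : realType) (sigma : 'I_2 -> R) (g : G R) : R[i] :=
  ((pi ^+ 3)^-1)%:C * kernel_integral sigma 'i%C ord_max g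
  + ((pi ^+ 3)^-1)%:C * kernel_integral sigma (- 'i%C) ord0 g.

(* Main.v *)
From HB Require Import structures.
Require Import Defs.
From mathcomp Require Import ring lra measurable_realfun.
Import Order.TTheory GRing.Theory Num.Theory.
Import numFieldNormedType.Exports.

(** The kernel inverts the Kohn Laplacian because, before the integration in
    r, it becomes an exact derivative in r under that operator.

    Put a_j = r^sigma_j, alpha_j = s_j sigma_j, k' the index other than k and,
    for c = i or c = -i and eps >= 0,
      A = alpha_1 |z_1|^2 + alpha_2 |z_2|^2,   B = c t + A + eps,
      w = r^(sigma_m - 1) / ((1 - a_1) (1 - a_2)).
    The integrand of the kernel is sigma_1 sigma_2 w B^-2 with eps = 0.

    The commutators in the definition of Box_k cancel half of its terms and
    leave - Zbar_k Z_k - Z_k' Zbar_k' ([BoxE]). Each of these fields maps B to a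
    multiple of z_j or of its conjugate, so Box_k B^-2 is an explicit
    combination of B^-3 and B^-4 ([Box_tr_inv_den2], in weak form). On the other
    hand 2 r alpha_j' = alpha_j^2 - sigma_j^2, and this gives
      w Box_k B^-2 = 4 d/dr (r w B^-3)
    if m = k for c = i and m = k' for c = -i ([is_cderive_boundary]). This is
    the reason for the exponents in the two halves of the kernel.

    Let f be a test function and eps > 0. Pairing the kernel, cut to
    a <= r <= b, with the transpose of Box_k applied to f leaves the two boundary
    terms 4 sigma_1 sigma_2 r w int B^-3 f at r = a and r = b
    ([truncated_identity]). As a tends to 0, r w tends to 0. As b tends to 1 the
    alpha_j blow up; the substitution of alpha_j^(-1/2) z_j for z_j turns the
    term at b into a factor that tends to 1 times the integral of
    (c t + |z|^2 + eps)^-3 f(alpha^(-1/2) z, t), where f may be replaced by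
    f(0, t) in the limit. Polar coordinates in both copies of C evaluate the
    integral over z, and the regularized pairing is
      (pi^2 / 2) int f(0, t) / (eps + c t) dt
    ([regularized_pairing]). Adding the cases c = i and c = -i produces pi^2
    times a Poisson integral, which tends to pi^3 f(0) with eps
    ([cvg_poisson]); hence the constant in front of the kernel.

    The limits on the side of the kernel need a bound that is uniform in eps.
    From |B|^2 >= A^2 + t^2 >= (A^2)^(3/4) (t^2)^(1/4) and
    A^2 >= 4 alpha_1 alpha_2 |z_1 z_2|^2 the integrand is at most a constant times
      r^(sigma_m - 1) (1 - r)^(-1/2) |x_1 y_1 x_2 y_2|^(-3/4) |t|^(-1/2),
    which is locally integrable in all six variables
    ([modC_reg_factor_dominant]). By Fubini's theorem the kernel is then locally
    integrable and may be paired before the integration in r.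

    Finally, the fields are right invariant: on F(u, g) = f(u^-1 g) a field in
    the variable g is the opposite of the same field in the variable u. So
    Box_k (N * f)(g) is the pairing of the distribution Box_k N with the test
    function F(., g), that is f(g) ([Box_cconv], [fundamental_solvable]). *)

Set Implicit Arguments.
Unset Strict Implicit.
Unset Printing Implicit Defensive.

Local Open Scope classical_set_scope.
Local Open Scope ring_scope.
Local Open Scope complex_scope.

(** * Borel sets and affine changes of variables *)

Section Borel.
Variable R : realType.

Let rbox (q : (((rat * rat) * (rat * rat)) * rat) * rat) : set (G R) :=
  ((ball (ratr q.1.1.1.1 : R) (ratr q.2 : R) `*` ball (ratr q.1.1.1.2 : R) (ratr q.2 : R)) `*`
   (ball (ratr q.1.1.2.1 : R) (ratr q.2 : R) `*` ball (ratr q.1.1.2.2 : R) (ratr q.2 : R))) `*`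
  ball (ratr q.1.2 : R) (ratr q.2 : R).

(** The sigma-algebra on G is the product one, not the Borel one by definition;
    an open set is a countable union of boxes with rational data. *)
Lemma open_measurableG (U : set (G R)) : open U -> measurable U.
Proof.
move=> oU.
have -> : U = \bigcup_q (if asbool (rbox q `<=` U) then rbox q else set0).
  apply/seteqP; split => [p Up|p [q _]]; last by case: asboolP => // h /h.
  have /nbhs_ballP[e /= e0 eU] : nbhs p U by exact: open_nbhs_nbhs.
  have /rat_in_itvoo[d] : 0 < e / 2 by rewrite divr_gt0.
  rewrite in_itv /= => /andP[d0 de].
  have pick (x : R) : exists q : rat, ball (ratr q : R) (ratr d : R) x.
    have /rat_in_itvoo[q] : x - ratr d < x + ratr d.
      by rewrite ltrD2l gtrN.
    rewrite in_itv /= => /andP[q1 q2]; exists q.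
    by rewrite /ball/= ltr_distlC; lra.
  case: p Up eU => [[[x1 y1] [x2 y2]] t] Up eU.
  have [q1 h1] := pick x1; have [q2 h2] := pick y1; have [q3 h3] := pick x2.
  have [q4 h4] := pick y2; have [q5 h5] := pick t.
  exists ((((q1, q2), (q3, q4)), q5), d) => //.
  have near (q : rat) (x y : R) : ball (ratr q : R) (ratr d : R) x ->
      ball (ratr q : R) (ratr d : R) y -> ball x e y.
    rewrite /ball/= !ltr_distlC => /andP[? ?] /andP[? ?]; apply/andP; split; lra.
  case: asboolP => // -[]; move=> [[[a1 b1] [a2 b2]] s] [[[/= k1 k2] [/= k3 k4]] /= k5].
  apply: eU; split => /=; first split => /=; first split => /=.
  - exact: (near q1).
  - exact: (near q2).
  - by split; [exact: (near q3)|exact: (near q4)].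
  - exact: (near q5).
apply: countable_bigcupT_measurable => // q.
case: asboolP => // _.
by do !apply: measurableX; apply: open_measurable; exact: ball_open.
Qed.

Lemma closed_measurableG (U : set (G R)) : closed U -> measurable U.
Proof. by move/closed_openC/open_measurableG/measurableC; rewrite setCK. Qed.

Lemma compact_measurableG (U : set (G R)) : compact U -> measurable U.
Proof.
by move=> cU; apply: closed_measurableG; apply: compact_closed => //; exact: norm_hausdorff.
Qed.

Lemma continuous_measurableG (f : G R -> R) :
  continuous f -> measurable_fun setT f.
Proof.
move=> /continuousP cf; apply: (measurability _ (RGenOpens.measurableE R)).
move=> _ [_ [a [b ->] <-]]; rewrite setTI; apply: open_measurableG.
exact/cf/interval_open.
Qed.

End Borel.

Section Scaling.
Local Open Scope ereal_scope.
Context (R : realType).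

Lemma lebesgue_measure_affine (k c : R) (A : set R) : (0 < k)%R -> measurable A ->
  lebesgue_measure ((fun x => k * x + c)%R @^-1` A) = (k^-1)%:E * lebesgue_measure A.
Proof.
move=> k0 mA.
have mphi : measurable_fun [set: measurableTypeR R]
    ((fun x => k * x + c)%R : _ -> measurableTypeR R).
  by apply: measurable_funD => //; exact: measurable_funM.
pose phi : measurableTypeR R -> measurableTypeR R := (fun x => k * x + c)%R.
pose m : {measure set _ -> \bar R} :=
  mscale (NngNum (ltW k0)) (pushforward lebesgue_measure phi).
have -> : lebesgue_measure A = m mphi A.
  apply: lebesgue_measure_unique => // _ [[a b]] _ <- /=.
  rewrite /m /mscale /= /pushforward.
  have -> : (fun x => k * x + c)%R @^-1` `]a, b]%classic =
      `]((a - c) / k)%R, ((b - c) / k)%R]%classic :> set R.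
    apply/seteqP; split => x /=; rewrite !in_itv /=;
      by rewrite ltr_pdivrMr// ler_pdivlMr// ltrBlDr lerBrDr mulrC.
  rewrite !lebesgue_measure_itv/= !lte_fin ltr_pM2r ?invr_gt0// ltrD2r.
  case: ifPn => ab; last by rewrite mule0.
  rewrite -!EFinD -EFinM; congr EFin; field.
  exact: lt0r_neq0.
rewrite /m /mscale /= muleA -EFinM mulVf ?mul1e//.
exact: lt0r_neq0.
Qed.

(** The second factor may be moved by a map that depends on the first
    coordinate, as in the group law, where t is sheared by z. *)
Lemma product_measure_skew d1 d2 (T1 : measurableType d1) (T2 : measurableType d2)
    (m1 : {sigma_finite_measure set T1 -> \bar R})
    (m2 : {sigma_finite_measure set T2 -> \bar R})
    (phi : T1 -> T1) (psi : T1 -> T2 -> T2) (c1 c2 : R) (A : set (T1 * T2)) :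
  (0 <= c1)%R -> (0 <= c2)%R ->
  measurable_fun setT phi ->
  (forall B, measurable B -> m1 (phi @^-1` B) = c1%:E * m1 B) ->
  (forall x B, measurable B -> m2 (psi x @^-1` B) = c2%:E * m2 B) ->
  measurable A ->
  (m1 \x m2) ((fun p => (phi p.1, psi p.1 p.2)) @^-1` A) =
    (c1 * c2)%:E * (m1 \x m2) A.
Proof.
move=> c10 c20 mphi h1 h2 mA.
rewrite /product_measure1 /=.
transitivity (\int[m1]_x (c2%:E * m2 (xsection A (phi x)))).
  apply: eq_integral => x _ /=; rewrite -(h2 x); last exact: measurable_xsection.
  congr (m2 _); apply/seteqP; split => y; by rewrite /xsection/= !inE.
have mx : measurable_fun setT (fun x => m2 (xsection A x)).
  exact: measurable_fun_xsection.
rewrite ge0_integralZl//=; last first.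
  exact: (measurableT_comp mx mphi).
have -> : \int[m1]_x m2 (xsection A (phi x)) =
    \int[pushforward m1 phi]_x m2 (xsection A x).
  by rewrite ge0_integral_pushforward//= preimage_setT.
rewrite (eq_measure_integral (mscale (NngNum c10) m1)); last first.
  by move=> B mB _; exact: h1 || exact: esym (h1 _ mB).
by rewrite ge0_integral_mscale//= [in LHS]muleA -EFinM [(c2 * c1)%R]mulrC.
Qed.

Lemma lebesgue_measure_affine_neq0 (k c : R) (A : set R) : k != 0%R -> measurable A ->
  lebesgue_measure ((fun x => k * x + c)%R @^-1` A) = `|k|^-1%:E * lebesgue_measure A.
Proof.
move=> k0 mA; have [k_gt0|k_lt0] := ltP 0%R k.
  by rewrite gtr0_norm// lebesgue_measure_affine.
have kN : (0 < - k)%R by rewrite oppr_gt0 lt_neqAle k0.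
have <- : (-%R : R -> R) @^-1` ((fun x => - k * x + c)%R @^-1` A) =
    (fun x => k * x + c)%R @^-1` A.
  by apply/seteqP; split => x /=; rewrite mulrNN.
rewrite ler0_norm// -(lebesgue_measure_affine c kN mA).
apply: lebesgue_measureN.
have mf : measurable_fun setT (fun x : R => - k * x + c)%R.
  by apply: measurable_funD => //; exact: measurable_funM.
by rewrite -[X in measurable X]setTI; exact: mf.
Qed.

Section integral_scale.
Context d (T : measurableType d) (m : {sigma_finite_measure set T -> \bar R}).
Variables (c : R) (phi : T -> T).
Hypotheses (c0 : (0 <= c)%R) (mphi : measurable_fun setT phi).
Hypothesis h : forall A, measurable A -> m (phi @^-1` A) = c%:E * m A.

Lemma ge0_integral_scale (f : T -> \bar R) : measurable_fun setT f ->
  (forall x, 0 <= f x) -> \int[m]_x f (phi x) = c%:E * \int[m]_x f x.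
Proof.
move=> mf f0.
have -> : \int[m]_x f (phi x) = \int[pushforward m phi]_x f x.
  by rewrite ge0_integral_pushforward//= preimage_setT.
rewrite (eq_measure_integral (mscale (NngNum c0) m)); last first.
  by move=> B mB _; exact: h || exact: esym (h _ mB).
by rewrite ge0_integral_mscale.
Qed.

Lemma integrable_scale (f : T -> R) : m.-integrable setT (EFin \o f) ->
  m.-integrable setT (EFin \o (f \o phi)).
Proof.
move=> /integrableP[mf foo]; apply/integrableP; split.
  exact: (measurableT_comp mf mphi).
rewrite (ge0_integral_scale (f := fun x => `|(f x)%:E|))//.
  by rewrite lte_mul_pinfty.
exact: measurableT_comp mf.
Qed.

Lemma Rintegral_scale (f : T -> R) : m.-integrable setT (EFin \o f) ->
  (\int[m]_x f (phi x) = c * \int[m]_x f x)%R.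
Proof.
move=> fi; have mf := measurable_int _ fi.
have fphi := integrable_scale fi.
rewrite /Rintegral integralE.
rewrite (_ : \int[m]_x _ = c%:E * \int[m]_x ((EFin \o f)^\+ x)); last first.
  rewrite -ge0_integral_scale//; last exact: measurable_funepos.
  by apply: eq_integral => x _; rewrite !funeposE.
rewrite (_ : \int[m]_x ((fun x => (f (phi x))%:E)^\- x) = c%:E * \int[m]_x ((EFin \o f)^\- x)); last first.
  rewrite -ge0_integral_scale//; last exact: measurable_funeneg.
  by apply: eq_integral => x _; rewrite !funenegE.
rewrite [in RHS]integralE.
have h1 := integrable_pos_fin_num measurableT fi; have h2 := integrable_neg_fin_num measurableT fi.
by rewrite -muleBr ?fin_num_adde_defr// fineM// fin_numB h1 h2.
Qed.

End integral_scale.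

End Scaling.

Section Haar.
Context (R : realType).

Lemma measurable_affine (k c : R) : measurable_fun setT (fun x : R => k * x + c).
Proof. by apply: measurable_funD => //; exact: measurable_funM. Qed.

(** Diagonal affine maps with a shear of t cover all changes of variables used
    below: translations, group translations, the inversion and dilations. *)
Definition haar_map (k c : nat -> R) (s : G R -> R) (g : G R) : G R :=
  (((k 0%N * g.1.1.1 + c 0%N, k 1%N * g.1.1.2 + c 1%N),
   (k 2%N * g.1.2.1 + c 2%N, k 3%N * g.1.2.2 + c 3%N)),
   k 4%N * g.2 + s (g.1, 0)).

Lemma measurable_haar_map k c s : measurable_fun setT s -> measurable_fun setT (haar_map k c s).
Proof.
move=> ms; apply: measurable_fun_pair => /=; first apply: measurable_fun_pair => /=.
- apply: measurable_fun_pair => /=.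
    apply: (measurableT_comp (measurable_affine _ _)).
    by do 2 apply: measurableT_comp => //.
  apply: (measurableT_comp (measurable_affine _ _)).
  by do 2 apply: measurableT_comp => //.
- apply: measurable_fun_pair => /=.
    apply: (measurableT_comp (measurable_affine _ _)).
    by do 2 apply: measurableT_comp => //.
  apply: (measurableT_comp (measurable_affine _ _)).
  by do 2 apply: measurableT_comp => //.
- apply: measurable_funD; first exact: measurable_funM.
  apply: measurableT_comp => //; exact: measurable_fun_pair.
Qed.

Lemma haar_haar_map (k c : nat -> R) (s : G R -> R) (A : set (G R)) : measurable_fun setT s ->
  (forall i, k i != 0) -> measurable A ->
  haar (haar_map k c s @^-1` A) = ((`|k 0%N|^-1 * `|k 1%N|^-1 * (`|k 2%N|^-1 * `|k 3%N|^-1) * `|k 4%N|^-1)%:E * haar A)%E.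
Proof.
move=> ms k0 mA; pose K i := `|k i|^-1.
have K0 i : 0 <= K i by rewrite invr_ge0.
have H i (c' : R) B : measurable B ->
    lebesgue_measure ((fun x => k i * x + c') @^-1` B) = ((K i)%:E * lebesgue_measure B)%E.
  by move=> mB; exact: lebesgue_measure_affine_neq0.
have HC i j c1 c2 (B : set (R * R)) : measurable B ->
    @lebesgueC R ((fun p => (k i * p.1 + c1, k j * p.2 + c2)) @^-1` B)
    = ((K i * K j)%:E * @lebesgueC R B)%E.
  move=> mB; apply: (@product_measure_skew _ _ _ _ _ (@lebesgue_measure R) (@lebesgue_measure R) (fun x => k i * x + c1)
    (fun _ x => k j * x + c2)) => //.
  exact: measurable_affine.
  by move=> *; exact: H.
  by move=> *; exact: H.
have mC i j c1 c2 : measurable_fun setT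
    (fun p : R * R => (k i * p.1 + c1, k j * p.2 + c2)).
  by apply: measurable_fun_pair => /=; apply: (measurableT_comp (measurable_affine _ _)).
have HC2 c1 c2 c3 c4 (B : set ((R * R) * (R * R))) : measurable B ->
    @lebesgueC2 R ((fun p => ((k 0%N * p.1.1 + c1, k 1%N * p.1.2 + c2),
       (k 2%N * p.2.1 + c3, k 3%N * p.2.2 + c4))) @^-1` B)
    = (((K 0%N * K 1%N) * (K 2%N * K 3%N))%:E * @lebesgueC2 R B)%E.
  move=> mB; apply: (@product_measure_skew _ _ _ _ _ (@lebesgueC R) (@lebesgueC R)
    (fun p => (k 0%N * p.1 + c1, k 1%N * p.2 + c2))
    (fun _ p => (k 2%N * p.1 + c3, k 3%N * p.2 + c4))) => //.
  by rewrite mulr_ge0.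
  by rewrite mulr_ge0.
  exact: mC.
  by move=> *; exact: HC.
  by move=> *; exact: HC.
apply: (@product_measure_skew _ _ _ _ _ (@lebesgueC2 R) (@lebesgue_measure R)
    (fun p => ((k 0%N * p.1.1 + c 0%N, k 1%N * p.1.2 + c 1%N),
       (k 2%N * p.2.1 + c 2%N, k 3%N * p.2.2 + c 3%N)))
    (fun p x => k 4%N * x + s (p, 0))) => //.
- apply: measurable_fun_pair => /=.
    exact: (measurableT_comp (mC 0%N 1%N _ _) measurable_fst).
  exact: (measurableT_comp (mC 2%N 3%N _ _) measurable_snd).
- by move=> *; exact: HC2.
- by move=> *; exact: H.
Qed.

End Haar.

(** * Integration of complex-valued functions *)

Notation Re := complex.Re.
Notation Im := complex.Im.
Notation modC := ComplexField.Normc.normc.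

Section ComplexBasics.
Variable R : realType.
Implicit Types x y : R[i].

Lemma ReD x y : Re (x + y) = Re x + Re y. Proof. by case: x y => ? ? []. Qed.
Lemma ImD x y : Im (x + y) = Im x + Im y. Proof. by case: x y => ? ? []. Qed.
Lemma ReN x : Re (- x) = - Re x. Proof. by case: x. Qed.
Lemma ImN x : Im (- x) = - Im x. Proof. by case: x. Qed.
Lemma ReM x y : Re (x * y) = Re x * Re y - Im x * Im y.
Proof. by case: x y => ? ? []. Qed.
Lemma ImM x y : Im (x * y) = Re x * Im y + Im x * Re y.
Proof. by case: x y => ? ? []. Qed.
Lemma ReV x : Re x^-1 = Re x / normsq x. Proof. by case: x. Qed.
Lemma ImV x : Im x^-1 = - (Im x / normsq x).
Proof. by case: x => a b; rewrite /normsq/=. Qed.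
Lemma complexP x y : Re x = Re y -> Im x = Im y -> x = y.
Proof. by case: x y => ? ? [? ?] /= -> ->. Qed.

Lemma modCE x : modC x = Num.sqrt (normsq x). Proof. by case: x. Qed.
Lemma modC_ge0 x : 0 <= modC x. Proof. by rewrite modCE sqrtr_ge0. Qed.
Lemma normsq_ge0 x : 0 <= normsq x. Proof. by rewrite addr_ge0// sqr_ge0. Qed.
Lemma Re_le_modC x : `|Re x| <= modC x.
Proof.
rewrite modCE -sqrtr_sqr ler_wsqrtr// /normsq lerDl sqr_ge0 //.
Qed.
Lemma Im_le_modC x : `|Im x| <= modC x.
Proof.
rewrite modCE -sqrtr_sqr ler_wsqrtr// /normsq lerDr sqr_ge0 //.
Qed.
Lemma modC_le x : modC x <= `|Re x| + `|Im x|.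
Proof.
rewrite modCE -(ger0_norm (addr_ge0 (normr_ge0 (Re x)) (normr_ge0 (Im x)))).
rewrite -sqrtr_sqr ler_wsqrtr// /normsq sqrrD -[Re x ^+ 2]real_normK ?num_real//.
rewrite -[Im x ^+ 2]real_normK ?num_real// lerD2r lerDl mulrn_wge0// mulr_ge0//.
Qed.
Lemma modCM x y : modC (x * y) = modC x * modC y.
Proof. exact: ComplexField.Normc.normcM. Qed.
Lemma modCV x : modC x^-1 = (modC x)^-1.
Proof. exact: ComplexField.Normc.normcV. Qed.
Lemma modCR (a : R) : modC a%:C = `|a|.
Proof. by rewrite modCE /normsq/= expr0n/= addr0 sqrtr_sqr. Qed.
Lemma modC0 : modC (0 : R[i]) = 0.
Proof. exact: ComplexField.Normc.normc0. Qed.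
Lemma modCN x : modC (- x) = modC x.
Proof. by rewrite !modCE /normsq ReN ImN !sqrrN. Qed.
Lemma le_modCD x y : modC (x + y) <= modC x + modC y.
Proof. by rewrite -lecR rmorphD /=; exact: (@ler_normD _ R[i]). Qed.
Lemma normsq_neq0 x : x != 0 -> normsq x != 0.
Proof.
apply: contra; rewrite /normsq paddr_eq0 ?sqr_ge0// !sqrf_eq0 => /andP[/eqP h1 /eqP h2].
by apply/eqP; apply: complexP; rewrite ?h1 ?h2.
Qed.
Lemma modCX x n : modC (x ^+ n) = modC x ^+ n.
Proof.
elim: n => [|n IH]; first by rewrite !expr0 ComplexField.Normc.normc1.
by rewrite !exprS modCM IH.
Qed.
End ComplexBasics.

Section Cmeasurable.
Context d (T : measurableType d) (R : realType).
Implicit Types (f g : T -> R[i]) (D : set T).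

Definition Cmeas D f := measurable_fun D (fun x => Re (f x)) /\
  measurable_fun D (fun x => Im (f x)).

Lemma Cmeas_cst D (c : R[i]) : Cmeas D (fun=> c).
Proof. by []. Qed.

Lemma CmeasD D f g : Cmeas D f -> Cmeas D g -> Cmeas D (fun x => f x + g x).
Proof.
move=> [f1 f2] [g1 g2]; split.
  by under eq_fun do rewrite ReD; exact: measurable_funD.
by under eq_fun do rewrite ImD; exact: measurable_funD.
Qed.

Lemma CmeasM D f g : Cmeas D f -> Cmeas D g -> Cmeas D (fun x => f x * g x).
Proof.
move=> [f1 f2] [g1 g2]; split.
  by under eq_fun do rewrite ReM; apply: measurable_funB; exact: measurable_funM.
by under eq_fun do rewrite ImM; apply: measurable_funD; exact: measurable_funM.
Qed.

Lemma CmeasR D (f : T -> R) : measurable_fun D f -> Cmeas D (fun x => (f x)%:C).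
Proof. by []. Qed.

(** The inverse of a total function that may vanish is x (x^2)^(-1), a product
    of measurable functions. *)
Lemma measurable_invr D (f : T -> R) : measurable D ->
  measurable_fun D f -> measurable_fun D (fun x => (f x)^-1).
Proof.
move=> mD mf.
have -> : (fun x => (f x)^-1) = (fun x => f x * (f x ^+ 2) `^ (-1)).
  apply/funext => x; have [->|fx0] := eqVneq (f x) 0; first by rewrite invr0 mul0r.
  by rewrite powR_inv1 ?sqr_ge0//; field.
apply: measurable_funM => //.
apply: (measurableT_comp (f := fun x : R => x `^ (-1))); first exact: measurable_powR.
exact: measurable_funX.
Qed.

Lemma CmeasV D f : measurable D -> Cmeas D f -> Cmeas D (fun x => (f x)^-1).
Proof.
move=> mD [f1 f2].
have m : measurable_fun D (fun x => (normsq (f x))^-1).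
  by apply: measurable_invr => //; apply: measurable_funD; exact: measurable_funX.
split.
  by under eq_fun do rewrite ReV; exact: measurable_funM.
under eq_fun do rewrite ImV; apply: measurable_funN; exact: measurable_funM.
Qed.

Lemma CmeasX D f n : Cmeas D f -> Cmeas D (fun x => f x ^+ n).
Proof.
move=> mf; elim: n => [|n IH]; first exact: Cmeas_cst.
by under eq_fun do rewrite exprS; exact: CmeasM.
Qed.

Lemma measurable_modC D f : Cmeas D f -> measurable_fun D (fun x => modC (f x)).
Proof.
move=> [f1 f2]; under eq_fun do rewrite modCE.
apply: (measurableT_comp (f := fun x : R => Num.sqrt x)).
  apply: continuous_measurable_fun; exact: sqrt_continuous.
by apply: measurable_funD; exact: measurable_funX.
Qed.

End Cmeasurable.

Section Cintegration.
Context d (T : measurableType d) (R : realType) (mu : {measure set T -> \bar R}).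
Variables (D : set T) (mD : measurable D).
Implicit Types (f g : T -> R[i]).

Lemma Cintegrable_meas f : Cintegrable mu D f -> Cmeas D f.
Proof. by move=> [/measurable_int/measurable_EFinP ? /measurable_int/measurable_EFinP]. Qed.

Lemma eq_Cintegral f g : (forall x, D x -> f x = g x) ->
  Cintegral mu D f = Cintegral mu D g.
Proof.
by move=> fg; congr Complex; apply: eq_Rintegral => x /set_mem Dx; rewrite fg.
Qed.

Lemma eq_Cintegrable f g : (forall x, D x -> f x = g x) ->
  Cintegrable mu D f -> Cintegrable mu D g.
Proof.
move=> fg [h1 h2]; split; [move: h1|move: h2]; apply: eq_integrable => // x /set_mem Dx;
  by rewrite /= fg.
Qed.

Lemma CintegrableD f g : Cintegrable mu D f -> Cintegrable mu D g ->
  Cintegrable mu D (fun x => f x + g x).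
Proof.
move=> [f1 f2] [g1 g2]; split.
  move: (integrableD mD f1 g1); apply: eq_integrable => // x _; by rewrite /= ReD.
move: (integrableD mD f2 g2); apply: eq_integrable => // x _; by rewrite /= ImD.
Qed.

Lemma CintegralD f g : Cintegrable mu D f -> Cintegrable mu D g ->
  Cintegral mu D (fun x => f x + g x) = Cintegral mu D f + Cintegral mu D g.
Proof.
move=> [f1 f2] [g1 g2]; apply: complexP; rewrite ?ReD ?ImD /=.
  by rewrite -RintegralD//; apply: eq_Rintegral => x _; rewrite ReD.
by rewrite -RintegralD//; apply: eq_Rintegral => x _; rewrite ImD.
Qed.

Let intZ (k : R) (f : T -> R) : mu.-integrable D (EFin \o f) ->
  mu.-integrable D (EFin \o (fun x => k * f x)).
Proof. by move=> h; move: (integrableZl mD k h); apply: eq_integrable => // x _; by rewrite /= //. Qed.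

Let intB (f g : T -> R) : mu.-integrable D (EFin \o f) -> mu.-integrable D (EFin \o g) ->
  mu.-integrable D (EFin \o (fun x => f x - g x)).
Proof. by move=> h h'; move: (integrableB mD h h'); apply: eq_integrable => // x _; by rewrite /= //. Qed.

Let intD (f g : T -> R) : mu.-integrable D (EFin \o f) -> mu.-integrable D (EFin \o g) ->
  mu.-integrable D (EFin \o (fun x => f x + g x)).
Proof. by move=> h h'; move: (integrableD mD h h'); apply: eq_integrable => // x _; by rewrite /= //. Qed.

Lemma CintegrableZ (c : R[i]) f : Cintegrable mu D f -> Cintegrable mu D (fun x => c * f x).
Proof.
move=> [f1 f2]; split.
  rewrite (_ : (fun x => _) = (fun x => Re c * Re (f x) - Im c * Im (f x))).
    by apply: intB; exact: intZ.
  by apply/funext => x; rewrite ReM.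
rewrite (_ : (fun x => _) = (fun x => Re c * Im (f x) + Im c * Re (f x))).
  by apply: intD; exact: intZ.
by apply/funext => x; rewrite ImM.
Qed.

Lemma CintegralZ (c : R[i]) f : Cintegrable mu D f ->
  Cintegral mu D (fun x => c * f x) = c * Cintegral mu D f.
Proof.
move=> [f1 f2]; apply: complexP; rewrite ?ReM ?ImM /=.
  rewrite -!RintegralZl// -RintegralB//; try exact: intZ.
  by apply: eq_Rintegral => x _; rewrite ReM.
rewrite -!RintegralZl// -RintegralD//; try exact: intZ.
by apply: eq_Rintegral => x _; rewrite ImM.
Qed.

Lemma CintegrableN f : Cintegrable mu D f -> Cintegrable mu D (fun x => - f x).
Proof. by move=> /(CintegrableZ (-1)); apply: eq_Cintegrable => x _; rewrite mulN1r. Qed.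

Lemma CintegralN f : Cintegrable mu D f ->
  Cintegral mu D (fun x => - f x) = - Cintegral mu D f.
Proof.
by move=> h; rewrite -mulN1r -CintegralZ//; apply: eq_Cintegral => x _; rewrite mulN1r.
Qed.

Lemma CintegrableB f g : Cintegrable mu D f -> Cintegrable mu D g ->
  Cintegrable mu D (fun x => f x - g x).
Proof. by move=> hf hg; apply: CintegrableD => //; exact: CintegrableN. Qed.

Lemma CintegralB f g : Cintegrable mu D f -> Cintegrable mu D g ->
  Cintegral mu D (fun x => f x - g x) = Cintegral mu D f - Cintegral mu D g.
Proof.
move=> hf hg; rewrite -CintegralN// -CintegralD//; exact: CintegrableN.
Qed.

Lemma le_Cintegrable f (g : T -> R) : Cmeas D f -> mu.-integrable D (EFin \o g) ->
  (forall x, D x -> modC (f x) <= g x) -> Cintegrable mu D f.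
Proof.
move=> [m1 m2] ig fg; split; apply: (le_integrable mD _ _ ig).
- exact/measurable_EFinP.
- move=> x Dx /=; rewrite lee_fin (le_trans (Re_le_modC _))// (le_trans (fg x Dx))//.
  exact: ler_norm.
- exact/measurable_EFinP.
- move=> x Dx /=; rewrite lee_fin (le_trans (Im_le_modC _))// (le_trans (fg x Dx))//.
  exact: ler_norm.
Qed.

Lemma Cintegrable_mod f : Cintegrable mu D f ->
  mu.-integrable D (EFin \o (fun x => modC (f x))).
Proof.
move=> fi; have mf := Cintegrable_meas fi; case: fi => f1 f2.
apply: (le_integrable mD _ _ (intD (integrable_norm f1) (integrable_norm f2))).
  exact/measurable_EFinP/measurable_modC.
move=> x Dx /=; rewrite lee_fin ger0_norm ?modC_ge0//.
by rewrite ger0_norm ?addr_ge0// modC_le.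
Qed.

Lemma CintegrableMb (h f : T -> R[i]) (M : R) : Cmeas D h ->
  (forall x, D x -> modC (h x) <= M) -> Cintegrable mu D f ->
  Cintegrable mu D (fun x => h x * f x).
Proof.
move=> mh hM fi.
apply: (@le_Cintegrable _ (fun x => M * modC (f x))).
- by apply: CmeasM => //; exact: Cintegrable_meas.
- exact/intZ/Cintegrable_mod.
- by move=> x Dx; rewrite modCM ler_wpM2r ?modC_ge0// hM.
Qed.

Definition cvgC (u : nat -> R[i]) (l : R[i]) :=
  ((fun n => Re (u n)) @ \oo --> Re l) /\ ((fun n => Im (u n)) @ \oo --> Im l).

Lemma Rdominated (f_ : nat -> T -> R) (f g : T -> R) :
  (forall n, measurable_fun D (f_ n)) -> measurable_fun D f ->
  mu.-integrable D (EFin \o g) ->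
  {ae mu, forall x, D x -> (f_ ^~ x) @ \oo --> f x} ->
  {ae mu, forall x, D x -> forall n, `|f_ n x| <= g x} ->
  (fun n => Rintegral mu D (f_ n)) @ \oo --> Rintegral mu D f.
Proof.
move=> mf_ mf ig cvf fg.
have [] := @dominated_convergence _ _ _ mu D mD (fun n x => (f_ n x)%:E)
  (fun x => (f x)%:E) (EFin \o g) _ _ _ ig _.
- by move=> n; exact/measurable_EFinP.
- exact/measurable_EFinP.
- move: cvf; apply: filterS => x h Dx; apply: cvg_EFin; last exact: h.
  by apply: nearW.
- by move: fg; apply: filterS => x h n Dx; rewrite /= lee_fin h.
move=> fi _ cv; apply: fine_cvg; rewrite fineK//; exact: integrable_fin_num.
Qed.

Lemma Cdominated (f_ : nat -> T -> R[i]) (f : T -> R[i]) (g : T -> R) :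
  (forall n, Cmeas D (f_ n)) -> Cmeas D f ->
  mu.-integrable D (EFin \o g) ->
  {ae mu, forall x, D x -> cvgC (f_ ^~ x) (f x)} ->
  {ae mu, forall x, D x -> forall n, modC (f_ n x) <= g x} ->
  cvgC (fun n => Cintegral mu D (f_ n)) (Cintegral mu D f).
Proof.
move=> mf_ mf ig cvf fg; split; apply: (@Rdominated _ _ g) => //.
- by move=> n; have [] := mf_ n.
- by have [] := mf.
- by move: cvf; apply: filterS => x h /h[].
- by move: fg; apply: filterS => x h Dx n; rewrite (le_trans (Re_le_modC _))// h.
- by move=> n; have [] := mf_ n.
- by have [] := mf.
- by move: cvf; apply: filterS => x h /h[].
- by move: fg; apply: filterS => x h Dx n; rewrite (le_trans (Im_le_modC _))// h.
Qed.

End Cintegration.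

Section Cfubini.
Context d1 d2 (T1 : measurableType d1) (T2 : measurableType d2) (R : realType).
Variable m1 : {sigma_finite_measure set T1 -> \bar R}.
Variable m2 : {sigma_finite_measure set T2 -> \bar R}.

(** The inner integral is real-valued and total, so it agrees with the
    extended-real one only at the almost all points where the section is
    integrable. *)
Lemma Rfubini1 (f : T1 * T2 -> R) : (m1 \x m2)%E.-integrable setT (EFin \o f) ->
  m1.-integrable setT (EFin \o (fun x => Rintegral m2 setT (fun y => f (x, y)))) /\
  Rintegral (m1 \x m2)%E setT f = Rintegral m1 setT (fun x => Rintegral m2 setT (fun y => f (x, y))).
Proof.
move=> fi.
have h1 := integrable_fubini_F fi; have h2 := integral12_prod_meas1 fi.
have ae := ae_integrable1 fi.
have aeq : {ae m1, forall x, setT x -> fubini_F m2 (EFin \o f) x =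
     (Rintegral m2 setT (fun y => f (x, y)))%:E}.
  move: ae; apply: filterS => x h _; rewrite /Rintegral fineK//.
  exact: integrable_fin_num h.
have mF : measurable_fun setT (fun x => (Rintegral m2 setT (fun y => f (x, y)))%:E).
  apply/measurable_EFinP; rewrite /Rintegral.
  apply: (measurableT_comp (f := fine)) => //; exact: (measurable_int _ h1).
split.
  apply/integrableP; split => //.
  move/integrableP : h1 => [_]; apply: le_lt_trans; rewrite le_eqVlt; apply/orP; left.
  apply/eqP; apply: ae_eq_integral => //.
  - exact: measurableT_comp.
  - by apply: measurableT_comp => //; exact: (measurable_int _ (integrable_fubini_F fi)).
  - by move: aeq; apply: filterS => x h _; rewrite /= h.
rewrite [LHS]/Rintegral -h2 [RHS]/Rintegral; congr fine.
apply: ae_eq_integral => //; exact: (measurable_int _ h1).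
Qed.

Lemma Rfubini2 (f : T1 * T2 -> R) : (m1 \x m2)%E.-integrable setT (EFin \o f) ->
  m2.-integrable setT (EFin \o (fun y => Rintegral m1 setT (fun x => f (x, y)))) /\
  Rintegral (m1 \x m2)%E setT f = Rintegral m2 setT (fun y => Rintegral m1 setT (fun x => f (x, y))).
Proof.
move=> fi.
have h2 := integral21_prod_meas1 fi.
have mG := measurable_fubini_G fi.
have ae := ae_integrable2 fi.
have aeq : {ae m2, forall x, setT x -> fubini_G m1 (EFin \o f) x =
     (Rintegral m1 setT (fun y => f (y, x)))%:E}.
  move: ae; apply: filterS => x h _; rewrite /Rintegral fineK//.
  exact: integrable_fin_num h.
have mF : measurable_fun setT (fun x => (Rintegral m1 setT (fun y => f (y, x)))%:E).
  apply/measurable_EFinP; rewrite /Rintegral.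
  by apply: (measurableT_comp (f := fine)).
split.
  apply/integrableP; split => //.
  have /(integrable21ltyP m1 m2) := fi => /(_ (measurable_int _ fi)).
  apply: le_lt_trans; apply: ge0_le_integral => //.
  - exact: measurableT_comp.
  - have := @measurable_fun_fubini_tonelli_G _ _ T1 T2 R m1 (fun z => `|(f z)%:E|%E).
    rewrite /fubini_G; apply => //.
    by apply: measurableT_comp => //; exact: (measurable_int _ fi).
  - move=> y _; rewrite /= /Rintegral.
    apply: (@le_trans _ _ `|\int[m1]_x (f (x, y))%:E|%E).
      by case: (\int[m1]_x (f (x, y))%:E)%E => [r| |] //=; rewrite normr0 leey.
    apply: le_abse_integral => //.
    by apply: (measurableT_comp (measurable_int _ fi)); exact: pair2_measurable.
rewrite [LHS]/Rintegral -h2 [RHS]/Rintegral; congr fine.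
by apply: ae_eq_integral.
Qed.

Lemma Cfubini1 (f : T1 * T2 -> R[i]) : Cintegrable (m1 \x m2)%E setT f ->
  Cintegrable m1 setT (fun x => Cintegral m2 setT (fun y => f (x, y))) /\
  Cintegral (m1 \x m2)%E setT f = Cintegral m1 setT (fun x => Cintegral m2 setT (fun y => f (x, y))).
Proof.
move=> [f1 f2]; have [h1 e1] := Rfubini1 f1; have [h2 e2] := Rfubini1 f2.
by split; [split|congr Complex].
Qed.

Lemma Cfubini2 (f : T1 * T2 -> R[i]) : Cintegrable (m1 \x m2)%E setT f ->
  Cintegrable m2 setT (fun y => Cintegral m1 setT (fun x => f (x, y))) /\
  Cintegral (m1 \x m2)%E setT f = Cintegral m2 setT (fun y => Cintegral m1 setT (fun x => f (x, y))).
Proof.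
move=> [f1 f2]; have [h1 e1] := Rfubini2 f1; have [h2 e2] := Rfubini2 f2.
by split; [split|congr Complex].
Qed.

End Cfubini.

Section Cscale.
Context (R : realType) d (T : measurableType d) (m : {sigma_finite_measure set T -> \bar R}).
Variables (c : R) (phi : T -> T).
Hypotheses (c0 : (0 <= c)%R) (mphi : measurable_fun setT phi).
Hypothesis h : forall A, measurable A -> (m (phi @^-1` A) = c%:E * m A)%E.

Lemma Cintegral_scale (f : T -> R[i]) : Cintegrable m setT f ->
  Cintegrable m setT (f \o phi) /\
  Cintegral m setT (f \o phi) = c%:C * Cintegral m setT f.
Proof.
move=> [f1 f2]; split; first split.
- exact: (integrable_scale c0 mphi h f1).
- exact: (integrable_scale c0 mphi h f2).
- by apply: complexP; rewrite ?ReM ?ImM /= mul0r ?subr0 ?addr0;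
    apply: (Rintegral_scale c0 mphi h).
Qed.
End Cscale.

(** * Directional derivatives *)

Section Lines.
Context (R : realType) (V : normedModType R).
Implicit Types (f : V -> R) (p v w : V).

Lemma derive_line f p v (s : R) : derivable f (p + s *: v) v ->
  is_derive s 1 (fun t => f (p + t *: v)) ('D_v f (p + s *: v)).
Proof.
move=> df.
have E : (fun h : R => h^-1 *: (((fun t => f (p + t *: v)) \o shift s) (h *: 1) -
      f (p + s *: v))) =
    (fun h : R => h^-1 *: ((f \o shift (p + s *: v)) (h *: v) - f (p + s *: v))).
  apply/funext => h /=; congr (_ *: (f _ - _)).
  by rewrite [h *: 1]mulr1 scalerDl addrCA addrA.
by split; [rewrite /derivable E|rewrite /derive E].
Qed.

Lemma derive_scale_dir f p v (c : R) : derivable f p v ->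
  is_derive p (c *: v) f (c * 'D_v f p).
Proof.
move=> df.
have H : is_derive (0 : R) 1 (fun t => f (p + t *: v)) ('D_v f p).
  have := @derive_line f p v 0; rewrite scale0r addr0; exact.
have H2 : is_derive (0 : R) 1 (fun t => f (p + t *: (c *: v))) (c * 'D_v f p).
  have -> : (fun t => f (p + t *: (c *: v))) = (fun t => f (p + t *: v)) \o (fun t => t * c).
    by apply/funext => t /=; rewrite scalerA.
  have H1 : is_derive (0 : R) 1 (fun t : R => t * c) c.
    have -> : (fun t : R => t * c) = id * cst c by [].
    by apply: is_derive_eq; rewrite scaler0 add0r [_ *: _]mulr1.
  rewrite mulrC; apply: is_derive1_comp; by rewrite mul0r.
have E : (fun h : R => h^-1 *: ((f \o shift p) (h *: (c *: v)) - f p)) =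
   (fun h : R => h^-1 *: (((fun t => f (p + t *: (c *: v))) \o shift 0) (h *: 1) -
      f (p + 0 *: (c *: v)))).
  apply/funext => h /=; rewrite addr0 scale0r addr0 [h *: 1]mulr1.
  by rewrite [p + h *: _]addrC.
case: H2 => H2 H3.
by split; [rewrite /derivable E|rewrite -H3 /derive E].
Qed.

Lemma mean_value_line f p w : (forall x, derivable f x w) ->
  exists2 t, t \in `]0, 1[%R & f (p + w) - f p = 'D_w f (p + t *: w).
Proof.
move=> df.
have H s := @derive_line f p w s (df _).
have [|t t01] := @MVT R (fun t => f (p + t *: w)) (fun s => 'D_w f (p + s *: w)) 0 1 ltr01 (fun s _ => H s).
  by apply: derivable_within_continuous => s _; case: (H s).
by rewrite scale1r scale0r addr0 subr0 mulr1 => e; exists t.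
Qed.

Lemma is_derive_affine (W : normedModType R) (A : W -> V) (p w : W) f v a :
  (forall h : R, A (h *: w + p) = h *: v + A p) ->
  is_derive (A p) v f a -> is_derive p w (f \o A) a.
Proof.
move=> hA [h1 h2].
have E : (fun h : R => h^-1 *: (((f \o A) \o shift p) (h *: w) - (f \o A) p)) =
    (fun h : R => h^-1 *: ((f \o shift (A p)) (h *: v) - f (A p))).
  by apply/funext => h /=; rewrite hA.
by split; [rewrite /derivable E|rewrite /derive E].
Qed.

End Lines.

Section Directions.
Context (R : realType).
Implicit Types (f g : G R -> R) (p v w : G R).

Lemma Cn_cont n f : Cn n f -> continuous f. Proof. by case: n => [|n] []. Qed.

Lemma CnS n f : Cn n.+1 f -> Cn n f.
Proof.
elim: n f => [|n IH] f; first by move=> [].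
by move=> [cf h]; split => // v; have [? /IH] := h v.
Qed.

Lemma Cn_derivable n f p v : Cn n.+1 f -> derivable f p v.
Proof. by move=> [_ /(_ v)[]]. Qed.

Lemma Cn_derive n f v : Cn n.+1 f -> Cn n ('D_v f).
Proof. by move=> [_ /(_ v)[]]. Qed.

Lemma near_between (phi : G R -> R) p v w (e : R) : continuous phi -> 0 < e ->
  exists2 d : R, 0 < d & forall s t : R, `|s| <= d -> `|t| <= d ->
    `|phi (p + s *: v + t *: w) - phi p| < e.
Proof.
move=> cphi e0.
have /nbhs_ballP[r /= r0 rphi] : nbhs p [set x | `|phi x - phi p| < e].
  by have /cvgrPdist_lt/(_ e e0) := cphi p; apply: filterS => x; rewrite /= distrC.
exists (r / (2 * (`|v| + `|w| + 1))).
  by rewrite divr_gt0// mulr_gt0// ltr_wpDl// addr_ge0.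
set d := _ / _ => s t sd td; apply: rphi; rewrite -ball_normE /ball_ /=.
rewrite -addrA opprD addrA subrr add0r normrN (le_lt_trans (ler_normD _ _))//.
rewrite !normrZ.
have d0 : 0 < d by rewrite divr_gt0// mulr_gt0// ltr_wpDl// addr_ge0.
have : d * (2 * (`|v| + `|w| + 1)) = r by rewrite /d divfK// mulf_neq0// gt_eqF// ltr_wpDl// addr_ge0.
have := ler_wpM2r (normr_ge0 v) sd; have := ler_wpM2r (normr_ge0 w) td.
have := normr_ge0 v; have := normr_ge0 w; nra.
Qed.

(** The increment along h (v + w) splits into one along h v at p and one along
    h w at a moving point; the mean value theorem and the continuity of the
    derivative handle the second. *)
Lemma derive_add_dir f p v w : Cn 1 f -> is_derive p (v + w) f ('D_v f p + 'D_w f p).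
Proof.
move=> f1.
suff h : (fun h : R => h^-1 *: ((f \o shift p) (h *: (v + w)) - f p)) @ 0^' -->
    'D_v f p + 'D_w f p.
  by split; [apply/cvg_ex; exists ('D_v f p + 'D_w f p)|exact/cvg_lim].
have -> : (fun h : R => h^-1 *: ((f \o shift p) (h *: (v + w)) - f p)) =
   (fun h : R => h^-1 *: ((f \o shift p) (h *: v) - f p)) +
   (fun h : R => h^-1 *: (f (p + h *: v + h *: w) - f (p + h *: v))).
  apply/funext => h; rewrite /= fctE /= -scalerDr; congr (_ *: _).
  have -> : h *: (v + w) + p = p + h *: v + h *: w by rewrite scalerDr addrC addrA.
  by rewrite [h *: v + p]addrC; ring.
apply: cvgD; first exact: (Cn_derivable (n := 0%N)).
apply/cvgrPdist_lt => e e0.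
have cD : continuous ('D_w f) by apply: (Cn_cont (n := 0)); exact: Cn_derive.
have [d d0 dP] := near_between p v w cD e0.
have : \forall h \near (0 : R)^', h != 0 /\ `|h| < d.
  near=> h; split; first by near: h; exact: nbhs_dnbhs_neq.
  near: h; apply: nbhs_dnbhs; apply: filterS (nbhsx_ballx 0 d d0) => x.
  by rewrite -ball_normE /ball_ /= sub0r normrN.
apply: filterS => h [h0 hd].
have [|t] := @mean_value_line R _ f (p + h *: v) (h *: w).
  by move=> x; exact: (Cn_derivable (n := 0%N)).
rewrite in_itv /= => /andP[t0 t1] ->.
have [_ ->] := derive_scale_dir h (Cn_derivable (p := p + h *: v + t *: (h *: w)) (v := w) f1).
rewrite -[_ *: (h * _)]/(h^-1 * (h * _)) mulKf// distrC scalerA.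
apply: dP; first exact: ltW.
rewrite normrM gtr0_norm//; apply: (le_trans _ (ltW hd)).
by rewrite ler_piMl// ltW.
Unshelve. all: end_near. Qed.

Lemma dist_quarter (a b c : R) : 0 < `|a - b| -> `|c - a| < `|a - b| / 4 ->
  `|c - b| < `|a - b| / 4 -> False.
Proof.
move=> ab ca cb; have : `|a - b| <= `|a - c| + `|c - b| by exact: ler_distD.
by rewrite (distrC a c); lra.
Qed.

(** Both mixed derivatives are limits of the second difference of f over the
    parallelogram spanned by h v and h w. *)
Lemma derive_comm f p v w : Cn 2 f -> 'D_v ('D_w f) p = 'D_w ('D_v f) p.
Proof.
move=> f2; apply/eqP; rewrite -subr_eq0 -normr_eq0; apply/negP => /negP.
(* If the two derivatives differed by e > 0, both would move by less than
   e / 4 near p, yet they share a value of the second difference. *)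
rewrite neq_lt ltNge normr_ge0 /= => e0.
set e := `|_| in e0.
have c1 : continuous ('D_v ('D_w f)) by apply: (Cn_cont (n := 0)); do 2 apply: Cn_derive.
have c2 : continuous ('D_w ('D_v f)) by apply: (Cn_cont (n := 0)); do 2 apply: Cn_derive.
have e4 : 0 < e / 4 by rewrite divr_gt0.
have [d d0 dP] := near_between p v w c1 e4.
have [d' d'0 dP'] := near_between p v w c2 e4.
pose h := Num.min d d'.
have h0 : 0 < h by rewrite lt_min d0.
have key : forall a b : G R, exists s t : R, [/\ `|s| <= h, `|t| <= h &
   f (p + h *: a + h *: b) - f (p + h *: a) - (f (p + h *: b) - f p) =
     h * (h * 'D_b ('D_a f) (p + s *: a + t *: b))].
  move=> a b.
  have dv x u : derivable f x u by exact: (Cn_derivable (n := 1%N)).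
  have dvv x u u' : derivable ('D_u f) x u' by apply: (Cn_derivable (n := 0%N)); exact: Cn_derive.
  pose g := (fun x => f (x + h *: b) - f x).
  have dg x : is_derive x (h *: a) g (h * ('D_a f (x + h *: b) - 'D_a f x)).
    have a1 := derive_scale_dir h (dv x a).
    have a2 : is_derive x (h *: a) (fun x => f (x + h *: b)) (h * 'D_a f (x + h *: b)).
      apply: (@is_derive_affine _ _ _ (fun x => x + h *: b) _ _ f (h *: a)).
        by move=> k; rewrite addrA.
      exact: derive_scale_dir.
    by rewrite mulrBr; exact: is_deriveB.
  have [x|s s01] := @mean_value_line R _ g p (h *: a); first by case: (dg x).
  have [_ ->] := dg (p + s *: (h *: a)).
  move=> E1; set q := p + s *: (h *: a) in E1.
  have [x|t t01] := @mean_value_line R _ ('D_a f) q (h *: b).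
    by case: (derive_scale_dir h (dvv x a b)).
  have [_ ->] := derive_scale_dir h (dvv (q + t *: (h *: b)) a b).
  move=> E2; exists (s * h), (t * h); split.
  - rewrite normrM (gtr0_norm h0) ler_piMl ?ltW//.
    by move: s01; rewrite in_itv/= => /andP[s0 s1]; rewrite gtr0_norm// ltW.
  - rewrite normrM (gtr0_norm h0) ler_piMl ?ltW//.
    by move: t01; rewrite in_itv/= => /andP[s0 s1]; rewrite gtr0_norm// ltW.
  - transitivity (g (p + h *: a) - g p); first by [].
    by rewrite E1 E2 /q !scalerA.
have [s [t [sh th E1]]] := key v w.
have [s' [t' [sh' th' E2]]] := key w v.
have E : 'D_w ('D_v f) (p + s *: v + t *: w) = 'D_v ('D_w f) (p + t' *: v + s' *: w).
  have hN0 : h != 0 by rewrite gt_eqF.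
  have c3 : p + h *: w + h *: v = p + h *: v + h *: w by exact: addrAC.
  have c4 : p + s' *: w + t' *: v = p + t' *: v + s' *: w by exact: addrAC.
  rewrite c3 c4 in E2.
  have {c3 c4} : h * (h * 'D_w ('D_v f) (p + s *: v + t *: w)) =
      h * (h * 'D_v ('D_w f) (p + t' *: v + s' *: w)).
    apply: (etrans (esym E1)); apply: (etrans _ E2).
    move: (f (p + h *: v + h *: w)) (f (p + h *: v)) (f (p + h *: w)) (f p) => A B C D.
    ring.
  by move=> /(mulfI hN0)/(mulfI hN0).
have hd : h <= d by rewrite ge_min lexx.
have hd' : h <= d' by rewrite ge_min lexx orbT.
have H1 := dP t' s' (le_trans th' hd) (le_trans sh' hd).
have H2 := dP' s t (le_trans sh hd') (le_trans th hd').
rewrite E in H2.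
exact: (dist_quarter e0 H1 H2).
Qed.

End Directions.

(** * Functions of class C^n and bounded supports *)

Section Cinfty.
Context (R : realType).
Implicit Types (f g : G R -> R) (p v w : G R).

Lemma Cn_cst n (c : R) : Cn n (fun _ : G R => c).
Proof.
elim: n c => [|n IH] c; split => //; do ?exact: cst_continuous.
move=> v; split => [g|]; first exact: derivable_cst.
have -> : 'D_v (fun _ : G R => c) = fun=> 0 by apply/funext => x; exact: derive_cst.
exact: IH.
Qed.

Lemma CnD n f g : Cn n f -> Cn n g -> Cn n (fun x => f x + g x).
Proof.
elim: n f g => [|n IH] f g hf hg.
  split => // x; apply: cvgD; [exact: (Cn_cont hf)|exact: (Cn_cont hg)].
split; first by move=> x; apply: cvgD; [exact: (Cn_cont hf)|exact: (Cn_cont hg)].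
move=> v; have df x := Cn_derivable (p := x) (v := v) hf.
have dg x := Cn_derivable (p := x) (v := v) hg.
split => [x|]; first exact: derivableD.
have -> : 'D_v (fun x => f x + g x) = fun x => 'D_v f x + 'D_v g x.
  by apply/funext => x; exact: deriveD.
by apply: IH; exact: Cn_derive.
Qed.

Lemma CnM n f g : Cn n f -> Cn n g -> Cn n (fun x => f x * g x).
Proof.
elim: n f g => [|n IH] f g hf hg.
  split => // x; apply: cvgM; [exact: (Cn_cont hf)|exact: (Cn_cont hg)].
split; first by move=> x; apply: cvgM; [exact: (Cn_cont hf)|exact: (Cn_cont hg)].
move=> v; have df x := Cn_derivable (p := x) (v := v) hf.
have dg x := Cn_derivable (p := x) (v := v) hg.
split => [x|]; first exact: derivableM.
have -> : 'D_v (fun x => f x * g x) = fun x => f x * 'D_v g x + g x * 'D_v f x.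
  by apply/funext => x; exact: deriveM.
by apply: CnD; apply: IH; do ?[exact: Cn_derive|exact: CnS].
Qed.

Lemma CnN n f : Cn n f -> Cn n (fun x => - f x).
Proof.
move=> hf; have -> : (fun x => - f x) = (fun x => -1 * f x).
  by apply/funext => x; rewrite mulN1r.
by apply: CnM => //; exact: Cn_cst.
Qed.

(** Right composition with an affine map permutes the directional derivatives
    through its linear part, so no chain rule is needed. *)
Lemma Cn_comp_affine n f (A L : G R -> G R) : continuous A ->
  (forall p v (h : R), A (h *: v + p) = h *: L v + A p) -> Cn n f -> Cn n (f \o A).
Proof.
move=> cA hA; elim: n f => [|n IH] f hf.
  by split => // x; apply: continuous_comp; [exact: cA|exact: (Cn_cont hf)].
split; first by move=> x; apply: continuous_comp; [exact: cA|exact: (Cn_cont hf)].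
move=> v.
have D x : is_derive x v (f \o A) ('D_(L v) f (A x)).
  apply: (@is_derive_affine R _ _ A x v f (L v)); first by move=> h; exact: hA.
  by apply: DeriveDef => //; exact: Cn_derivable hf.
split => [x|]; first by case: (D x).
have -> : 'D_v (f \o A) = 'D_(L v) f \o A by apply/funext => x; case: (D x).
by apply: IH; exact: Cn_derive.
Qed.

Lemma Cn_linear n (l : G R -> R) : continuous l ->
  (forall p v (h : R), l (h *: v + p) = h * l v + l p) -> Cn n l.
Proof.
move=> cl hl; case: n => [|n]; split => // v.
have D x : is_derive x v l (l v).
  have -> : l = id \o l by [].
  apply: (@is_derive_affine R R^o _ l x v id (l v)) => h; exact: hl.
split => [x|]; first by case: (D x).
by have -> : 'D_v l = (fun=> l v) by [apply/funext => x; case: (D x)]; exact: Cn_cst.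
Qed.

Lemma derive_linear (l : G R -> R) p v :
  (forall p v (h : R), l (h *: v + p) = h * l v + l p) -> is_derive p v l (l v).
Proof.
move=> hl; have -> : l = id \o l by [].
apply: (@is_derive_affine R R^o _ l p v id (l v)) => h; exact: hl.
Qed.

End Cinfty.

Section BoundedSupport.
Context (R : realType).
Implicit Types (p v : G R).

(** Bounded support is easier to propagate than compact support of the closure,
    and the two agree in finite dimension. *)
Definition bsupp (T : nmodType) (f : G R -> T) :=
  exists M : R, forall g, M < `|g| -> f g = 0.

Lemma bsupp_derive (f : G R -> R) v : bsupp f -> bsupp ('D_v f).
Proof.
move=> [M h]; exists M => g Mg.
rewrite (@near_eq_derive _ _ _ f (fun=> 0)); first exact: derive_cst.
have : open [set x : G R | M < `|x|].
  by apply: (@open_comp _ _ (fun x : G R => `|x|) [set y | M < y]);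
    [move=> x _; exact: norm_continuous|exact: open_gt].
move=> oM; have : nbhs g [set x : G R | M < `|x|] by exact: open_nbhs_nbhs.
by apply: filterS => x; exact: h.
Qed.

Lemma bsuppM (T : pzSemiRingType) (a f : G R -> T) : bsupp f -> bsupp (fun x => a x * f x).
Proof. by move=> [M h]; exists M => g /h ->; rewrite mulr0. Qed.

Lemma bsuppD (T : nmodType) (f g : G R -> T) : bsupp f -> bsupp g -> bsupp (fun x => f x + g x).
Proof.
move=> [M h] [M' h']; exists (Num.max M M') => x; rewrite gt_max => /andP[a b].
by rewrite h// h'// addr0.
Qed.

Definition boxG (M : R) : set (G R) := [set g | `|g| <= M].

Lemma normG_le (g : G R) (M : R) : (`|g| <= M) =
  [&& `|g.1.1.1| <= M, `|g.1.1.2| <= M, `|g.1.2.1| <= M, `|g.1.2.2| <= M & `|g.2| <= M].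
Proof. by rewrite !prod_normE !ge_max -!andbA. Qed.

Lemma boxGE (M : R) : boxG M = ((`[-M, M] `*` `[-M, M]) `*` (`[-M, M] `*` `[-M, M])) `*` `[-M, M].
Proof.
apply/seteqP; split => -[[[a b] [c d]] t]; rewrite /boxG /mkset normG_le /= !in_itv /= -!ler_norml.
  by move=> /and5P[-> -> -> -> ->].
by move=> [[[-> ->] [-> ->]] ->].
Qed.

Lemma compact_boxG M : compact (boxG M).
Proof. by rewrite boxGE; do !apply: compact_setX; exact: segment_compact. Qed.

Lemma measurable_boxG M : measurable (boxG M).
Proof. by apply: compact_measurableG; exact: compact_boxG. Qed.

Lemma haar_boxG_lty M : (haar (boxG M) < +oo)%E.
Proof.
have I : (lebesgue_measure `[(-M)%R, M]%classic < +oo :> \bar R)%E.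
  by apply: compact_finite_measure; exact: segment_compact.
have mI : measurable (`[-M, M]%classic : set R) by exact: measurable_itv.
have HC : (@lebesgueC R (`[(- M)%R, M] `*` `[(- M)%R, M]) < +oo)%E.
  rewrite /lebesgueC product_measure1E//.
  by apply: lte_mul_pinfty => //; rewrite ge0_fin_numE.
have HC2 : (@lebesgueC2 R ((`[(- M)%R, M] `*` `[(- M)%R, M]) `*` (`[(- M)%R, M] `*` `[(- M)%R, M])) < +oo)%E.
  rewrite /lebesgueC2 product_measure1E//; try exact: measurableX.
  by apply: lte_mul_pinfty => //; rewrite ge0_fin_numE.
rewrite boxGE /haar product_measure1E//; last by do !apply: measurableX.
by apply: lte_mul_pinfty => //; rewrite ge0_fin_numE.
Qed.

Lemma compact_sub_boxG (K : set (G R)) : compact K -> exists M, K `<=` boxG M.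
Proof.
move=> /compact_bounded [M [Mr h]]; exists (M + 1) => g Kg.
by apply: (h (M + 1)) => //; rewrite ltrDl.
Qed.

Lemma bsupp_bounded (f : G R -> R) : continuous f -> bsupp f ->
  exists2 C, 0 <= C & forall g, `|f g| <= C.
Proof.
move=> cf [M h].
have : compact (f @` boxG M).
  apply: continuous_compact; last exact: compact_boxG.
  exact: continuous_subspaceT.
move=> /compact_bounded [C [Cr hC]]; exists (`|C| + 1); first by rewrite addr_ge0.
move=> g; have [gM|gM] := leP `|g| M.
  apply: (hC (`|C| + 1)); last by exists g.
  by apply: le_lt_trans (ler_norm _) _; rewrite ltrDl.
by rewrite h// normr0 addr_ge0.
Qed.

End BoundedSupport.

(** * Local integrability and integrals of derivatives *)

Section LocInt.
Context (R : realType).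

Lemma integrable_boxG (f : G R -> R) (C M : R) : measurable_fun setT f ->
  (forall g, `|f g| <= C) -> (@haar R).-integrable (boxG M) (EFin \o f).
Proof.
move=> mf fC; apply: measurable_bounded_integrable.
- exact: measurable_boxG.
- exact: haar_boxG_lty.
- exact: measurable_funS mf.
- exists C; split; first exact: num_real.
  by move=> y Cy g _; rewrite /= (le_trans (fC g))// ltW.
Qed.

Lemma integrable_bsuppW (f : G R -> R) (M : R) : (forall g, M < `|g| -> f g = 0) ->
  (@haar R).-integrable (boxG M) (EFin \o f) -> (@haar R).-integrable setT (EFin \o f).
Proof.
move=> fM fi; have H := (integrable_mkcond (mu := @haar R) (EFin \o f) (measurable_boxG M)).1 fi.
suff <- : (EFin \o f) \_ (boxG M) = EFin \o f by [].
apply/funext => g; rewrite /patch; case: ifPn => // /negP; rewrite inE /= => gM.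
by rewrite fM// ltNge; apply/negP.
Qed.

Lemma integrable_bsupp (f : G R -> R) : continuous f -> bsupp f ->
  (@haar R).-integrable setT (EFin \o f).
Proof.
move=> cf sf; have [C _ fC] := bsupp_bounded cf sf; have [M fM] := sf.
apply: (integrable_bsuppW fM); apply: (integrable_boxG (C := C)) => //.
exact: continuous_measurableG.
Qed.

(** Boxes suffice because every compact set is contained in one. *)
Definition locint (N : G R -> R[i]) := forall M : R, Cintegrable (@haar R) (boxG M) N.

Lemma haar_integrableS (K B : set (G R)) (f : G R -> \bar R) : measurable K -> measurable B ->
  K `<=` B -> (@haar R).-integrable B f -> (@haar R).-integrable K f.
Proof. by move=> mK mB KB; apply: (@integrableS _ _ _ (@haar R)). Qed.

Lemma locint_locally_integrable N : locint N -> locally_integrableG N.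
Proof.
move=> hN K cK; have [M KM] := compact_sub_boxG cK; have [h1 h2] := hN M.
have mK := compact_measurableG cK; have mB := @measurable_boxG R M.
by split; [exact: (haar_integrableS mK mB KM h1)|exact: (haar_integrableS mK mB KM h2)].
Qed.

Definition contC (f : G R -> R[i]) :=
  continuous (fun g => Re (f g)) /\ continuous (fun g => Im (f g)).

Lemma contC_meas f : contC f -> Cmeas setT f.
Proof. by move=> [h1 h2]; split; exact: continuous_measurableG. Qed.

Lemma CmeasS (D D' : set (G R)) (f : G R -> R[i]) : measurable D' -> D `<=` D' -> Cmeas D' f -> Cmeas D f.
Proof. by move=> mD s [h1 h2]; split; [exact: measurable_funS h1|exact: measurable_funS h2]. Qed.

Lemma bsuppReIm (f : G R -> R[i]) : bsupp f ->
  bsupp (fun g => Re (f g)) /\ bsupp (fun g => Im (f g)).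
Proof. by move=> [M h]; split; exists M => g /h ->. Qed.

Lemma bsupp_boundedC (f : G R -> R[i]) : contC f -> bsupp f ->
  exists2 C, 0 <= C & forall g, modC (f g) <= C.
Proof.
move=> [c1 c2] /bsuppReIm[s1 s2].
have [C1 C10 h1] := bsupp_bounded c1 s1; have [C2 C20 h2] := bsupp_bounded c2 s2.
exists (C1 + C2); first exact: addr_ge0.
by move=> g; rewrite (le_trans (modC_le _))// lerD.
Qed.

Lemma locint_mul N f : locint N -> contC f -> bsupp f ->
  Cintegrable (@haar R) setT (fun g => N g * f g).
Proof.
move=> hN cf sf; have [C C0 fC] := bsupp_boundedC cf sf; have [M fM] := sf.
have mB := @measurable_boxG R M.
have : Cintegrable (@haar R) (boxG M) (fun g => f g * N g).
  apply: (CintegrableMb (mu := @haar R) mB (M := C)) => //.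
  by apply: (CmeasS _ _ (contC_meas cf)).
move=> [h1 h2]; split.
  apply: (@integrable_bsuppW _ M); first by move=> g /fM ->; rewrite mulr0.
  by move: h1; apply: eq_integrable => // g _ /=; rewrite mulrC.
apply: (@integrable_bsuppW _ M); first by move=> g /fM ->; rewrite mulr0.
by move: h2; apply: eq_integrable => // g _ /=; rewrite mulrC.
Qed.

Lemma contC_locint f : contC f -> locint f.
Proof.
move=> [c1 c2] M; have mB := @measurable_boxG R M.
suff H (h : G R -> R) : continuous h -> (@haar R).-integrable (boxG M) (EFin \o h).
  by split; apply: H.
move=> ch; apply: measurable_bounded_integrable => //.
- exact: haar_boxG_lty.
- by apply: measurable_funS (continuous_measurableG ch).
- have : compact (h @` boxG M).
    apply: continuous_compact; last exact: compact_boxG.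
    exact: continuous_subspaceT.
  by move=> /compact_bounded [C [Cr hC]]; exists C; split => // y Cy g gM; apply: hC => //; exists g.
Qed.

Lemma locint_contM a N : contC a -> locint N -> locint (fun g => a g * N g).
Proof.
move=> ca hN M; have mB := @measurable_boxG R M.
have : exists C, forall g, boxG M g -> modC (a g) <= C.
  case: ca => c1 c2.
  suff H (h : G R -> R) : continuous h -> exists C, forall g, boxG M g -> `|h g| <= C.
    have [C1 H1] := H _ c1; have [C2 H2] := H _ c2; exists (C1 + C2) => g gM.
    by rewrite (le_trans (modC_le _))// lerD// ?H1 ?H2.
  move=> ch; have : compact (h @` boxG M).
    apply: continuous_compact; last exact: compact_boxG.
    exact: continuous_subspaceT.
  move=> /compact_bounded [C [Cr hC]]; exists (C + 1) => g gM.
  by apply: (hC (C + 1)); [rewrite ltrDl|exists g].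
move=> [C hC]; apply: (CintegrableMb (mu := @haar R) mB _ hC (hN M)).
exact: (CmeasS _ _ (contC_meas ca)).
Qed.

Lemma contCM f g : contC f -> contC g -> contC (fun x => f x * g x).
Proof.
move=> [f1 f2] [g1 g2]; split => x.
  rewrite (_ : (fun g0 => _) = (fun x => Re (f x) * Re (g x) - Im (f x) * Im (g x))).
    by apply: cvgB; apply: cvgM; [exact: f1|exact: g1|exact: f2|exact: g2].
  by apply/funext => y; rewrite ReM.
rewrite (_ : (fun g0 => _) = (fun x => Re (f x) * Im (g x) + Im (f x) * Re (g x))).
  by apply: cvgD; apply: cvgM; [exact: f1|exact: g2|exact: f2|exact: g1].
by apply/funext => y; rewrite ImM.
Qed.

Lemma contCD f g : contC f -> contC g -> contC (fun x => f x + g x).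
Proof.
move=> [f1 f2] [g1 g2]; split => x.
  rewrite (_ : (fun g0 => _) = (fun x => Re (f x) + Re (g x))).
    by apply: cvgD; [exact: f1|exact: g1].
  by apply/funext => y; rewrite ReD.
rewrite (_ : (fun g0 => _) = (fun x => Im (f x) + Im (g x))).
  by apply: cvgD; [exact: f2|exact: g2].
by apply/funext => y; rewrite ImD.
Qed.

Lemma contC_cst c : contC (fun=> c).
Proof. by split; exact: cst_continuous. Qed.

End LocInt.

Section Parts.
Context (R : realType).

Lemma haar_scale (c : R) (phi : G R -> G R) (f : G R -> R) : 0 <= c ->
  measurable_fun setT phi ->
  (forall A, measurable A -> @haar R (phi @^-1` A) = (c%:E * @haar R A)%E) ->
  (@haar R).-integrable setT (EFin \o f) ->
  (@haar R).-integrable setT (EFin \o (f \o phi)) /\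
  Rintegral (@haar R) setT (f \o phi) = c * Rintegral (@haar R) setT f.
Proof.
move=> c0 mphi h fi; split.
  by apply: (@integrable_scale R _ _ (@haar R) c phi).
by apply: (@Rintegral_scale R _ _ (@haar R) c phi).
Qed.

Lemma translation_haar_map (w : G R) : (fun g => g + w) =
  haar_map (fun=> 1) (fun n => match n with 0%N => w.1.1.1 | 1%N => w.1.1.2
     | 2%N => w.1.2.1 | _ => w.1.2.2 end) (fun=> w.2).
Proof.
apply/funext => g; rewrite /haar_map !mul1r.
by case: g w => [[[a b] [c d]] t] [[[a' b'] [c' d']] t'].
Qed.

Lemma haar_translation (w : G R) (A : set (G R)) : measurable A ->
  @haar R ((fun g => g + w) @^-1` A) = (1%:E * @haar R A)%E.
Proof.
move=> mA; rewrite translation_haar_map haar_haar_map//.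
by rewrite !normr1 invr1 !mulr1.
Qed.

Lemma measurable_translation (w : G R) : measurable_fun setT (fun g : G R => g + w).
Proof. by rewrite translation_haar_map; apply: measurable_haar_map. Qed.

(** The integral of a translate does not depend on the translation;
    differentiate it under the integral sign. *)
Lemma integral_derive_eq0 (u u' : G R -> R) (v : G R) :
  continuous u -> continuous u' -> bsupp u ->
  (forall p, is_derive p v u (u' p)) -> Rintegral (@haar R) setT u' = 0.
Proof.
move=> cu cu' su du.
have u'E : u' = 'D_v u by apply/funext => p; case: (du p).
have su' : bsupp u' by rewrite u'E; exact: bsupp_derive.
have [C C0 hC] := bsupp_bounded cu' su'.
have [M hM] := su'.
have iu := integrable_bsupp cu su.
have shift (s : R) (f : G R -> R) : (@haar R).-integrable setT (EFin \o f) ->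
    (@haar R).-integrable setT (EFin \o (fun g : G R => f (g + s *: v))) /\
    Rintegral (@haar R) setT (fun g => f (g + s *: v)) = Rintegral (@haar R) setT f.
  move=> fi; have [h1 h2] := haar_scale (c := 1) ler01 (measurable_translation (s *: v))
    (@haar_translation (s *: v)) fi.
  by split=> //; rewrite -[RHS]mul1r -h2.
have line (p : G R) (s : R) : is_derive s 1 (fun t : R => u (p + t *: v)) (u' (p + s *: v)).
  by rewrite u'E; apply: derive_line; case: (du (p + s *: v)).
pose B := fun g : G R => C * \1_(boxG (M + `|v|)) g.
have B0 g : 0 <= B g by rewrite mulr_ge0.
have iB : (@haar R).-integrable setT (EFin \o B).
  apply: (@integrable_bsuppW _ _ (M + `|v|)).
    by move=> g hg; rewrite /B indicE memNset ?mulr0//= /boxG /= => h; rewrite ltNge h in hg.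
  apply: (@integrable_boxG _ _ C).
    apply: measurable_funM => //; apply: measurable_indic; exact: measurable_boxG.
  by move=> g; rewrite /B indicE normrM normr_nat (ger0_norm C0) ler_piMr// lern1 leq_b1.
have Bub (s : R) (g : G R) : `]-1, 1[%classic s -> setT g ->
    `|partial1of2 (fun s g => u (g + s *: v)) s g| <= B g.
  move=> s01 _; rewrite partial1of2E; have [_ ->] := line g s.
  have [hg|hg] := leP `|g| (M + `|v|).
    by rewrite /B indicE mem_set// mulr1.
  rewrite hM; first by rewrite normr0.
  have : `|g| <= `|g + s *: v| + `|v|.
    rewrite -{1}(addrK (s *: v) g) (le_trans (ler_normB _ _))// lerD2l normrZ.
    rewrite ler_piMl//; move: s01; rewrite /= in_itv/= => /andP[s1 s2].
    by rewrite ler_norml !ltW.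
  by move: hg => /lt_le_trans h /h; rewrite ltrD2r.
have I0 : `]-1, 1[%classic (0 : R) by rewrite /= in_itv /= ltrN10 ltr01.
have := @cvg_differentiation_under_integral R _ _ (@haar R)
   (fun s g => u (g + s *: v)) setT measurableT 0 (-1) 1 I0
   (fun s _ => (shift s u iu).1) (fun s g _ _ => @ex_derive _ _ _ _ _ _ _ (line g s)) B B0 iB Bub.
have -> : (fun h : R => h^-1 *: (Rintegral (@haar R) setT (fun g => u (g + (h + 0) *: v)) -
      Rintegral (@haar R) setT (fun g => u (g + 0 *: v)))) = fun=> 0.
  by apply/funext => h; rewrite (shift _ _ iu).2 (shift _ _ iu).2 subrr scaler0.
have -> : Rintegral (@haar R) setT (fun y => partial1of2 (fun s g => u (g + s *: v)) 0 y) =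
    Rintegral (@haar R) setT u'.
  apply: eq_Rintegral => g _; rewrite partial1of2E.
  by have [_ ->] := line g 0; rewrite scale0r addr0.
by move=> cv; apply: (cvg_unique _ cv) => //; exact: cvg_cst.
Qed.

End Parts.

(** * Derivatives of complex-valued functions *)

Section ComplexDerivative.
Context (R : realType) (V : normedModType R).
Implicit Types (f g : V -> R[i]) (p v w : V).

Definition is_cderive p v f (a : R[i]) :=
  is_derive p v (fun x => Re (f x)) (Re a) /\ is_derive p v (fun x => Im (f x)) (Im a).

Lemma is_cderiveD p v f g a b : is_cderive p v f a -> is_cderive p v g b ->
  is_cderive p v (fun x => f x + g x) (a + b).
Proof.
move=> [f1 f2] [g1 g2]; split; rewrite ?ReD ?ImD.
  rewrite (_ : (fun x => _) = (fun x => Re (f x) + Re (g x))); first exact: is_deriveD.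
  by apply/funext => x; rewrite ReD.
rewrite (_ : (fun x => _) = (fun x => Im (f x) + Im (g x))); first exact: is_deriveD.
by apply/funext => x; rewrite ImD.
Qed.

Lemma is_cderiveM p v f g a b : is_cderive p v f a -> is_cderive p v g b ->
  is_cderive p v (fun x => f x * g x) (f p * b + a * g p).
Proof.
have M (u1 u2 : V -> R) (d1 d2 : R) : is_derive p v u1 d1 -> is_derive p v u2 d2 ->
    is_derive p v (fun x => u1 x * u2 x) (u1 p * d2 + u2 p * d1).
  by move=> h1 h2; exact: is_deriveM.
move=> [f1 f2] [g1 g2]; split; rewrite ?ReD ?ImD ?ReM ?ImM.
  rewrite (_ : (fun x => _) = (fun x => Re (f x) * Re (g x) - Im (f x) * Im (g x))).
    apply: (is_derive_eq (is_deriveB (M _ _ _ _ f1 g1) (M _ _ _ _ f2 g2))); ring.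
  by apply/funext => x; rewrite ReM.
rewrite (_ : (fun x => _) = (fun x => Re (f x) * Im (g x) + Im (f x) * Re (g x))).
  apply: (is_derive_eq (is_deriveD (M _ _ _ _ f1 g2) (M _ _ _ _ f2 g1))); ring.
by apply/funext => x; rewrite ImM.
Qed.

Lemma is_cderive_cst p v c : is_cderive p v (fun=> c) 0.
Proof. by split; exact: is_derive_cst. Qed.

Lemma is_cderiveV p v f a : f p != 0 -> is_cderive p v f a ->
  is_cderive p v (fun x => (f x)^-1) (- a * (f p)^-1 ^+ 2).
Proof.
move=> fp0 [f1 f2].
have n0 := normsq_neq0 fp0.
have M (u1 u2 : V -> R) (d1 d2 : R) : is_derive p v u1 d1 -> is_derive p v u2 d2 ->
    is_derive p v (fun x => u1 x * u2 x) (u1 p * d2 + u2 p * d1).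
  by move=> h1 h2; exact: is_deriveM.
have dn : is_derive p v (fun x => normsq (f x)) (2 * (Re (f p) * Re a + Im (f p) * Im a)).
  have -> : (fun x => normsq (f x)) = (fun x => Re (f x) * Re (f x) + Im (f x) * Im (f x)).
    by apply/funext => x; rewrite /normsq !expr2.
  apply: (is_derive_eq (is_deriveD (M _ _ _ _ f1 f1) (M _ _ _ _ f2 f2))); ring.
have dV : is_derive p v (fun x => (normsq (f x))^-1)
    (- (normsq (f p)) ^- 2 * (2 * (Re (f p) * Re a + Im (f p) * Im a))).
  case: dn => dn1 dn2; apply: DeriveDef; first exact: derivableV.
  by rewrite deriveV// dn2.
split.
  rewrite (_ : (fun x => _) = (fun x => Re (f x) * (normsq (f x))^-1)); last first.
    by apply/funext => x; rewrite ReV.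
  apply: (is_derive_eq (M _ _ _ _ f1 dV)).
  rewrite expr2 !(ReM,ImM,ReN,ImN,ReV,ImV).
  move: n0; rewrite /normsq => n0; field.
  exact: n0.
rewrite (_ : (fun x => _) = (fun x => (- Im (f x)) * (normsq (f x))^-1)); last first.
  by apply/funext => x; rewrite ImV mulNr.
have f2N : is_derive p v (fun x => - Im (f x)) (- Im a) by exact: is_deriveN.
apply: (is_derive_eq (M _ _ _ _ f2N dV)).
rewrite expr2 !(ReM,ImM,ReN,ImN,ReV,ImV).
move: n0; rewrite /normsq => n0; field.
exact: n0.
Qed.

End ComplexDerivative.

Section Operators.
Context (R : realType).
Implicit Types (f g : G R -> R[i]) (p v w : G R).

Definition smoothC f := forall n, CCn n f.
Definition testfun f := smoothC f /\ bsupp f.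

Lemma test_function_testfun f : test_function f -> testfun f.
Proof.
move=> [sf cf]; split => //.
have [M hM] := compact_sub_boxG cf; exists M => g Mg.
apply/eqP/negP => /negP fg; have : boxG M g by apply: hM; exact: subset_closure.
by rewrite /boxG /= leNgt Mg.
Qed.

Lemma smoothC_cont f : smoothC f -> contC f.
Proof. by move=> /(_ 0%N)[/Cn_cont ? /Cn_cont ?]. Qed.

Lemma is_cderive_funD p v f a : is_cderive p v f a -> fun_D v f p = a.
Proof. by move=> [[_ h1] [_ h2]]; rewrite /fun_D h1 h2; case: a {h1 h2}. Qed.

Lemma smoothC_cderive p v f : smoothC f -> is_cderive p v f (fun_D v f p).
Proof.
by move=> /(_ 1%N)[h1 h2]; split; apply: DeriveDef => //; [exact: Cn_derivable h1|exact: Cn_derivable h2].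
Qed.

Lemma smoothC_cst c : smoothC (fun=> c).
Proof. by move=> n; split; exact: Cn_cst. Qed.

Lemma smoothCD f g : smoothC f -> smoothC g -> smoothC (fun x => f x + g x).
Proof.
move=> hf hg n; have [f1 f2] := hf n; have [g1 g2] := hg n; split.
  rewrite (_ : (fun x => _) = (fun x => Re (f x) + Re (g x))); first exact: CnD.
  by apply/funext => x; rewrite ReD.
rewrite (_ : (fun x => _) = (fun x => Im (f x) + Im (g x))); first exact: CnD.
by apply/funext => x; rewrite ImD.
Qed.

Lemma smoothCM f g : smoothC f -> smoothC g -> smoothC (fun x => f x * g x).
Proof.
move=> hf hg n; have [f1 f2] := hf n; have [g1 g2] := hg n; split.
  rewrite (_ : (fun x => _) = (fun x => Re (f x) * Re (g x) + - (Im (f x) * Im (g x)))).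
    by apply: CnD; [exact: CnM|apply: CnN; exact: CnM].
  by apply/funext => x; rewrite ReM.
rewrite (_ : (fun x => _) = (fun x => Re (f x) * Im (g x) + Im (f x) * Re (g x))).
  by apply: CnD; exact: CnM.
by apply/funext => x; rewrite ImM.
Qed.

Lemma smoothC_funD v f : smoothC f -> smoothC (fun_D v f).
Proof. by move=> hf n; have [f1 f2] := hf n.+1; split; exact: Cn_derive. Qed.

Lemma bsupp_funD v f : bsupp f -> bsupp (fun_D v f).
Proof.
move=> /bsuppReIm[/bsupp_derive h1 /bsupp_derive h2].
have [M1 H1] := h1 v; have [M2 H2] := h2 v; exists (Num.max M1 M2) => g.
by rewrite gt_max => /andP[a b]; rewrite /fun_D H1 ?H2.
Qed.

Lemma testfunD f g : testfun f -> testfun g -> testfun (fun x => f x + g x).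
Proof. by move=> [? ?] [? ?]; split; [exact: smoothCD|exact: bsuppD]. Qed.

Lemma testfunM a f : smoothC a -> testfun f -> testfun (fun x => a x * f x).
Proof. by move=> ? [? ?]; split; [exact: smoothCM|exact: bsuppM]. Qed.

Lemma testfun_funD v f : testfun f -> testfun (fun_D v f).
Proof. by move=> [? ?]; split; [exact: smoothC_funD|exact: bsupp_funD]. Qed.

Lemma fun_D_add v f g : smoothC f -> smoothC g ->
  fun_D v (fun x => f x + g x) = fun x => fun_D v f x + fun_D v g x.
Proof.
move=> hf hg; apply/funext => x; apply: is_cderive_funD.
by apply: is_cderiveD; exact: smoothC_cderive.
Qed.

Lemma fun_D_mul v f g : smoothC f -> smoothC g ->
  fun_D v (fun x => f x * g x) = fun x => f x * fun_D v g x + fun_D v f x * g x.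
Proof.
move=> hf hg; apply/funext => x; apply: is_cderive_funD.
by apply: is_cderiveM; exact: smoothC_cderive.
Qed.

Lemma fun_D_cst v c : fun_D v (fun=> c) = fun=> 0.
Proof. by apply/funext => x; apply: is_cderive_funD; exact: is_cderive_cst. Qed.

Lemma fun_D_cmul v c f : smoothC f -> fun_D v (fun x => c * f x) = fun x => c * fun_D v f x.
Proof.
move=> hf; rewrite (fun_D_mul _ (smoothC_cst c))// fun_D_cst.
by apply/funext => x; rewrite mul0r addr0.
Qed.

Lemma fun_D_comm v w f : smoothC f -> fun_D v (fun_D w f) = fun_D w (fun_D v f).
Proof.
move=> /(_ 2%N)[f1 f2]; apply/funext => x; rewrite /fun_D /=.
by rewrite (derive_comm _ _ _ f1) (derive_comm _ _ _ f2).
Qed.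

End Operators.

(** * The vector fields and the transposed Kohn Laplacian *)

Definition other (k : 'I_2) : 'I_2 := if k == ord0 then ord_max else ord0.

Section VectorFields.
Context (R : realType) (sigma : 'I_2 -> R).
Implicit Types (f u : G R -> R[i]) (j k : 'I_2).

Lemma sum_I2 (V : nmodType) (F : 'I_2 -> V) : \sum_(j < 2) F j = F ord0 + F ord_max.
Proof.
rewrite !big_ord_recl big_ord0 addr0; congr (_ + F _); exact/val_inj.
Qed.

Lemma I2_cases (k : 'I_2) : k = ord0 \/ k = ord_max.
Proof. by case: k => -[|[|//]] h; [left|right]; exact/val_inj. Qed.

Lemma sum_I2_other (V : nmodType) (F : 'I_2 -> V) k : \sum_(j < 2) F j = F k + F (other k).
Proof. by rewrite sum_I2; case: (I2_cases k) => ->; rewrite /other//= addrC. Qed.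

Lemma sum_other (V : nmodType) (F : 'I_2 -> V) k : \sum_(j < 2 | j != k) F j = F (other k).
Proof.
apply: big_pred1 => j.
by case: (I2_cases k) => ->; case: (I2_cases j) => ->.
Qed.

(** The commutators cancel one of the two orderings of the fields in each
    variable. *)
Lemma BoxE (X : Type) D mul k (u : X -> R[i]) x :
  Box D mul sigma k u x =
   - vecZbar D mul sigma k (vecZ D mul sigma k u) x
   - vecZ D mul sigma (other k) (vecZbar D mul sigma (other k) u) x.
Proof.
rewrite /Box (sum_I2_other _ k) sum_other.
have half (a b c d : R[i]) : - 2^-1 * (a + b + (c + d)) + 2^-1 * (b - a - (d - c))
    = - a - d by field.
exact: half.
Qed.

(** This is z_j for eta = i and its conjugate for eta = -i; one parameter treats
    a field and its conjugate together. *)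
Definition ze (eta : R[i]) j (g : G R) : R[i] :=
  (Re (zc j g))%:C + eta * (Im (zc j g))%:C.

(** This is Z_j for eta = -i and its conjugate for eta = i. *)
Definition vfield (eta : R[i]) j u : G R -> R[i] := fun g =>
  2^-1 * (fun_D (e_x R j) u g + eta * fun_D (e_y R j) u g)
  + eta * (sigma j)%:C * ze eta j g * fun_D (e_t R) u g.

Lemma ze_zc j g : ze 'i%C j g = zc j g.
Proof. by apply: complexP; rewrite /ze !(ReD,ImD,ReM,ImM)/=; ring. Qed.

Lemma ze_conj j g : ze (- 'i%C) j g = (zc j g)^*%C.
Proof.
by rewrite /ze; apply: complexP; rewrite !(ReD,ImD,ReM,ImM,ReN,ImN)/=;
  case: (zc j g) => a b /=; ring.
Qed.

Lemma vecZ_fun j u : vecZ (@fun_D R) (@fun_mul R) sigma j u = vfield (- 'i%C) j u.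
Proof.
apply/funext => g; rewrite /vecZ /dz /fun_mul /vfield ze_conj.
have alg (i a b c s z : R[i]) : 2^-1 * (a - i * b) - i * s * z * c =
  2^-1 * (a + - i * b) + - i * s * z * c by ring.
exact: alg.
Qed.

Lemma vecZbar_fun j u : vecZbar (@fun_D R) (@fun_mul R) sigma j u = vfield 'i%C j u.
Proof.
by apply/funext => g; rewrite /vecZbar /dzbar /fun_mul /vfield ze_zc.
Qed.

Lemma Re_zc_linear j (p v : G R) (h : R) :
  Re (zc j (h *: v + p)) = h * Re (zc j v) + Re (zc j p).
Proof. by rewrite /zc; case: (j == ord0). Qed.

Lemma Im_zc_linear j (p v : G R) (h : R) :
  Im (zc j (h *: v + p)) = h * Im (zc j v) + Im (zc j p).
Proof. by rewrite /zc; case: (j == ord0). Qed.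

Lemma Re_zc_continuous j : continuous (fun g : G R => Re (zc j g)).
Proof.
rewrite /zc; case: (j == ord0) => /= -[[[a b] [c d]] t].
  apply: (@continuous_comp _ _ _ (fun g : G R => g.1.1) fst); last exact: cvg_fst.
  by apply: (@continuous_comp _ _ _ (fun g : G R => g.1) fst); exact: cvg_fst.
apply: (@continuous_comp _ _ _ (fun g : G R => g.1.2) fst); last exact: cvg_fst.
by apply: (@continuous_comp _ _ _ (fun g : G R => g.1) snd); [exact: cvg_fst|exact: cvg_snd].
Qed.

Lemma Im_zc_continuous j : continuous (fun g : G R => Im (zc j g)).
Proof.
rewrite /zc; case: (j == ord0) => /= -[[[a b] [c d]] t].
  apply: (@continuous_comp _ _ _ (fun g : G R => g.1.1) snd); last exact: cvg_snd.
  by apply: (@continuous_comp _ _ _ (fun g : G R => g.1) fst); exact: cvg_fst.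
apply: (@continuous_comp _ _ _ (fun g : G R => g.1.2) snd); last exact: cvg_snd.
by apply: (@continuous_comp _ _ _ (fun g : G R => g.1) snd); [exact: cvg_fst|exact: cvg_snd].
Qed.

Lemma smoothC_Re_zc j : smoothC (fun g : G R => (Re (zc j g))%:C).
Proof.
move=> n; split; last exact: Cn_cst.
by apply: Cn_linear; [exact: Re_zc_continuous|exact: Re_zc_linear].
Qed.

Lemma smoothC_Im_zc j : smoothC (fun g : G R => (Im (zc j g))%:C).
Proof.
move=> n; split; last exact: Cn_cst.
by apply: Cn_linear; [exact: Im_zc_continuous|exact: Im_zc_linear].
Qed.

Lemma smoothC_ze eta j : smoothC (ze eta j).
Proof.
apply: smoothCD; first exact: smoothC_Re_zc.
by apply: (smoothCM (smoothC_cst eta)); exact: smoothC_Im_zc.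
Qed.

Lemma cderive_Re_zc p v j : is_cderive p v (fun g : G R => (Re (zc j g))%:C) (Re (zc j v))%:C.
Proof.
split => /=; last exact: is_derive_cst.
exact: (derive_linear p v (Re_zc_linear j)).
Qed.

Lemma cderive_Im_zc p v j : is_cderive p v (fun g : G R => (Im (zc j g))%:C) (Im (zc j v))%:C.
Proof.
split => /=; last exact: is_derive_cst.
exact: (derive_linear p v (Im_zc_linear j)).
Qed.

Lemma cderive_ze p v eta j : is_cderive p v (ze eta j) (ze eta j v).
Proof.
apply: is_cderiveD; first exact: cderive_Re_zc.
have := is_cderiveM (is_cderive_cst p v eta) (cderive_Im_zc p v j).
by rewrite mul0r addr0.
Qed.

Lemma fun_D_ze v eta j : fun_D v (ze eta j) = fun=> ze eta j v.
Proof. by apply/funext => p; exact: is_cderive_funD (cderive_ze p v eta j). Qed.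

Lemma ze_t eta j : ze eta j (e_t R) = 0.
Proof. by rewrite /ze /zc /e_t /=; case: (j == ord0); apply: complexP; rewrite !(ReD,ImD,ReM,ImM)/=; ring. Qed.

Lemma ze_x eta j : ze eta j (e_x R j) = 1.
Proof. by rewrite /ze /zc /e_x /=; case: (j == ord0); apply: complexP; rewrite !(ReD,ImD,ReM,ImM)/=; ring. Qed.

Lemma ze_y eta j : ze eta j (e_y R j) = eta.
Proof. by rewrite /ze /zc /e_y /=; case: (j == ord0); apply: complexP; rewrite !(ReD,ImD,ReM,ImM)/=; ring. Qed.

#[local] Opaque e_x e_y e_t.

Lemma smoothC_vfield eta j f : smoothC f -> smoothC (vfield eta j f).
Proof.
move=> sf; apply: smoothCD.
  apply: (smoothCM (smoothC_cst _)); apply: smoothCD; first exact: smoothC_funD.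
  by apply: (smoothCM (smoothC_cst _)); exact: smoothC_funD.
apply: smoothCM; last exact: smoothC_funD.
by apply: (smoothCM (smoothC_cst _)); exact: smoothC_ze.
Qed.

Lemma testfun_vfield eta j f : testfun f -> testfun (vfield eta j f).
Proof.
move=> hf; apply: testfunD.
  apply: (testfunM (smoothC_cst _)); apply: testfunD; first exact: testfun_funD.
  by apply: (testfunM (smoothC_cst _)); exact: testfun_funD.
apply: testfunM; last exact: testfun_funD.
by apply: (smoothCM (smoothC_cst _)); exact: smoothC_ze.
Qed.

Lemma fun_D_vfield v eta j f g : smoothC f ->
  fun_D v (vfield eta j f) g =
   2^-1 * (fun_D v (fun_D (e_x R j) f) g + eta * fun_D v (fun_D (e_y R j) f) g)
   + eta * (sigma j)%:C * (ze eta j g * fun_D v (fun_D (e_t R) f) g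
      + ze eta j v * fun_D (e_t R) f g).
Proof.
move=> sf; have sx := smoothC_funD (e_x R j) sf; have sy := smoothC_funD (e_y R j) sf.
have st := smoothC_funD (e_t R) sf.
apply: is_cderive_funD; rewrite /vfield.
have C c := is_cderive_cst g v c.
have h1 := is_cderiveM (C eta) (smoothC_cderive g v sy).
have h2 := is_cderiveM (C 2^-1) (is_cderiveD (smoothC_cderive g v sx) h1).
have h3 := is_cderiveM (is_cderiveM (C (eta * (sigma j)%:C)) (cderive_ze g v eta j)) (smoothC_cderive g v st).
have alg (e s z zv x' y' t' x y t : R[i]) : 2^-1 * (x' + (e * y' + 0 * y)) + 0 * (x + e * y)
   + (e * s * z * t' + (e * s * zv + 0 * z) * t) =
   2^-1 * (x' + e * y') + e * s * (z * t' + zv * t) by ring.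
apply: (eq_ind _ (is_cderive g v _) (is_cderiveD h2 h3)); exact: alg.
Qed.

Lemma vfield_t eta j f : smoothC f ->
  vfield eta j (fun_D (e_t R) f) = fun_D (e_t R) (vfield eta j f).
Proof.
move=> sf; apply/funext => g; rewrite fun_D_vfield// ze_t mul0r addr0 /vfield.
rewrite (fun_D_comm (e_x R j) (e_t R) sf) (fun_D_comm (e_y R j) (e_t R) sf).
by rewrite mulrA.
Qed.

(** Only the commutator of Z_j with its own conjugate is needed, since the
    Kohn Laplacian never mixes the two complex variables. *)
Lemma vfield_comm eta eta' j f g : smoothC f -> eta * eta' = 1 ->
  vfield eta j (vfield eta' j f) g =
  vfield eta' j (vfield eta j f) g + (eta' - eta) * (sigma j)%:C * fun_D (e_t R) f g.
Proof.
move=> sf ee; rewrite [in LHS]/vfield [X in _ = X + _]/vfield !fun_D_vfield// !ze_t !ze_x !ze_y.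
have alg (e e' s z z' xx xy xt yx yy yt tx ty tt t : R[i]) : e * e' = 1 ->
  yx = xy -> tx = xt -> ty = yt ->
  2^-1 * (2^-1 * (xx + e' * xy) + e' * s * (z' * xt + 1 * t) +
    e * (2^-1 * (yx + e' * yy) + e' * s * (z' * yt + e' * t))) +
    e * s * z * (2^-1 * (tx + e' * ty) + e' * s * (z' * tt + 0 * t)) =
  2^-1 * (2^-1 * (xx + e * xy) + e * s * (z * xt + 1 * t) +
    e' * (2^-1 * (yx + e * yy) + e * s * (z * yt + e * t))) +
    e' * s * z' * (2^-1 * (tx + e * ty) + e * s * (z * tt + 0 * t)) + (e' - e) * s * t.
  by move=> h -> -> ->; field: h.
refine (alg _ _ _ _ _ _ _ _ _ _ _ _ _ _ _ ee _ _ _).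
- exact: (congr1 (fun F => F g) (fun_D_comm (e_y R j) (e_x R j) sf)).
- exact: (congr1 (fun F => F g) (fun_D_comm (e_t R) (e_x R j) sf)).
- exact: (congr1 (fun F => F g) (fun_D_comm (e_t R) (e_y R j) sf)).
Qed.

(** Distributional operators only evaluate a functional on test functions, and
    integration against a locally integrable function is linear only there. *)
Definition test_linear (T : (G R -> R[i]) -> R[i]) :=
  (forall f u, testfun f -> testfun u -> T (fun x => f x + u x) = T f + T u) /\
  (forall c f, testfun f -> T (fun x => c * f x) = c * T f).

Lemma test_linear_vfield T eta j f : test_linear T -> testfun f ->
  2^-1 * (- T (fun_D (e_x R j) f) + eta * (- T (fun_D (e_y R j) f)))
  - T (fun_D (e_t R) (fun x => eta * (sigma j)%:C * ze eta j x * f x)) =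
  T (fun x => -1 * vfield eta j f x).
Proof.
move=> [Ta Tm] hf; have [sf _] := hf.
have tx := testfun_funD (e_x R j) hf; have ty := testfun_funD (e_y R j) hf; have tt := testfun_funD (e_t R) hf.
have sc := smoothC_cst; have sz := smoothCM (sc _ (eta * (sigma j)%:C)) (smoothC_ze eta j).
rewrite Tm; last exact: testfun_vfield.
rewrite /vfield Ta; last 2 first.
  by apply: (testfunM (sc _ _)); apply: testfunD => //; exact: (testfunM (sc _ _)).
  exact: testfunM.
rewrite Tm; last by apply: testfunD => //; exact: (testfunM (sc _ _)).
rewrite Ta//; last exact: (testfunM (sc _ _)).
rewrite Tm// (fun_D_mul _ sz sf) (fun_D_cmul _ _ (smoothC_ze eta j)) fun_D_ze ze_t.
have -> : (fun x => eta * (sigma j)%:C * ze eta j x * fun_D (e_t R) f x + eta * (sigma j)%:C * 0 * f x)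
    = (fun x => eta * (sigma j)%:C * ze eta j x * fun_D (e_t R) f x).
  by apply/funext => x; rewrite mulr0 mul0r addr0.
have alg (a b c : R[i]) : 2^-1 * (- a + eta * - b) - c = -1 * (2^-1 * (a + eta * b) + c) by ring.
exact: alg.
Qed.

Lemma vecZ_distr T j f : test_linear T -> testfun f ->
  vecZ (@distr_D R) (@distr_mul R) sigma j T f = T (fun x => -1 * vfield (- 'i%C) j f x).
Proof.
move=> hT hf; rewrite -test_linear_vfield// /vecZ /dz /distr_D /distr_mul /fun_mul.
have -> : (fun g => 'i%C * (sigma j)%:C * (zc j g)^*%C * f g) =
   (fun x => -1 * (- 'i%C * (sigma j)%:C * ze (- 'i%C) j x * f x)).
  by apply/funext => x; rewrite ze_conj; ring.
have sz := smoothCM (smoothC_cst (- 'i%C * (sigma j)%:C)) (smoothC_ze (- 'i%C) j).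
rewrite fun_D_cmul; last by apply: (smoothCM sz); case: hf.
rewrite (hT.2 (-1)); last by apply: testfun_funD; exact: testfunM.
have alg (i a b c : R[i]) : 2^-1 * (- a - i * - b) - - (-1 * c) = 2^-1 * (- a + - i * - b) - c by ring.
exact: alg.
Qed.

Lemma vecZbar_distr T j f : test_linear T -> testfun f ->
  vecZbar (@distr_D R) (@distr_mul R) sigma j T f = T (fun x => -1 * vfield 'i%C j f x).
Proof.
move=> hT hf; rewrite -test_linear_vfield// /vecZbar /dzbar /distr_D /distr_mul /fun_mul.
under eq_fun do rewrite -ze_zc.
by [].
Qed.

Lemma testfun_Nvfield eta j f : testfun f -> testfun (fun x => -1 * vfield eta j f x).
Proof. by move=> hf; apply: (testfunM (smoothC_cst _)); exact: testfun_vfield. Qed.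

Lemma vfield_add eta j f u : smoothC f -> smoothC u ->
  vfield eta j (fun x => f x + u x) = fun x => vfield eta j f x + vfield eta j u x.
Proof.
move=> sf su; apply/funext => x; rewrite /vfield !fun_D_add//.
have alg (e c a1 a2 b1 b2 c1 c2 : R[i]) : 2^-1 * (a1 + a2 + e * (b1 + b2)) + c * (c1 + c2) =
  2^-1 * (a1 + e * b1) + c * c1 + (2^-1 * (a2 + e * b2) + c * c2) by ring.
exact: alg.
Qed.

Lemma vfield_cmul eta j c f : smoothC f ->
  vfield eta j (fun x => c * f x) = fun x => c * vfield eta j f x.
Proof.
move=> sf; apply/funext => x; rewrite /vfield !fun_D_cmul//.
have alg (e q d a1 b1 c1 : R[i]) : 2^-1 * (d * a1 + e * (d * b1)) + q * (d * c1) =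
  d * (2^-1 * (a1 + e * b1) + q * c1) by ring.
exact: alg.
Qed.

Lemma test_linear_vec T T' eta j : test_linear T -> (forall f, testfun f -> T' f = T (fun x => -1 * vfield eta j f x)) ->
  test_linear T'.
Proof.
move=> [Ta Tm] h; split=> [f u hf hu|c f hf].
  have [sf _] := hf; have [su _] := hu.
  rewrite !h//; last exact: testfunD.
  rewrite -Ta; try exact: testfun_Nvfield.
  by congr T; apply/funext => x; rewrite vfield_add// mulrDr.
have [sf _] := hf; rewrite !h//; last exact: (testfunM (smoothC_cst _)).
rewrite -Tm; last exact: testfun_Nvfield.
by congr T; apply/funext => x; rewrite vfield_cmul// mulrCA.
Qed.

(** The fields are free of divergence, so transposing changes their signs and
    reverses their order. *)
Definition Box_tr k f : G R -> R[i] := fun x =>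
  - vfield (- 'i%C) k (vfield 'i%C k f) x - vfield 'i%C (other k) (vfield (- 'i%C) (other k) f) x.

Lemma testfun_Box_tr k f : testfun f -> testfun (Box_tr k f).
Proof.
move=> hf; have -> : Box_tr k f = fun x => -1 * vfield (- 'i%C) k (vfield 'i%C k f) x +
    -1 * vfield 'i%C (other k) (vfield (- 'i%C) (other k) f) x.
  by apply/funext => x; rewrite /Box_tr !mulN1r.
by apply: testfunD; apply: (testfunM (smoothC_cst _)); do 2 apply: testfun_vfield.
Qed.

Lemma Box_distr T k f : test_linear T -> testfun f ->
  Box (@distr_D R) (@distr_mul R) sigma k T f = T (Box_tr k f).
Proof.
move=> hT hf; rewrite BoxE.
have hZ j : test_linear (vecZ (@distr_D R) (@distr_mul R) sigma j T).
  by apply: (test_linear_vec hT) => u hu; rewrite vecZ_distr.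
have hZb j : test_linear (vecZbar (@distr_D R) (@distr_mul R) sigma j T).
  by apply: (test_linear_vec hT) => u hu; rewrite vecZbar_distr.
rewrite vecZbar_distr// vecZ_distr; [|exact: hT|exact: testfun_Nvfield].
rewrite vecZ_distr// vecZbar_distr; [|exact: hT|exact: testfun_Nvfield].
have [sf _] := hf.
rewrite !vfield_cmul; try exact: smoothC_vfield.
have [Ta Tm] := hT.
set A := vfield _ _ _; set B := vfield _ _ (vfield _ (other k) _).
have tA : testfun A by do 2 apply: testfun_vfield.
have tB : testfun B by do 2 apply: testfun_vfield.
have -> : Box_tr k f = fun x => -1 * A x + -1 * B x.
  by apply/funext => x; rewrite /Box_tr !mulN1r.
rewrite Ta; [|exact: (testfunM (smoothC_cst _))|exact: (testfunM (smoothC_cst _))].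
have -> : (fun x => -1 * (-1 * A x)) = A by apply/funext => x; rewrite !mulN1r opprK.
have -> : (fun x => -1 * (-1 * B x)) = B by apply/funext => x; rewrite !mulN1r opprK.
by rewrite !Tm// !mulN1r.
Qed.

Lemma test_linear_distr_of N : locint N -> test_linear (distr_of N).
Proof.
move=> hN; split=> [f u [sf bf] [su bu]|c f [sf bf]].
  have h1 := locint_mul hN (smoothC_cont sf) bf; have h2 := locint_mul hN (smoothC_cont su) bu.
  rewrite /distr_of -CintegralD//.
  by apply: eq_Cintegral => x _; rewrite mulrDr.
have h1 := locint_mul hN (smoothC_cont sf) bf.
rewrite /distr_of -CintegralZ//.
by apply: eq_Cintegral => x _; rewrite mulrCA.
Qed.

Lemma Cparts (K K' : G R -> R[i]) v u : contC K -> contC K' ->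
  (forall p, is_cderive p v K (K' p)) -> testfun u ->
  Cintegral (@haar R) setT (fun g => K g * fun_D v u g) =
  - Cintegral (@haar R) setT (fun g => K' g * u g).
Proof.
move=> cK cK' dK hu; have [su bu] := hu; have [sdu bdu] := testfun_funD v hu.
have i1 := locint_mul (contC_locint cK) (smoothC_cont sdu) bdu.
have i2 := locint_mul (contC_locint cK') (smoothC_cont su) bu.
apply/eqP; rewrite -addr_eq0 -CintegralD//; apply/eqP.
have d p := is_cderiveM (dK p) (smoothC_cderive p v su).
have cc : contC (fun g => K g * fun_D v u g + K' g * u g).
  by apply: contCD; apply: contCM => //; exact: smoothC_cont.
have cKu : contC (fun g => K g * u g) by apply: contCM => //; exact: smoothC_cont.
have [b1 b2] := bsuppReIm (bsuppM K bu).
apply: complexP => /=.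
  apply: (@integral_derive_eq0 R _ _ v cKu.1 cc.1 b1) => p; exact: (d p).1.
apply: (@integral_derive_eq0 R _ _ v cKu.2 cc.2 b2) => p; exact: (d p).2.
Qed.

(** The variable coefficient of the derivative in t does not depend on t, so it
    can be moved onto the kernel without an extra term. *)
Lemma vfield_parts eta j (K Kx Ky Kt : G R -> R[i]) f :
  contC K -> contC Kx -> contC Ky -> contC Kt ->
  (forall p, is_cderive p (e_x R j) K (Kx p)) ->
  (forall p, is_cderive p (e_y R j) K (Ky p)) ->
  (forall p, is_cderive p (e_t R) K (Kt p)) -> testfun f ->
  Cintegral (@haar R) setT (fun g => K g * vfield eta j f g) =
  - Cintegral (@haar R) setT (fun g =>
     (2^-1 * (Kx g + eta * Ky g) + eta * (sigma j)%:C * ze eta j g * Kt g) * f g).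
Proof.
move=> cK cKx cKy cKt dx dy dt hf; have [sf bf] := hf.
have cz : contC (fun g => eta * (sigma j)%:C * ze eta j g).
  by apply: smoothC_cont; apply: (smoothCM (smoothC_cst _)); exact: smoothC_ze.
have Q (v : G R) : forall a : G R -> R[i], contC a ->
    Cintegrable (@haar R) setT (fun g => a g * fun_D v f g).
  move=> a ca; have [sdf bdf] := testfun_funD v hf.
  exact: (locint_mul (contC_locint ca) (smoothC_cont sdf) bdf).
have Q0 (a : G R -> R[i]) : contC a -> Cintegrable (@haar R) setT (fun g => a g * f g).
  by move=> ca; exact: (locint_mul (contC_locint ca) (smoothC_cont sf) bf).
have czK := contCM cz cK; have czKt := contCM cz cKt.
have dzK p : is_cderive p (e_t R) (fun g => eta * (sigma j)%:C * ze eta j g * K g)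
    (eta * (sigma j)%:C * ze eta j p * Kt p).
  have h1 := is_cderiveM (is_cderive_cst p (e_t R) (eta * (sigma j)%:C)) (cderive_ze p (e_t R) eta j).
  have h2 := is_cderiveM h1 (dt p).
  apply: (eq_ind _ (is_cderive p _ _) h2).
  have alg (a b c d e : R[i]) : a * b * c + (a * 0 + 0 * d) * e = a * b * c by ring.
  by rewrite ze_t; exact: alg.
have P1 := Cparts cK cKx dx hf; have P2 := Cparts cK cKy dy hf.
have P3 := Cparts czK czKt dzK hf.
have iZ := fun c F (h : Cintegrable (@haar R) setT F) => CintegrableZ measurableT c h.
transitivity (2^-1 * Cintegral (@haar R) setT (fun g => K g * fun_D (e_x R j) f g) +
  2^-1 * eta * Cintegral (@haar R) setT (fun g => K g * fun_D (e_y R j) f g) +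
  Cintegral (@haar R) setT (fun g => eta * (sigma j)%:C * ze eta j g * K g * fun_D (e_t R) f g)).
  rewrite -!(CintegralZ measurableT); try exact: Q.
  rewrite -(CintegralD measurableT); [|exact: iZ (Q _ _ cK)|exact: iZ (Q _ _ cK)].
  rewrite -(CintegralD measurableT); last 2 first.
    apply: (CintegrableD measurableT); exact: iZ (Q _ _ cK).
    exact: Q.
  apply: eq_Cintegral => g _; rewrite /vfield.
  have alg (h e c k x y t : R[i]) : k * (h * (x + e * y) + c * t) =
    h * (k * x) + h * e * (k * y) + c * k * t by ring.
  exact: alg.
refine (etrans (congr2 +%R (congr2 +%R (congr1 ( *%R _) P1) (congr1 ( *%R _) P2)) P3) _).
transitivity (- (2^-1 * Cintegral (@haar R) setT (fun g => Kx g * f g) +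
  2^-1 * eta * Cintegral (@haar R) setT (fun g => Ky g * f g) +
  Cintegral (@haar R) setT (fun g => eta * (sigma j)%:C * ze eta j g * Kt g * f g))).
  have alg (h e a b c : R[i]) : h * - a + h * e * - b + - c = - (h * a + h * e * b + c) by ring.
  exact: alg.
congr (- _).
rewrite -!(CintegralZ measurableT); try exact: Q0.
rewrite -(CintegralD measurableT); [|exact: iZ (Q0 _ cKx)|exact: iZ (Q0 _ cKy)].
rewrite -(CintegralD measurableT); last 2 first.
  by apply: (CintegrableD measurableT); [exact: iZ (Q0 _ cKx)|exact: iZ (Q0 _ cKy)].
  exact: Q0.
apply: eq_Cintegral => g _.
have alg (h e c k x y t : R[i]) : h * (x * k) + h * e * (y * k) + c * t * k =
    (h * (x + e * y) + c * t) * k by ring.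
exact: alg.
Qed.

End VectorFields.

(** * The group law *)

Section GroupLaw.
Context (R : realType) (sigma : 'I_2 -> R).
Implicit Types (g h u v : G R).

Definition symp u g : R := 2 * Im (phi sigma u g).

(** The map g |-> u^-1 g, in terms of which a convolution is an integral over
    the variable of the kernel. *)
Definition ltrans u g : G R := mulG sigma (invG u) g.

Lemma sympE u g : symp u g =
  2 * (sigma ord0 * (Im (zc ord0 u) * Re (zc ord0 g) - Re (zc ord0 u) * Im (zc ord0 g)) +
       sigma ord_max * (Im (zc ord_max u) * Re (zc ord_max g) - Re (zc ord_max u) * Im (zc ord_max g))).
Proof.
rewrite /symp /phi sum_I2 ImD !ImM !ReM /=.
by case: (zc ord0 u) (zc ord0 g) (zc ord_max u) (zc ord_max g) => ? ? [? ?] [? ?] [? ?] /=; ring.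
Qed.

Lemma sympDl k v u g : symp (k *: v + u) g = k * symp v g + symp u g.
Proof. by rewrite !sympE !Re_zc_linear !Im_zc_linear; ring. Qed.

Lemma sympDr k v u g : symp u (k *: v + g) = k * symp u v + symp u g.
Proof. by rewrite !sympE !Re_zc_linear !Im_zc_linear; ring. Qed.

Lemma sympC u g : symp g u = - symp u g.
Proof. by rewrite !sympE; ring. Qed.

Lemma symp_invl u g : symp (invG u) g = - symp u g.
Proof. by rewrite !sympE /invG /zc /=; case: u => [[[a b] [c d]] t] /=; ring. Qed.

Lemma symp_continuous g : continuous (fun u => symp u g).
Proof.
move=> u; rewrite (_ : (fun u => symp u g) = (fun u =>
  2 * (sigma ord0 * (Im (zc ord0 u) * Re (zc ord0 g) - Re (zc ord0 u) * Im (zc ord0 g)) +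
       sigma ord_max * (Im (zc ord_max u) * Re (zc ord_max g) - Re (zc ord_max u) * Im (zc ord_max g))))).
  apply: cvgM; first exact: cvg_cst.
  apply: cvgD; (apply: cvgM; first exact: cvg_cst).
    by apply: cvgB; (apply: cvgM; last exact: cvg_cst); [exact: Im_zc_continuous|exact: Re_zc_continuous].
  by apply: cvgB; (apply: cvgM; last exact: cvg_cst); [exact: Im_zc_continuous|exact: Re_zc_continuous].
by apply/funext => x; rewrite sympE.
Qed.

Lemma ltransE u g : ltrans u g = (g.1 - u.1, g.2 - u.2 - symp u g).
Proof.
rewrite /ltrans /mulG /tc -/(symp _ _) symp_invl /=; congr (_, _); first by rewrite addrC.
by rewrite [- u.2 + g.2]addrC.
Qed.

Lemma ltrans_linear_r u v g (k : R) :
  ltrans u (k *: v + g) = k *: (v + - symp u v *: e_t R) + ltrans u g.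
Proof.
rewrite !ltransE sympDr; case: u v g => [[[a b] [c d]] t] [[[a' b'] [c' d']] t'] [[[a2 b2] [c2 d2]] t2].
rewrite /e_t; have sE (x y : R) : x *: y = x * y by []; congr (((_, _), (_, _)), _); rewrite /= !sE; ring.
Qed.

Lemma ltrans_linear_l u v g (k : R) :
  ltrans (k *: v + u) g = k *: (-1 *: v + - symp v g *: e_t R) + ltrans u g.
Proof.
rewrite !ltransE sympDl; case: u v g => [[[a b] [c d]] t] [[[a' b'] [c' d']] t'] [[[a2 b2] [c2 d2]] t2].
rewrite /e_t; have sE (x y : R) : x *: y = x * y by []; congr (((_, _), (_, _)), _); rewrite /= !sE; ring.
Qed.


Lemma continuous_pairG (T : topologicalType) (a : T -> (R * R) * (R * R)) (b : T -> R) :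
  continuous a -> continuous b -> continuous (fun x => (a x, b x) : G R).
Proof. by move=> ca cb x; exact: (cvg_pair (ca x) (cb x)). Qed.

Lemma ltrans_continuous_r u : continuous (ltrans u).
Proof.
have -> : ltrans u = (fun g => (g.1 - u.1, g.2 - u.2 - symp u g)) by apply/funext => g; exact: ltransE.
apply: continuous_pairG => g.
  by apply: cvgB; [exact: cvg_fst|exact: cvg_cst].
apply: cvgB; first by apply: cvgB; [exact: cvg_snd|exact: cvg_cst].
have -> : symp u = (fun g => - symp g u) by apply/funext => x; rewrite sympC.
by apply: cvgN; exact: symp_continuous.
Qed.

Lemma ltrans_continuous_l g : continuous (ltrans ^~ g).
Proof.
have -> : ltrans ^~ g = (fun u => (g.1 - u.1, g.2 - u.2 - symp u g)) by apply/funext => u; exact: ltransE.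
apply: continuous_pairG => u.
  by apply: cvgB; [exact: cvg_cst|exact: cvg_fst].
apply: cvgB; first by apply: cvgB; [exact: cvg_cst|exact: cvg_snd].
exact: symp_continuous.
Qed.

(** For g in a bounded set the functions u |-> f(u^-1 g) have a common bounded
    support: first z is controlled, then t. *)
Lemma ltrans_proper (M r : R) : exists M', forall u g, `|g| <= r -> `|ltrans u g| <= M -> `|u| <= M'.
Proof.
have bound (s a b c d A B : R) : `|a| <= A -> `|b| <= B -> `|c| <= A -> `|d| <= B ->
    `|s * (a * b - c * d)| <= `|s| * (2 * (A * B)).
  move=> ha hb hc hd; rewrite normrM ler_wpM2l//.
  rewrite (le_trans (ler_normB _ _))// !normrM mulr2n mulrDl mul1r.
  by apply: lerD; apply: ler_pM.
pose S := `|sigma ord0| + `|sigma ord_max|.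
exists (M + r + 2 * (S * (2 * ((M + r) * r)))) => u g hg; rewrite ltransE => hM.
have r0 : 0 <= r by apply: le_trans hg.
have M0 : 0 <= M by apply: le_trans hM.
have S0 : 0 <= S by rewrite addr_ge0.
move: (hM); rewrite normG_le /= => /and5P[h1 h2 h3 h4 h5].
move: (hg); rewrite normG_le /= => /and5P[k1 k2 k3 k4 k5].
have near (a b : R) : `|b| <= r -> `|b - a| <= M -> `|a| <= M + r.
  move=> hb hba; have -> : a = - (b - a) + b by ring.
  by rewrite (le_trans (ler_normD _ _))// normrN lerD.
have e1 := near _ _ k1 h1; have e2 := near _ _ k2 h2.
have e3 := near _ _ k3 h3; have e4 := near _ _ k4 h4.
have hom : `|symp u g| <= 2 * (S * (2 * ((M + r) * r))).
  rewrite sympE normrM ger0_norm// ler_wpM2l// mulrDl (le_trans (ler_normD _ _))//.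
  by apply: lerD; apply: bound; rewrite /zc.
have X0 : 0 <= 2 * (S * (2 * ((M + r) * r))).
  by apply: le_trans hom.
rewrite normG_le; apply/and5P; split; try by rewrite (le_trans _ (lerDl _ _ )) ?X0// ltW.
- by apply: (le_trans e1); rewrite lerDl.
- by apply: (le_trans e2); rewrite lerDl.
- by apply: (le_trans e3); rewrite lerDl.
- by apply: (le_trans e4); rewrite lerDl.
- have -> : u.2 = - (g.2 - u.2 - symp u g) + g.2 + - symp u g by ring.
  rewrite (le_trans (ler_normD _ _))// normrN lerD//.
  by rewrite (le_trans (ler_normD _ _))// normrN lerD.
Qed.

End GroupLaw.

Section RealConv.
Context (R : realType) (sigma : 'I_2 -> R).
Implicit Types (m : G R -> R) (f : G R -> R) (u v g : G R).

Definition locintR m := forall M : R, (@haar R).-integrable (boxG M) (EFin \o m).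

Definition rconv m f g := Rintegral (@haar R) setT (fun u => m u * f (ltrans sigma u g)).

Lemma integrable_indic_locint m (C M : R) : locintR m ->
  (@haar R).-integrable setT (EFin \o (fun u => C * `|m u| * \1_(boxG M) u)).
Proof.
move=> hm; apply: (@integrable_bsuppW _ _ M).
  by move=> g hg; rewrite indicE memNset ?mulr0//= /boxG /= => h; rewrite ltNge h in hg.
have H := integrableZl (mu := @haar R) (measurable_boxG M) C (integrable_norm (hm M)).
move: H; apply: eq_integrable; first exact: measurable_boxG.
by move=> x xM; rewrite /= indicE xM mulr1.
Qed.

Lemma rconv_bound m f C M u g : (forall x, `|f x| <= C) ->
  (forall u, boxG M u \/ f (ltrans sigma u g) = 0) ->
  `|m u * f (ltrans sigma u g)| <= C * `|m u| * \1_(boxG M) u.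
Proof.
move=> fC hM; have C0 : 0 <= C by apply: le_trans (fC 0).
rewrite normrM indicE; have [uM|->] := hM u.
  by rewrite mem_set// mulr1 mulrC ler_wpM2r.
by rewrite normr0 mulr0 mulr_ge0// mulr_ge0.
Qed.

Lemma measurable_locintR m : locintR m -> measurable_fun setT m.
Proof.
move=> hm.
have -> : m = (fun g => limn (fun n => m g * \1_(boxG n%:R) g)).
  apply/funext => g; apply/esym/cvg_lim => //; apply: cvg_near_cst.
  near=> n; rewrite indicE mem_set ?mulr1// /boxG /=; near: n.
  exact: nbhs_infty_ger.
apply: (@measurable_fun_cvg _ _ _ setT (fun n g => m g * \1_(boxG n%:R) g)).
  move=> n; have /measurable_int/measurable_EFinP := hm n%:R.
  move=> /(measurable_restrictT _ (measurable_boxG _)); apply: eq_measurable_fun.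
  by move=> g _; rewrite patchE indicE; case: ifPn => gn; rewrite ?mulr1 ?mulr0.
move=> g _; apply/cvg_ex => /=; exists (m g); apply: cvg_near_cst.
near=> n; rewrite indicE mem_set ?mulr1// /boxG /=; near: n.
exact: nbhs_infty_ger.
Unshelve. all: end_near. Qed.

End RealConv.

(** * Differentiation of convolutions *)

Section RealConv2.
Context (R : realType) (sigma : 'I_2 -> R).
Implicit Types (m : G R -> R) (f : G R -> R) (u v g : G R).

(** Continuity reduces to sequences, which is the form in which dominated
    convergence applies. *)
Lemma seq_continuousG (F : G R -> R) :
  (forall g (a : nat -> G R), a @ \oo --> g -> (F \o a) @ \oo --> F g) -> continuous F.
Proof.
move=> h g; apply/cvgrPdist_lt => e e0; apply: contrapT => H.
have /choice[a ha] : forall n : nat, exists x : G R, ball g n.+1%:R^-1 x /\ e <= `|F g - F x|.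
  move=> n; apply: contrapT => Hn; apply: H.
  have : nbhs g (ball g (n.+1%:R^-1 : R)) by apply: nbhsx_ballx; rewrite invr_gt0.
  apply: filterS => x gx; rewrite ltNge; apply/negP => hx; apply: Hn.
  by exists x.
have ca : a @ \oo --> g.
  apply/cvg_ballP => d d0; near=> n.
  apply: (@le_ball _ _ g n.+1%:R^-1 d); last by case: (ha n).
  by apply: ltW; near: n; exact: near_infty_natSinv_lt (PosNum d0).
have /cvgrPdist_lt/(_ e e0)[N _ HN] := h g a ca.
have := HN N (leqnn N); rewrite /= ltNge => /negP; apply; by case: (ha N).
Unshelve. all: end_near. Qed.

Lemma measurable_rconv_integrand m f g : measurable_fun setT m -> continuous f ->
  measurable_fun setT (fun u => m u * f (ltrans sigma u g)).
Proof.
move=> mm cf; apply: measurable_funM => //; apply: continuous_measurableG => u.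
by apply: continuous_comp; [exact: ltrans_continuous_l|exact: cf].
Qed.

Lemma rconv_continuous m f : locintR m -> continuous f -> bsupp f ->
  continuous (rconv sigma m f).
Proof.
move=> hm cf sf; have mm := measurable_locintR hm.
have [C C0 fC] := bsupp_bounded cf sf; have [M fM] := sf.
apply: seq_continuousG => g a ag.
have [r hr] : exists r, forall n, `|a n| <= r.
  have cn : (fun n => `|a n|) @ \oo --> `|g| by exact: cvg_norm ag.
  have /cvg_seq_bounded[r [_ hr]] : cvgn (fun n => `|a n|) by apply: cvgP cn.
  by exists (r + 1) => n; apply: (le_trans (ler_norm _)); apply: (hr (r + 1)); rewrite ?ltrDl.
have hg : `|g| <= Num.max r `|g| by rewrite le_max lexx orbT.
have hr' n : `|a n| <= Num.max r `|g| by rewrite le_max hr.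
have [M' HM'] := ltrans_proper sigma M (Num.max r `|g|).
have supp u x : `|x| <= Num.max r `|g| -> boxG M' u \/ f (ltrans sigma u x) = 0.
  move=> hx; have [h|/fM ->] := leP `|ltrans sigma u x| M; last by right.
  by left; exact: (HM' u x).
apply: (@Rdominated _ _ _ (@haar R) setT measurableT (fun n u => m u * f (ltrans sigma u (a n)))
   (fun u => m u * f (ltrans sigma u g)) (fun u => C * `|m u| * \1_(boxG M') u)).
- by move=> n; exact: measurable_rconv_integrand.
- exact: measurable_rconv_integrand.
- exact: integrable_indic_locint.
- apply: aeW => u _; apply: cvgM; first exact: cvg_cst.
  apply: (cvg_comp (fun n => ltrans sigma u (a n)) f _ (cf (ltrans sigma u g))).
  apply: (cvg_comp a (ltrans sigma u) ag); exact: ltrans_continuous_r.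
- by apply: aeW => u _ n; apply: rconv_bound => // x; exact: supp.
Qed.

Lemma locintR_symp m v : locintR m -> locintR (fun u => symp sigma u v * m u).
Proof.
move=> hm M.
have hc : locint (fun u => (m u)%:C).
  move=> K; split; first exact: hm.
  exact: (integrable0 (@haar R) (boxG K)).
have co : contC (fun u => (symp sigma u v)%:C).
  by split; [exact: symp_continuous|exact: cst_continuous].
have [h _] := locint_contM co hc M.
move: h; apply: eq_integrable; first exact: measurable_boxG.
by move=> u _; rewrite /= mulr0 subr0.
Qed.

Lemma rconv_integrable m f g : locintR m -> continuous f -> bsupp f ->
  (@haar R).-integrable setT (EFin \o (fun u => m u * f (ltrans sigma u g))).
Proof.
move=> hm cf sf; have mm := measurable_locintR hm.
have [C C0 fC] := bsupp_bounded cf sf; have [M fM] := sf.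
have [M' HM'] := ltrans_proper sigma M `|g|.
apply: (le_integrable (mu := @haar R) measurableT _ _ (integrable_indic_locint C M' hm)).
  by apply/measurable_EFinP; exact: measurable_rconv_integrand.
move=> u _; rewrite lee_fin /=.
apply: (le_trans _ (ler_norm _)); apply: rconv_bound => // x.
have [h|/fM ->] := leP `|ltrans sigma x g| M; last by right.
by left; exact: (HM' x g).
Qed.

Lemma derive_ltrans f u v g (s : R) : (forall n, Cn n f) ->
  is_derive s 1 (fun t => f (ltrans sigma u (g + t *: v)))
    ('D_v f (ltrans sigma u (g + s *: v)) - symp sigma u v * 'D_(e_t R) f (ltrans sigma u (g + s *: v))).
Proof.
move=> sf.
have E t : ltrans sigma u (g + t *: v) = ltrans sigma u g + t *: (v + - symp sigma u v *: e_t R).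
  by rewrite addrC ltrans_linear_r addrC.
have -> : (fun t => f (ltrans sigma u (g + t *: v))) =
   (fun t => f (ltrans sigma u g + t *: (v + - symp sigma u v *: e_t R))).
  by apply/funext => t; rewrite E.
rewrite E.
set p := ltrans sigma u g + _ *: _.
have D := @derive_line R _ f (ltrans sigma u g) (v + - symp sigma u v *: e_t R) s.
have dadd := derive_add_dir p v (- symp sigma u v *: e_t R) (sf 1%N).
have [_ dsc] := derive_scale_dir (- symp sigma u v) (Cn_derivable (p := p) (v := e_t R) (sf 1%N)).
have [d1 d2] := dadd.
apply: (is_derive_eq (D d1)); rewrite -/p d2 dsc; ring.
Qed.

(** Moving g in the direction v moves u^-1 g in the direction v corrected by a
    multiple of the direction of t that is bilinear in u and v; this produces
    the second convolution. *)
Lemma rconv_derive m f g v : locintR m -> (forall n, Cn n f) -> bsupp f ->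
  is_derive g v (rconv sigma m f)
   (rconv sigma m ('D_v f) g - rconv sigma (fun u => symp sigma u v * m u) ('D_(e_t R) f) g).
Proof.
move=> hm sf bf; have hom := locintR_symp v hm.
have svf n : Cn n ('D_v f) by apply: Cn_derive; exact: sf.
have stf n : Cn n ('D_(e_t R) f) by apply: Cn_derive; exact: sf.
have cf := Cn_cont (sf 0%N); have cvf := Cn_cont (svf 0%N); have ctf := Cn_cont (stf 0%N).
have bvf := bsupp_derive v bf; have btf := bsupp_derive (e_t R) bf.
have [C1 C10 h1] := bsupp_bounded cvf bvf; have [C2 C20 h2] := bsupp_bounded ctf btf.
have [M1 s1] := bvf; have [M2 s2] := btf.
pose r := `|g| + `|v|.
have [M1' H1] := ltrans_proper sigma M1 r; have [M2' H2] := ltrans_proper sigma M2 r.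
pose B u := C1 * `|m u| * \1_(boxG M1') u + C2 * `|symp sigma u v * m u| * \1_(boxG M2') u.
have B0 u : 0 <= B u by rewrite addr_ge0// !mulr_ge0.
have iB : (@haar R).-integrable setT (EFin \o B).
  have i1 := integrable_indic_locint C1 M1' hm; have i2 := integrable_indic_locint C2 M2' hom.
  move: (integrableD (mu := @haar R) measurableT i1 i2).
  by apply: eq_integrable.
have d1 (s : R) u : is_derive s 1 (fun t => m u * f (ltrans sigma u (g + t *: v)))
    (m u * ('D_v f (ltrans sigma u (g + s *: v)) - symp sigma u v * 'D_(e_t R) f (ltrans sigma u (g + s *: v)))).
  exact: is_deriveZ (derive_ltrans u v g s sf).
have Bub (s : R) u : `]-1, 1[%classic s -> setT u ->
    `|partial1of2 (fun s u => m u * f (ltrans sigma u (g + s *: v))) s u| <= B u.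
  move=> s01 _; rewrite partial1of2E; have [_ ->] := d1 s u.
  have gs : `|g + s *: v| <= r.
    rewrite (le_trans (ler_normD _ _))// lerD2l normrZ ler_piMl//.
    by move: s01; rewrite /= in_itv/= => /andP[? ?]; rewrite ler_norml !ltW.
  rewrite mulrBr [m u * (symp _ _ _ * _)]mulrA [m u * symp _ _ _]mulrC (le_trans (ler_normB _ _))// lerD//.
    apply: (@rconv_bound R sigma m ('D_v f) C1 M1' u _ h1) => x.
    have [h|/s1 ->] := leP `|ltrans sigma x (g + s *: v)| M1; last by right.
    by left; exact: (H1 x _ gs).
  apply: (@rconv_bound R sigma (fun u => symp sigma u v * m u) ('D_(e_t R) f) C2 M2' u _ h2) => x.
  have [h|/s2 ->] := leP `|ltrans sigma x (g + s *: v)| M2; last by right.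
  by left; exact: (H2 x _ gs).
have I0 : `]-1, 1[%classic (0 : R) by rewrite /= in_itv /= ltrN10 ltr01.
have := @cvg_differentiation_under_integral R _ _ (@haar R)
   (fun s u => m u * f (ltrans sigma u (g + s *: v))) setT measurableT 0 (-1) 1 I0
   (fun s _ => rconv_integrable (g + s *: v) hm cf bf) (fun s u _ _ => @ex_derive _ _ _ _ _ _ _ (d1 s u)) B B0 iB Bub.
pose L := rconv sigma m ('D_v f) g - rconv sigma (fun u => symp sigma u v * m u) ('D_(e_t R) f) g.
have eL : Rintegral (@haar R) setT (fun y => partial1of2 (fun s u => m u * f (ltrans sigma u (g + s *: v))) 0 y) =
    rconv sigma m ('D_v f) g - rconv sigma (fun u => symp sigma u v * m u) ('D_(e_t R) f) g.
  have i1 := rconv_integrable g hm cvf bvf; have i2 := rconv_integrable g hom ctf btf.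
  rewrite /rconv -(RintegralB measurableT i1 i2).
  apply: eq_Rintegral => u _; rewrite partial1of2E.
  by have [_ ->] := d1 0 u; rewrite scale0r addr0; ring.
rewrite eL => cv.
have cv' : (fun h => h^-1 *: ((rconv sigma m f \o shift g) (h *: v) - rconv sigma m f g)) @ 0^' --> L.
  apply: cvg_trans cv; apply: near_eq_cvg; apply: nearW => h.
  have e1 : g + (h + 0) *: v = h *: v + g by rewrite addr0 addrC.
  have e2 : g + 0 *: v = g by rewrite scale0r addr0.
  by rewrite e1 e2.
split; first by apply/cvg_ex; exists L.
exact: cvg_lim cv'.
Qed.

(** Both terms of the derivative are again convolutions of the same type, so
    induction on n applies with m quantified. *)
Lemma Cn_rconv n m f : locintR m -> (forall n, Cn n f) -> bsupp f -> Cn n (rconv sigma m f).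
Proof.
elim: n m f => [|n IH] m f hm sf bf.
  by split => //; apply: rconv_continuous => //; exact: Cn_cont (sf 0%N).
split; first by apply: rconv_continuous => //; exact: Cn_cont (sf 0%N).
move=> v; have D g := rconv_derive g v hm sf bf.
split => [g|]; first by case: (D g).
have -> : 'D_v (rconv sigma m f) = fun g =>
   rconv sigma m ('D_v f) g + - rconv sigma (fun u => symp sigma u v * m u) ('D_(e_t R) f) g.
  by apply/funext => g; case: (D g).
apply: CnD; [|apply: CnN].
  by apply: IH => // [k|]; [exact: Cn_derive|exact: bsupp_derive].
by apply: IH => // [|k|]; [exact: locintR_symp|exact: Cn_derive|exact: bsupp_derive].
Qed.

End RealConv2.

(** * Convolution of complex-valued functions *)

Section Convolution.
Context (R : realType) (sigma : 'I_2 -> R).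
Implicit Types (M N f : G R -> R[i]) (u v g : G R) (j k : 'I_2) (eta : R[i]).

Definition reflected f g : G R -> R[i] := fun u => f (ltrans sigma u g).

(** The convolution after the substitution u = g h^-1, so that derivatives in g
    fall on the smooth factor. *)
Definition cconv M f : G R -> R[i] := fun g =>
  Cintegral (@haar R) setT (fun u => M u * f (ltrans sigma u g)).

Lemma bsupp_reflected f g : bsupp f -> bsupp (reflected f g).
Proof.
move=> [M hM]; have [M' H] := ltrans_proper sigma M `|g|.
exists M' => u Mu; apply: hM; rewrite ltNge; apply/negP => h.
by move: Mu; rewrite ltNge (H u g).
Qed.

Lemma smoothC_reflected f g : smoothC f -> smoothC (reflected f g).
Proof.
move=> sf n; have [h1 h2] := sf n.
have A : forall p v (h : R), ltrans sigma (h *: v + p) g =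
    h *: (-1 *: v + - symp sigma v g *: e_t R) + ltrans sigma p g.
  by move=> p v h; exact: ltrans_linear_l.
split.
  exact: (Cn_comp_affine (@ltrans_continuous_l _ sigma g) A h1).
exact: (Cn_comp_affine (@ltrans_continuous_l _ sigma g) A h2).
Qed.

Lemma testfun_reflected f g : testfun f -> testfun (reflected f g).
Proof. by move=> [? ?]; split; [exact: smoothC_reflected|exact: bsupp_reflected]. Qed.

Lemma cconv_integrable M f g : locint M -> testfun f ->
  Cintegrable (@haar R) setT (fun u => M u * f (ltrans sigma u g)).
Proof.
move=> hM hf; have [st bt] := testfun_reflected g hf.
exact: (locint_mul hM (smoothC_cont st) bt).
Qed.

Lemma mulG_invG g h : mulG sigma g (invG h) = (g.1 - h.1, g.2 - h.2 - symp sigma g h).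
Proof.
rewrite /mulG -/(symp _ _ _) /tc /=; congr (_, _ + _).
by rewrite sympC symp_invl sympC opprK.
Qed.

Lemma ltrans_mulG g h : ltrans sigma (mulG sigma g (invG h)) g = h.
Proof.
have e X : symp sigma ((g.1 - h.1, X) : G R) g = symp sigma g h.
  rewrite !sympE.
  have E j : zc j ((g.1 - h.1, X) : G R) = zc j g - zc j h.
    by rewrite /zc; case: (j == ord0).
  rewrite !E !ReD !ImD !ReN !ImN; ring.
rewrite mulG_invG ltransE /= e [RHS](surjective_pairing h); congr (_, _); first by rewrite subKr.
ring.
Qed.

Lemma mulG_inv_haar_map g : (fun h => mulG sigma g (invG h)) =
  haar_map (fun=> -1) (fun n => match n with
     0%N => g.1.1.1 | 1%N => g.1.1.2 | 2%N => g.1.2.1 | _ => g.1.2.2 end)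
     (fun h => g.2 - symp sigma g h).
Proof.
apply/funext => h; rewrite mulG_invG /haar_map.
have -> : symp sigma g (h.1, 0) = symp sigma g h by rewrite !sympE.
case: g h => [[[a b] [c d]] t] [[[a' b'] [c' d']] t'] /=.
by congr (((_, _), (_, _)), _) => /=; ring.
Qed.

Lemma measurable_symp_r g : measurable_fun setT (fun h => g.2 - symp sigma g h).
Proof.
apply: continuous_measurableG => h; apply: cvgB; first exact: cvg_cst.
have -> : symp sigma g = (fun h => - symp sigma h g) by apply/funext => x; rewrite sympC.
by apply: cvgN; exact: symp_continuous.
Qed.

(** The map h |-> g h^-1 is a reflection followed by a shear and a translation. *)
Lemma haar_mulG_inv g (A : set (G R)) : measurable A ->
  @haar R ((fun h => mulG sigma g (invG h)) @^-1` A) = (1%:E * @haar R A)%E.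
Proof.
move=> mA; rewrite mulG_inv_haar_map haar_haar_map//; last exact: measurable_symp_r.
by rewrite !normrN !normr1 invr1 !mulr1.
Qed.

Lemma conv_cconv N f : locint N -> testfun f -> conv sigma N f = cconv N f.
Proof.
move=> hN hf; apply/funext => g; rewrite /conv /cconv.
have mT : measurable_fun setT (fun h => mulG sigma g (invG h)).
  rewrite mulG_inv_haar_map; apply: measurable_haar_map; exact: measurable_symp_r.
have := @Cintegral_scale R _ _ (@haar R) 1 (fun h => mulG sigma g (invG h)) ler01 mT
  (@haar_mulG_inv g) _ (cconv_integrable g hN hf).
move=> [_]; rewrite mul1r => <-; apply: eq_Cintegral => h _ /=.
by rewrite ltrans_mulG.
Qed.

Lemma locint_ReIm M : locint M -> locintR (fun u => Re (M u)) /\ locintR (fun u => Im (M u)).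
Proof. by move=> h; split => K; have [] := h K. Qed.

Lemma cconv_ReIm M f : locint M -> testfun f ->
  (fun g => Re (cconv M f g)) = (fun g =>
    rconv sigma (fun u => Re (M u)) (fun u => Re (f u)) g + - rconv sigma (fun u => Im (M u)) (fun u => Im (f u)) g) /\
  (fun g => Im (cconv M f g)) = (fun g =>
    rconv sigma (fun u => Re (M u)) (fun u => Im (f u)) g + rconv sigma (fun u => Im (M u)) (fun u => Re (f u)) g).
Proof.
move=> hM [sf bf]; have [m1 m2] := locint_ReIm hM; have [b1 b2] := bsuppReIm bf.
have [c1 c2] := smoothC_cont sf.
split; apply/funext => g; rewrite /rconv /cconv /=.
  rewrite -(RintegralB measurableT (rconv_integrable sigma g m1 c1 b1) (rconv_integrable sigma g m2 c2 b2)).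
  by apply: eq_Rintegral => u _; rewrite ReM.
rewrite -(RintegralD measurableT (rconv_integrable sigma g m1 c2 b2) (rconv_integrable sigma g m2 c1 b1)).
by apply: eq_Rintegral => u _; rewrite ImM.
Qed.

Lemma smoothC_cconv M f : locint M -> testfun f -> smoothC (cconv M f).
Proof.
move=> hM hf n; have [e1 e2] := cconv_ReIm hM hf; have [sf bf] := hf.
have [m1 m2] := locint_ReIm hM; have [b1 b2] := bsuppReIm bf.
have s1 (q : nat) : Cn q (fun u => Re (f u)) by case: (sf q).
have s2 (q : nat) : Cn q (fun u => Im (f u)) by case: (sf q).
rewrite /CCn e1 e2; split; apply: CnD.
- exact: (@Cn_rconv _ _ _ _ _ m1 s1 b1).
- apply: CnN; exact: (@Cn_rconv _ _ _ _ _ m2 s2 b2).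
- exact: (@Cn_rconv _ _ _ _ _ m1 s2 b2).
- exact: (@Cn_rconv _ _ _ _ _ m2 s1 b1).
Qed.

Lemma locint_symp M v : locint M -> locint (fun u => (symp sigma u v)%:C * M u).
Proof.
move=> hM; apply: locint_contM => //.
by split; [exact: symp_continuous|exact: cst_continuous].
Qed.

Lemma fun_D_cconv M f v : locint M -> testfun f ->
  fun_D v (cconv M f) = fun g => cconv M (fun_D v f) g
     - cconv (fun u => (symp sigma u v)%:C * M u) (fun_D (e_t R) f) g.
Proof.
move=> hM hf; apply/funext => g; apply: is_cderive_funD.
have [sf bf] := hf; have [m1 m2] := locint_ReIm hM; have [b1 b2] := bsuppReIm bf.
have [e1 e2] := cconv_ReIm hM hf.
have s1 (q : nat) : Cn q (fun u => Re (f u)) by case: (sf q).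
have s2 (q : nat) : Cn q (fun u => Im (f u)) by case: (sf q).
have [d1 d2] := cconv_ReIm hM (testfun_funD v hf).
have [d3 d4] := cconv_ReIm (locint_symp v hM) (testfun_funD (e_t R) hf).
have q1 : (fun u => Re ((symp sigma u v)%:C * M u)) = (fun u => symp sigma u v * Re (M u)).
  by apply/funext => u; rewrite ReM /= mul0r subr0.
have q2 : (fun u => Im ((symp sigma u v)%:C * M u)) = (fun u => symp sigma u v * Im (M u)).
  by apply/funext => u; rewrite ImM /= mul0r addr0.
rewrite q1 q2 in d3 d4.
have r11 := rconv_derive sigma g v m1 s1 b1; have r22 := rconv_derive sigma g v m2 s2 b2.
have r12 := rconv_derive sigma g v m1 s2 b2; have r21 := rconv_derive sigma g v m2 s1 b1.
have D1 := congr1 (fun F => F g) d1; have D2 := congr1 (fun F => F g) d2.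
have D3 := congr1 (fun F => F g) d3; have D4 := congr1 (fun F => F g) d4; cbv beta in D1, D2, D3, D4.
have ReB (a b : R[i]) : Re (a - b) = Re a - Re b by rewrite ReD ReN.
have ImB (a b : R[i]) : Im (a - b) = Im a - Im b by rewrite ImD ImN.
split.
  apply: (eq_ind_r (fun F => is_derive g v F _) _ e1).
  apply: (is_derive_eq (is_deriveB r11 r22)).
  refine (esym (etrans (ReB _ _) (etrans (congr2 (fun a b => a - b) D1 D3) _))).
  have alg (a b c d : R) : a + - c - (b + - d) = a - b - (c - d) by ring.
  exact: alg.
apply: (eq_ind_r (fun F => is_derive g v F _) _ e2).
apply: (is_derive_eq (is_deriveD r12 r21)).
refine (esym (etrans (ImB _ _) (etrans (congr2 (fun a b => a - b) D2 D4) _))).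
have alg (a b c d : R) : a + c - (b + d) = a - b + (c - d) by ring.
exact: alg.
Qed.

End Convolution.

(** * From a fundamental solution to solvability *)

Section ConvolutionBox.
Context (R : realType) (sigma : 'I_2 -> R).
Implicit Types (M N f : G R -> R[i]) (u v g : G R) (j k : 'I_2) (eta : R[i]).

Let mu := @haar R.
Let CI F := Cintegrable mu setT F.
Let I F := Cintegral mu setT F.

Lemma Cintegral_lin4 (F1 F2 F3 F4 : G R -> R[i]) : CI F1 -> CI F2 -> CI F3 -> CI F4 ->
  I (fun u => F1 u + F2 u + (F3 u + F4 u)) = I F1 + I F2 + (I F3 + I F4).
Proof.
move=> h1 h2 h3 h4; have h12 := CintegrableD measurableT h1 h2.
have h34 := CintegrableD measurableT h3 h4.
rewrite /I (CintegralD measurableT h12 h34).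
by rewrite (CintegralD measurableT h1 h2) (CintegralD measurableT h3 h4).
Qed.

Lemma Cintegral_lin6 (h e c : R[i]) (F1 F2 F3 F4 F5 F6 : G R -> R[i]) :
  CI F1 -> CI F2 -> CI F3 -> CI F4 -> CI F5 -> CI F6 ->
  I (fun u => h * ((F1 u - F2 u) + e * (F3 u - F4 u)) + c * (F5 u - F6 u)) =
  h * ((I F1 - I F2) + e * (I F3 - I F4)) + c * (I F5 - I F6).
Proof.
move=> h1 h2 h3 h4 h5 h6.
have b12 := CintegrableB measurableT h1 h2; have b34 := CintegrableB measurableT h3 h4.
have b56 := CintegrableB measurableT h5 h6.
have z34 := CintegrableZ measurableT e b34; have z56 := CintegrableZ measurableT c b56.
have s14 := CintegrableD measurableT b12 z34; have zs := CintegrableZ measurableT h s14.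
rewrite /I (CintegralD measurableT zs z56) (CintegralZ measurableT h s14) (CintegralZ measurableT c b56).
rewrite (CintegralD measurableT b12 z34) (CintegralZ measurableT e b34).
by rewrite (CintegralB measurableT h1 h2) (CintegralB measurableT h3 h4) (CintegralB measurableT h5 h6).
Qed.

Lemma symp_x u j : symp sigma u (e_x R j) = 2 * sigma j * Im (zc j u).
Proof.
by rewrite sympE; case: (I2_cases j) => ->; rewrite /e_x /zc /=; ring.
Qed.

Lemma symp_y u j : symp sigma u (e_y R j) = - (2 * sigma j * Re (zc j u)).
Proof.
by rewrite sympE; case: (I2_cases j) => ->; rewrite /e_y /zc /=; ring.
Qed.

Lemma symp_t u : symp sigma u (e_t R) = 0.
Proof. by rewrite sympE /e_t /zc /=; ring. Qed.

Lemma ze_ltrans eta j u g : ze eta j (ltrans sigma u g) = ze eta j g - ze eta j u.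
Proof.
have E : zc j (ltrans sigma u g) = zc j g - zc j u by rewrite ltransE /zc; case: (j == ord0).
by rewrite /ze E ReD ImD ReN ImN; apply: complexP;
  rewrite ?(ReD,ImD,ReM,ImM,ReN,ImN) /=; ring.
Qed.

(** The coefficient of the derivative in t by which the field fails to commute
    with left translations. *)
Definition comm_coef eta j u : R[i] := 2 * eta * (sigma j)%:C * ze eta j u.

Lemma smoothC_comm_coef eta j : smoothC (comm_coef eta j).
Proof. by apply: (smoothCM (smoothC_cst _)); exact: smoothC_ze. Qed.

Lemma locint_comm_coef eta j M : locint M -> locint (fun u => comm_coef eta j u * M u).
Proof. by move=> hM; apply: locint_contM => //; apply: smoothC_cont; exact: smoothC_comm_coef. Qed.

Lemma vfield_cconv eta j M f : eta ^+ 2 = -1 -> locint M -> testfun f ->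
  vfield sigma eta j (cconv sigma M f) = fun g => cconv sigma M (vfield sigma eta j f) g
    + cconv sigma (fun u => comm_coef eta j u * M u) (fun_D (e_t R) f) g.
Proof.
move=> eta2 hM hf; apply/funext => g; rewrite {1}/vfield !fun_D_cconv//.
have tx := testfun_funD (e_x R j) hf; have ty := testfun_funD (e_y R j) hf; have tt := testfun_funD (e_t R) hf.
have J F h := @cconv_integrable R sigma F h g.
have ix := J _ _ hM tx; have iy := J _ _ hM ty; have it := J _ _ hM tt.
have iox := J _ _ (locint_symp sigma (e_x R j) hM) tt.
have ioy := J _ _ (locint_symp sigma (e_y R j) hM) tt.
have iot := J _ _ (locint_symp sigma (e_t R) hM) tt.
have iL := J _ _ hM (testfun_vfield sigma eta j hf).
have ic := J _ _ (locint_comm_coef eta j hM) tt.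
refine (etrans (esym (Cintegral_lin6 _ _ _ ix iox iy ioy it iot)) (etrans _ (CintegralD measurableT iL ic))).
apply: eq_Cintegral => u _; rewrite symp_x symp_y symp_t /vfield /comm_coef ze_ltrans.
have -> : (2 * sigma j * Im (zc j u))%:C = 2 * (sigma j)%:C * (Im (zc j u))%:C :> R[i].
  by apply: complexP; rewrite !(ReM,ImM) /=; ring.
have -> : (- (2 * sigma j * Re (zc j u)))%:C = - (2 * (sigma j)%:C * (Re (zc j u))%:C) :> R[i].
  by apply: complexP; rewrite !(ReM,ImM,ReN,ImN) /=; ring.
rewrite [ze eta j u]/ze.
have alg (m s x y e zg X Y T : R[i]) : e ^+ 2 = -1 ->
  2^-1 * (m * X - 2 * s * y * m * T + e * (m * Y - - (2 * s * x) * m * T)) + e * s * zg * (m * T - 0 * m * T)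
  = m * (2^-1 * (X + e * Y) + e * s * (zg - (x + e * y)) * T) + 2 * e * s * (x + e * y) * m * T.
  move=> h; have h' : e * e = -1 by rewrite -expr2.
  by field: h'.
exact: alg.
Qed.

Lemma fun_D_reflected f u v g : smoothC f ->
  fun_D v (reflected sigma f g) u = - fun_D v f (ltrans sigma u g) - (symp sigma v g)%:C * fun_D (e_t R) f (ltrans sigma u g).
Proof.
move=> sf; apply: is_cderive_funD.
have H (h : G R -> R) : (forall n, Cn n h) -> is_derive u v (fun x => h (ltrans sigma x g))
   (- 'D_v h (ltrans sigma u g) - symp sigma v g * 'D_(e_t R) h (ltrans sigma u g)).
  move=> sh.
  apply: (@is_derive_affine R _ _ (fun x => ltrans sigma x g) u v h (-1 *: v + - symp sigma v g *: e_t R)).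
    by move=> k; exact: ltrans_linear_l.
  set p := ltrans _ _ _.
  have [d1 d2] := derive_add_dir p (-1 *: v) (- symp sigma v g *: e_t R) (sh 1%N).
  have [_ d3] := derive_scale_dir (-1) (Cn_derivable (p := p) (v := v) (sh 1%N)).
  have [_ d4] := derive_scale_dir (- symp sigma v g) (Cn_derivable (p := p) (v := e_t R) (sh 1%N)).
  apply: DeriveDef => //; rewrite d2 d3 d4.
  by rewrite mulN1r mulNr.
have H1 := H _ (fun n => (sf n).1); have H2 := H _ (fun n => (sf n).2).
split.
  by apply: (is_derive_eq H1); rewrite ReD !ReN ReM /= mul0r subr0.
by apply: (is_derive_eq H2); rewrite ImD !ImN ImM /= mul0r addr0.
Qed.

(** Compared with [vfield_cconv], the sign is reversed: on f(u^-1 g) the field in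
    u is the opposite of the field in g. *)
Lemma vfield_reflected eta j f g : eta ^+ 2 = -1 -> smoothC f ->
  vfield sigma eta j (reflected sigma f g) = fun u =>
   -1 * reflected sigma (vfield sigma eta j f) g u + -1 * (comm_coef eta j u * reflected sigma (fun_D (e_t R) f) g u).
Proof.
move=> eta2 sf; apply/funext => u; rewrite {1}/vfield !fun_D_reflected// /reflected.
rewrite [symp sigma (e_x R j) g]sympC [symp sigma (e_y R j) g]sympC [symp sigma (e_t R) g]sympC.
rewrite symp_x symp_y symp_t /vfield /comm_coef ze_ltrans.
have -> : (- (2 * sigma j * Im (zc j g)))%:C = - (2 * (sigma j)%:C * (Im (zc j g))%:C) :> R[i].
  by apply: complexP; rewrite !(ReM,ImM,ReN,ImN) /=; ring.
have -> : (- - (2 * sigma j * Re (zc j g)))%:C = 2 * (sigma j)%:C * (Re (zc j g))%:C :> R[i].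
  by apply: complexP; rewrite !(ReM,ImM) /=; ring.
rewrite [ze eta j g]/ze oppr0.
have alg (s x y e zu X Y T : R[i]) : e ^+ 2 = -1 ->
  2^-1 * (- X - - (2 * s * y) * T + e * (- Y - 2 * s * x * T)) + e * s * zu * (- T - 0 * T) =
  -1 * (2^-1 * (X + e * Y) + e * s * (x + e * y - zu) * T) + -1 * (2 * e * s * zu * T).
  move=> h; have h' : e * e = -1 by rewrite -expr2.
  by field: h'.
exact: alg.
Qed.

Lemma vfield_comm_coef_mul eta eta' j f : eta * eta' = 1 -> smoothC f ->
  vfield sigma eta' j (fun u => comm_coef eta j u * f u) = fun u =>
    comm_coef eta j u * vfield sigma eta' j f u + 2 * eta * (sigma j)%:C * f u.
Proof.
move=> ee sf; apply/funext => u; rewrite {1}/vfield !(fun_D_mul _ (smoothC_comm_coef eta j) sf).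
have D v : fun_D v (comm_coef eta j) u = 2 * eta * (sigma j)%:C * ze eta j v.
  rewrite (fun_D_cmul _ _ (smoothC_ze eta j)); congr (_ * _).
  exact: is_cderive_funD (cderive_ze u v eta j).
rewrite !D ze_x ze_y ze_t /vfield.
have alg (e e' s z c X Y T f0 : R[i]) : e * e' = 1 ->
  2^-1 * (c * X + 2 * e * s * 1 * f0 + e' * (c * Y + 2 * e * s * e * f0)) +
    z * (c * T + 2 * e * s * 0 * f0) =
  c * (2^-1 * (X + e' * Y) + z * T) + 2 * e * s * f0.
  by move=> h; field: h.
exact: alg.
Qed.

(** Applying two fields in g amounts to applying them in u in the opposite
    order; the two sign changes cancel. *)
Lemma vfield2_cconv eta eta' j N f g : eta ^+ 2 = -1 -> eta' = - eta -> locint N -> testfun f ->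
  vfield sigma eta j (vfield sigma eta' j (cconv sigma N f)) g =
  Cintegral (@haar R) setT (fun u => N u * vfield sigma eta' j (vfield sigma eta j (reflected sigma f g)) u).
Proof.
move=> eta2 etaN hN hf; have [sf bf] := hf.
have eta2' : eta' ^+ 2 = -1 by rewrite etaN sqrrN.
have ee : eta * eta' = 1 by rewrite etaN mulrN -expr2 eta2 opprK.
have ee' : eta' * eta = 1 by rewrite mulrC.
have tT := testfun_funD (e_t R) hf; have [sT _] := tT.
have tL' := testfun_vfield sigma eta' j hf; have tL := testfun_vfield sigma eta j hf.
have [sL _] := tL; have [sL' _] := tL'.
have hcN := locint_comm_coef eta' j hN.
rewrite (vfield_cconv _ eta2' hN hf).
rewrite vfield_add; [|exact: smoothC_cconv|exact: smoothC_cconv].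
rewrite (vfield_cconv _ eta2 hN tL') (vfield_cconv _ eta2 hcN tT).
rewrite (vfield_reflected _ _ eta2 sf).
have sA := smoothC_reflected sigma g sL.
have sB := smoothC_reflected sigma g sT.
have sC := smoothCM (smoothC_comm_coef eta j) sB.
rewrite (vfield_add sigma eta' j (smoothCM (smoothC_cst (-1)) sA) (smoothCM (smoothC_cst (-1)) sC)).
rewrite (vfield_cmul sigma eta' j (-1) sA) (vfield_cmul sigma eta' j (-1) sC).
rewrite (vfield_comm_coef_mul _ ee sB) (vfield_reflected _ _ eta2' sL) (vfield_reflected _ _ eta2' sT).
have tLL' := testfun_vfield sigma eta j tL'; have tTL' := testfun_funD (e_t R) tL'.
have tLT := testfun_vfield sigma eta j tT; have tTT := testfun_funD (e_t R) tT.
have i1 := cconv_integrable sigma g hN tLL'.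
have i2 := cconv_integrable sigma g (locint_comm_coef eta j hN) tTL'.
have i3 := cconv_integrable sigma g hcN tLT.
have i4 := cconv_integrable sigma g (locint_comm_coef eta j hcN) tTT.
refine (etrans (esym (Cintegral_lin4 i1 i2 i3 i4)) _).
apply: eq_Cintegral => u _; rewrite /reflected.
set p := ltrans sigma u g.
have C := vfield_comm sigma j p sf ee.
have T1 := congr1 (fun F => F p) (vfield_t sigma eta j sf).
have T2 := congr1 (fun F => F p) (vfield_t sigma eta' j sf).
have alg (n c c' s e e' a b t1 t1' t2 t2' tt t : R[i]) : e' = - e ->
   a = b + (e' - e) * s * t -> t1 = t1' -> t2 = t2' ->
   n * a + c * n * t2 + (c' * n * t1 + c * (c' * n) * tt) =
   n * (-1 * (-1 * b + -1 * (c' * t1')) + -1 * (c * (-1 * t2' + -1 * (c' * tt)) + 2 * e * s * t)).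
  by move=> -> -> -> ->; ring.
refine (alg _ _ _ _ _ _ _ _ _ _ _ _ _ _ etaN C T1 _).
exact: esym T2.
Qed.

Lemma ltrans_0l g : ltrans sigma 0 g = g.
Proof.
have om0 : symp sigma 0 g = 0.
  by have := sympDl sigma (-1) 0 0 g; rewrite scaler0 addr0 mulN1r addNr.
by rewrite ltransE om0 !subr0 -surjective_pairing.
Qed.

Lemma vfield0 eta j : vfield sigma eta j (fun=> 0) = fun=> 0.
Proof. by apply/funext => x; rewrite /vfield !fun_D_cst !mulr0 !addr0 mulr0. Qed.

Lemma Box_cconv k N f g : locint N -> testfun f ->
  Box (@fun_D R) (@fun_mul R) sigma k (cconv sigma N f) g =
  Cintegral mu setT (fun u => N u * Box_tr sigma k (reflected sigma f g) u).
Proof.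
move=> hN hf; have ht := testfun_reflected sigma g hf.
rewrite BoxE vecZ_fun vecZbar_fun vecZbar_fun vecZ_fun.
have i2 : ('i%C : R[i]) ^+ 2 = -1 by rewrite sqr_i.
have i2' : (- 'i%C : R[i]) ^+ 2 = -1 by rewrite sqrrN sqr_i.
rewrite (vfield2_cconv k g i2 erefl hN hf) (vfield2_cconv (other k) g i2' (esym (opprK _)) hN hf).
have J eta eta' j : CI (fun u => N u * vfield sigma eta j (vfield sigma eta' j (reflected sigma f g)) u).
  have [sL bL] := testfun_vfield sigma eta j (testfun_vfield sigma eta' j ht).
  exact: (locint_mul hN (smoothC_cont sL) bL).
have J1 := CintegrableN measurableT (J (- 'i%C) 'i%C k).
have J2 := J 'i%C (- 'i%C) (other k).
refine (etrans (congr2 (fun a b => a - b) (esym (CintegralN measurableT (J _ _ k))) erefl) _).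
refine (etrans (esym (CintegralB measurableT J1 J2)) _).
apply: eq_Cintegral => u _; rewrite /Box_tr.
have alg (n a b : R[i]) : - (n * a) - n * b = n * (- a - b) by ring.
exact: alg.
Qed.

(** The convolution identity at g is the distributional identity for the test
    function u |-> f(u^-1 g). *)
Lemma fundamental_solvable k N : locint N ->
  (forall f, testfun f -> Cintegral mu setT (fun u => N u * Box_tr sigma k f u) = f 0) ->
  solvable_by_convolution sigma k N.
Proof.
move=> hN hk; split.
- exact: locint_locally_integrable.
- move=> f /test_function_testfun hf.
  by rewrite (Box_distr _ _ (test_linear_distr_of hN) hf); exact: hk.
- move=> f /test_function_testfun hf; rewrite (conv_cconv sigma hN hf); split.
    exact: smoothC_cconv.
  apply/funext => j; rewrite /box_b /form_dzbar; case: ifPn => [/eqP ->|_].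
    apply/funext => g; rewrite (Box_cconv k g hN hf) hk; last exact: testfun_reflected.
    by rewrite /reflected ltrans_0l.
  apply/funext => g; rewrite BoxE vecZ_fun vecZbar_fun vecZbar_fun vecZ_fun.
  by rewrite !vfield0 subr0 oppr0.
Qed.

End ConvolutionBox.

(** * Integrable powers *)

Section Tensor.
Context d1 d2 (T1 : measurableType d1) (T2 : measurableType d2) (R : realType).
Variable m1 : {sigma_finite_measure set T1 -> \bar R}.
Variable m2 : {sigma_finite_measure set T2 -> \bar R}.

Lemma integrable_tensor (f : T1 -> R) (g : T2 -> R) :
  m1.-integrable setT (EFin \o f) -> m2.-integrable setT (EFin \o g) ->
  (m1 \x m2)%E.-integrable setT (EFin \o (fun p => f p.1 * g p.2)).
Proof.
move=> hf hg.
have mf : measurable_fun setT f by exact/measurable_EFinP/(measurable_int _ hf).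
have mg : measurable_fun setT g by exact/measurable_EFinP/(measurable_int _ hg).
apply/integrable12ltyP.
  apply/measurable_EFinP; apply: measurable_funM.
    exact: measurableT_comp.
  exact: measurableT_comp.
have [_ f1] := integrableP _ _ _ hf; have [_ g1] := integrableP _ _ _ hg.
pose c := (\int[m2]_y `|(g y)%:E|)%E.
have c0 : (0 <= c)%E by exact: integral_ge0.
have cfin : c \is a fin_num by rewrite ge0_fin_numE.
rewrite (eq_integral (fun x => `|(f x)%:E| * c)%E); last first.
  move=> x _; rewrite /c -ge0_integralZl//.
  - by apply: eq_integral => y _ /=; rewrite normrM EFinM.
  - by apply: measurableT_comp => //; exact/measurable_EFinP.
rewrite ge0_integralZr//.
  by apply: lte_mul_pinfty => //; rewrite ?integral_ge0// ge0_fin_numE// integral_ge0.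
by apply: measurableT_comp => //; exact/measurable_EFinP.
Qed.

End Tensor.

Section Powers.
Context (R : realType).
Local Notation mu := (@lebesgue_measure R).

(** The fundamental theorem of calculus bounds the integrals over the intervals
    [M / n, M] uniformly by M^a / a. *)
Lemma integrable_powR_itv (a M : R) : 0 < a -> 0 < M ->
  mu.-integrable `]0, M[ (EFin \o (fun x => x `^ (a - 1))).
Proof.
move=> a0 M0.
have mp : measurable_fun setT (fun x : R => x `^ (a - 1)) by exact: measurable_powR.
pose F n : set R := `[M / n.+2%:R, M]%classic.
have FM n : M / n.+2%:R < M.
  by rewrite ltr_pdivrMr// ltr_pMr// ltr1n.
have F0 n : 0 < M / n.+2%:R :> R by rewrite divr_gt0.
have cF : `]0, M[%classic `<=` \bigcup_n F n.
  move=> x /=; rewrite in_itv /= => /andP[x0 xM].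
  have /archi_boundP : 0 <= M / x by rewrite divr_ge0 ?ltW.
  set n := Num.Def.archi_bound _ => nM.
  exists n => //; rewrite /F /= in_itv /= (ltW xM) andbT.
  rewrite ler_pdivrMr// mulrC -ler_pdivrMr// (le_trans (ltW nM))//.
  by rewrite ler_nat (leq_trans (leqnSn _))// leqnSn.
apply/integrableP; split.
  by apply/measurable_EFinP; exact: measurable_funS mp.
apply: (@le_lt_trans _ _ (\int[mu]_(x in \bigcup_n F n) (x `^ (a - 1))%:E)%E).
  apply: (@le_trans _ _ (\int[mu]_(x in `]0%R, M[) (x `^ (a - 1))%:E)%E).
    rewrite le_eqVlt; apply/orP; left; apply/eqP; apply: eq_integral => x _ /=.
    by rewrite ger0_norm// powR_ge0.
  apply: ge0_subset_integral => //.
  - by apply: bigcup_measurable => n _; exact: measurable_itv.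
  - by apply/measurable_EFinP; exact: measurable_funS mp.
  - by move=> x _; rewrite lee_fin powR_ge0.
have ndF : nondecreasing_seq F.
  move=> n m nm; apply/subsetPset => x; rewrite /F /= !in_itv /= => /andP[h ->].
  rewrite andbT (le_trans _ h)// ler_pM2l// lef_pV2 ?posrE// ler_nat.
  by rewrite !ltnS.
have cv : (\int[mu]_(x in F n) (x `^ (a - 1))%:E)%E @[n --> \oo] -->
    (\int[mu]_(x in \bigcup_n F n) (x `^ (a - 1))%:E)%E.
  apply: ge0_nondecreasing_set_cvg_integral => //.
  - by move=> n; exact: measurable_itv.
  - by move=> n; apply/measurable_EFinP; exact: measurable_funS mp.
  - by move=> n x _; rewrite lee_fin powR_ge0.
have FTC n : (\int[mu]_(x in F n) (x `^ (a - 1))%:E <= (M `^ a / a)%:E)%E.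
  have dp (x : R) : 0 < x -> is_derive x 1 (fun x => x `^ a / a) (x `^ (a - 1)).
    move=> x0; have h := is_derive1_powR a x0.
    have -> : (fun x => x `^ a / a) = a^-1 \*: (fun x => x `^ a) :> (R -> R) by apply/funext => y; rewrite mulrC.
    apply: (is_derive_eq (is_deriveZ a^-1 h)).
    by rewrite -[_ *: _]/(_ * _) mulrA mulVf ?mul1r// gt_eqF.
  have cp (b x : R) : 0 < x -> {for x, continuous (fun x => x `^ b)}.
    move=> x0; apply: differentiable_continuous; apply/derivable1_diffP.
    by case: (is_derive1_powR b x0).
  rewrite /F (@continuous_FTC2 _ _ (fun x => x `^ a / a)).
  - rewrite -EFinB lee_fin gerBl divr_ge0 ?powR_ge0// ltW//.
  - exact: FM.
  - apply: continuous_in_subspaceT => x; rewrite inE /= in_itv /= => /andP[h _].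
    by apply: cp; exact: lt_le_trans h.
  - split.
    + move=> x; rewrite in_itv /= => /andP[h _].
      by case: (dp x (lt_trans (F0 n) h)).
    + apply: cvg_at_right_filter; apply: cvgM; last exact: cvg_cst.
      exact: cp.
    + apply: cvg_at_left_filter; apply: cvgM; last exact: cvg_cst.
      exact: cp.
  - move=> x; rewrite in_itv /= => /andP[h _]; rewrite derive1E.
    by case: (dp x (lt_trans (F0 n) h)).
apply: (@le_lt_trans _ _ (M `^ a / a)%:E); last exact: ltry.
rewrite -(cvg_lim _ cv)//.
apply: lime_le; last by apply: nearW => n; exact: FTC.
by apply/cvg_ex; eexists; exact: cv.
Qed.

(** Extension by zero keeps the dominating functions integrable on the whole
    line, so that they can be multiplied in independent variables. *)
Definition cutpow (a M x : R) : R := \1_(`]0, M[%classic) x * x `^ (a - 1).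

Lemma cutpowE a M x : 0 < x < M -> cutpow a M x = x `^ (a - 1).
Proof. by move=> h; rewrite /cutpow indicE mem_set ?mul1r// /= in_itv. Qed.

Lemma cutpow_ge0 a M x : 0 <= cutpow a M x.
Proof. by rewrite mulr_ge0 ?powR_ge0// indicE. Qed.

Lemma measurable_cutpow a M : measurable_fun setT (cutpow a M).
Proof.
apply: measurable_funM; first exact: measurable_indic.
exact: measurable_powR.
Qed.

Lemma integrable_cutpow (a M : R) : 0 < a -> 0 < M ->
  mu.-integrable setT (EFin \o cutpow a M).
Proof.
move=> a0 M0; have h := integrable_powR_itv a0 M0.
have -> : EFin \o cutpow a M = (EFin \o (fun x => x `^ (a - 1))) \_ `]0, M[%classic
    :> (R -> \bar R).
  apply/funext => x; rewrite patchE /cutpow /= indicE.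
  by case: ifP => _; rewrite ?mul1r ?mul0r.
by move: h; rewrite integrable_mkcond//; exact: measurable_itv.
Qed.

Lemma integrable_flip (c : R) (f : R -> R) : mu.-integrable setT (EFin \o f) ->
  mu.-integrable setT (EFin \o (fun x => f (-1 * x + c))).
Proof.
apply: (@integrable_scale R _ _ mu 1 (fun x => -1 * x + c)) => //.
  exact: measurable_affine.
have N1 : (-1 : R) != 0 by rewrite oppr_eq0 oner_eq0.
move=> A mA; have := lebesgue_measure_affine_neq0 c N1 mA.
by rewrite normrN normr1 invr1.
Qed.

(** Reflecting [cutpow] gives |x|^(a-1) on ]-M, M[ except at x = 0. *)
Definition cutpow_abs (a M x : R) : R := cutpow a M x + cutpow a M (-1 * x + 0).

Lemma cutpow_absE a M x : x != 0 -> `|x| < M -> cutpow_abs a M x = `|x| `^ (a - 1).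
Proof.
rewrite /cutpow_abs addr0 mulN1r => x0 xM; have [x_gt0|x_le0] := ltP 0 x.
  move: xM; rewrite gtr0_norm// => xM; rewrite cutpowE ?x_gt0//.
  rewrite [X in _ + X](_ : _ = 0) ?addr0//.
  by rewrite /cutpow indicE memNset ?mul0r//= in_itv /= oppr_gt0 ltNge (ltW x_gt0).
have xlt0 : x < 0 by rewrite lt_neqAle x0.
move: xM; rewrite ltr0_norm// => xM; rewrite [X in _ + X]cutpowE ?oppr_gt0 ?xlt0//.
rewrite [X in X + _](_ : _ = 0) ?add0r//.
by rewrite /cutpow indicE memNset ?mul0r//= in_itv /= ltNge x_le0.
Qed.

Lemma cutpow_abs_ge0 a M x : 0 <= cutpow_abs a M x.
Proof. by rewrite addr_ge0 ?cutpow_ge0. Qed.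

Lemma integrable_cutpow_abs (a M : R) : 0 < a -> 0 < M ->
  mu.-integrable setT (EFin \o cutpow_abs a M).
Proof.
move=> a0 M0; have h := integrable_cutpow a0 M0.
move: (integrableD measurableT h (integrable_flip 0 h)).
by apply: eq_integrable => // x _.
Qed.

(** The function r^(a-1) (1-r)^(-1/2) on ]0, 1[. *)
Definition betafun (a r : R) : R := cutpow a 1 r * cutpow 2^-1 1 (-1 * r + 1).

(** Only one of the two factors is singular on each half of ]0, 1[. *)
Lemma integrable_betafun (a : R) : 0 < a -> mu.-integrable setT (EFin \o betafun a).
Proof.
move=> a0; pose C := 1 + 2^-1 `^ (a - 1) : R.
have h2 : (0 : R) < 2^-1 by [].
have C1 : 1 <= C by rewrite lerDl powR_ge0.
have i1 := integrableZl measurableT 2 (integrable_cutpow a0 ltr01).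
have i2 := integrableZl measurableT C (integrable_flip 1 (integrable_cutpow h2 ltr01)).
apply: (le_integrable _ _ _ (integrableD _ i1 i2)) => //.
  apply/measurable_EFinP; apply: measurable_funM; first exact: measurable_cutpow.
  exact: (measurableT_comp (measurable_cutpow _ _) (measurable_affine _ _)).
move=> r _; rewrite -!EFinM -EFinD !abse_EFin lee_fin.
rewrite /betafun ger0_norm; last exact: mulr_ge0 (cutpow_ge0 _ _ _) (cutpow_ge0 _ _ _).
have p1 := cutpow_ge0 a 1 r; have p2 := cutpow_ge0 2^-1 1 (-1 * r + 1).
rewrite ger0_norm; last by rewrite addr_ge0// mulr_ge0// (le_trans _ C1).
have -> : -1 * r + 1 = 1 - r by ring.
have [r01|r01] := boolP (0 < r < 1); last first.
  rewrite {1}/cutpow indicE memNset ?mul0r ?mul0r; last by rewrite /= in_itv /=; exact/negP.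
  by rewrite addr_ge0// mulr_ge0// ?cutpow_ge0// (le_trans _ C1).
rewrite !cutpowE//; last by move: r01; lra.
have [r2|r2] := lerP r 2^-1.
  rewrite (@le_trans _ _ (2 * r `^ (a - 1)))//; last first.
    by rewrite lerDl mulr_ge0 ?powR_ge0// (le_trans _ C1).
  rewrite mulrC ler_wpM2r ?powR_ge0//.
  have -> : 2^-1 - 1 = - 2^-1 :> R by lra.
  rewrite powRN powR12_sqrt; last by move: r01 => /andP[]; lra.
  have sq : 2^-1 <= Num.sqrt (1 - r).
    rewrite -[leLHS]ger0_norm// -sqrtr_sqr ler_wsqrtr// expr2.
    by move: r2; lra.
  by rewrite -[leRHS]invrK lef_pV2// posrE// (lt_le_trans h2).
rewrite (@le_trans _ _ (C * (1 - r) `^ (2^-1 - 1)))//; last first.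
  by rewrite lerDr mulr_ge0 ?powR_ge0.
rewrite ler_wpM2r ?powR_ge0//.
have r0 : 0 < r by case/andP : r01.
have [a1|a1] := orP (le_total 1 a).
  apply: (le_trans _ C1); rewrite -[leRHS](powRr0 r).
  apply: ger_powR; last by rewrite subr_ge0.
  by rewrite r0; case/andP : r01 => _ /ltW ->.
apply: (@le_trans _ _ (2^-1 `^ (a - 1))); last by rewrite lerDr.
have -> : a - 1 = - (1 - a) by ring.
rewrite !powRN lef_pV2 ?posrE ?powR_gt0// ge0_ler_powR ?nnegrE ?(ltW r0) ?(ltW r2)//.
by rewrite subr_ge0.
Qed.

End Powers.

(** * Polar coordinates in C *)

Section Radial.
Context (R : realType).
Local Notation mu := (@lebesgue_measure R).
Local Notation nu := (@lebesgueC R).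

Definition rsq (p : R * R) : R := p.1 ^+ 2 + p.2 ^+ 2.

Lemma measurable_rsq : measurable_fun setT rsq.
Proof. by apply: measurable_funD; apply: measurable_funX; [exact: measurable_fst|exact: measurable_snd]. Qed.

Lemma rsq_ge0 p : 0 <= rsq p. Proof. by rewrite addr_ge0// sqr_ge0. Qed.

Let disc (a : R) : set (R * R) := [set p | rsq p <= a].

Let mdisc a : measurable (disc a).
Proof.
rewrite -[disc a]setTI; have := measurable_rsq measurableT (measurable_itv `]-oo, a]).
by congr (measurable _); apply/seteqP; split => p /=; rewrite in_itv /=.
Qed.

Let areaM (a : R) : 0 < a -> nu (disc a) = (a%:E * nu (disc 1))%E.
Proof.
move=> a0; pose k := (Num.sqrt a)^-1.
have k0 : 0 < k by rewrite invr_gt0 sqrtr_gt0.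
have ki : 0 <= k^-1 by rewrite invr_ge0 ltW.
have := @product_measure_skew R _ _ _ _ mu mu (fun x => k * x + 0) (fun _ x => k * x + 0) k^-1 k^-1
  (disc 1) ki ki (measurable_affine k 0).
have -> : k^-1 * k^-1 = a by rewrite /k invrK -expr2 sqr_sqrtr// ltW.
move=> e; refine (etrans _ (e _ _ _)); clear e => //.
- congr (nu _); apply/seteqP; split => -[x y]; rewrite /disc /rsq /= !addr0 !exprMn -mulrDr
    /k exprVn sqr_sqrtr ?(ltW a0)// mulrC ler_pdivrMr// mul1r => h; exact: h.
- by move=> B mB; exact: lebesgue_measure_affine.
- by move=> _ B mB; exact: lebesgue_measure_affine.
- exact: mdisc.
Qed.

Let kappa := fine (nu (disc 1)).

Let square_area (a b : R) : a < b ->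
  nu (`[a, b]%classic `*` `[a, b]%classic) = ((b - a) * (b - a))%:E.
Proof.
move=> ab; have e : lebesgue_measure (`[a, b]%classic : set R) = (b - a)%:E.
  by rewrite lebesgue_measure_itv/= lte_fin ab.
rewrite /lebesgueC product_measure1E//.
exact: (etrans (congr2 mule e e)).
Qed.

Let disc1_fin : nu (disc 1) = kappa%:E.
Proof.
rewrite /kappa fineK// ge0_fin_numE//.
apply: (@le_lt_trans _ _ (nu (`[-1, 1]%classic `*` `[-1, 1]%classic))).
  apply: le_measure; rewrite ?inE; [exact: mdisc|by apply: measurableX|].
  move=> [x y]; rewrite /disc /rsq /= => h; split; rewrite /= in_itv /= -ler_norml.
    by rewrite -(@ler_pXn2r _ 2) ?nnegrE// expr1n real_normK ?num_real// (le_trans _ h)// lerDl sqr_ge0.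
  by rewrite -(@ler_pXn2r _ 2) ?nnegrE// expr1n real_normK ?num_real// (le_trans _ h)// lerDr sqr_ge0.
by rewrite square_area ?ltry//; lra.
Qed.

Let kappa_gt0 : 0 < kappa.
Proof.
rewrite -lte_fin -disc1_fin.
apply: (@lt_le_trans _ _ (nu (`[0, 2^-1]%classic `*` `[0, 2^-1]%classic))).
  by rewrite square_area ?lte_fin ?invr_gt0// subr0 mulr_gt0.
apply: le_measure; rewrite ?inE; [by apply: measurableX|exact: mdisc|].
move=> [x y] []; rewrite /disc /rsq /= !in_itv /= => /andP[x0 x1] /andP[y0 y1].
by nra.
Qed.

Let disc0 : nu (disc 0) = 0%E.
Proof.
apply/eqP; rewrite -measure_le0.
apply: (@le_trans _ _ (nu ([set 0] `*` setT))).
  apply: le_measure; rewrite ?inE; [exact: mdisc|by apply: measurableX|].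
  move=> [x y]; rewrite /disc /rsq /= => h; split => //=.
  apply/eqP; rewrite -sqrf_eq0 eq_le sqr_ge0 andbT.
  by rewrite (le_trans _ h)// lerDl sqr_ge0.
rewrite /lebesgueC product_measure1E//.
have e : lebesgue_measure [set 0 : R] = 0%E by exact: lebesgue_measure_set1.
by rewrite (eq_ind_r (fun z => (z * _ <= 0)%E) _ e)// mul0e.
Qed.

Let discE (a : R) : nu (disc a) = (kappa * Num.max a 0)%:E.
Proof.
have [a0|a0] := ltP 0 a; first by rewrite areaM// disc1_fin -EFinM mulrC.
rewrite mulr0; apply/eqP; rewrite -measure_le0 -disc0.
apply: le_measure; [by rewrite inE; exact: mdisc|by rewrite inE; exact: mdisc|].
by move=> p h; exact: le_trans a0.
Qed.

Let rsqP (a b : R) : a < b -> nu (rsq @^-1` `]a, b]) = (kappa * (Num.max b 0 - Num.max a 0))%:E.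
Proof.
move=> ab.
have -> : rsq @^-1` `]a, b] = disc b `\` disc a.
  apply/seteqP; split => p; rewrite /= in_itv /=.
    by move=> /andP[h1 h2]; split => //; rewrite /disc /=; apply/negP; rewrite -ltNge.
  by move=> [-> /negP]; rewrite -ltNge => ->.
have bfin : (nu (disc b) < +oo)%E by rewrite discE ltry.
have := @measureD _ _ _ nu _ _ (mdisc b) (mdisc a) bfin.
rewrite setIidr; last by move=> p /= h; exact: le_trans (ltW ab).
move=> h; apply: (etrans h); apply: (etrans (congr2 (fun x y => x - y)%E (discE b) (discE a))).
by rewrite -EFinB mulrBr.
Qed.

Let pos := `]0%R, +oo[%classic : set R.
Let neg := `]-oo, 0%R]%classic : set R.

(** By scaling, the area of the disc of squared radius a is a multiple of a; so
    |z|^2 carries the area to a multiple of Lebesgue measure on the half-line.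
    Adding the missing negative half-line allows an appeal to the uniqueness of
    Lebesgue measure. *)
Let push_rsq (A : set R) : measurable A -> A `<=` pos ->
  nu (rsq @^-1` A) = (kappa%:E * mu A)%E.
Proof.
move=> mA Apos.
have k0 : 0 <= kappa^-1 by rewrite invr_ge0 ltW.
pose f : R * R -> measurableTypeR R := rsq.
have mf : measurable_fun setT f by exact: measurable_rsq.
pose m1 : {measure set (measurableTypeR R) -> \bar R} := pushforward nu f.
have mneg : measurable (neg : set (measurableTypeR R)) by exact: measurable_itv.
(* The measure m is Lebesgue measure on the whole line, by uniqueness. *)
pose m : {measure set (measurableTypeR R) -> \bar R} :=
  measure_add (mscale (NngNum k0) (m1 mf)) (mrestr mu mneg).
have mE B : m B = (kappa^-1%:E * nu (rsq @^-1` B) + mu (B `&` neg))%E.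
  by rewrite /m /measure_add/= /msum !big_ord_recl big_ord0 adde0.
have -> : mu A = m A.
  apply: lebesgue_measure_unique => // _ [[a b]] _ <- /=.
  rewrite mE /=; have [ab|ba] := ltP a b; last first.
    rewrite set_itv_ge; last by rewrite bnd_simp -leNgt.
    by rewrite preimage_set0 set0I !measure0 mule0 adde0.
  rewrite rsqP// -EFinM mulKf ?gt_eqF//.
  have -> : `]a, b]%classic `&` neg = `]a, Num.min b 0]%classic.
    apply/seteqP; split => x; rewrite /neg /= !in_itv /= le_min.
      by move=> [/andP[-> ->]] ->.
    by move=> /and3P[-> -> ->].
  rewrite !lebesgue_measure_itv/= !lte_fin ab lt_min ab /=.
  by case: (ltP a 0) => a0; case: (ltP b 0) => b0;
    rewrite -?EFinB -?EFinD ?adde0; congr EFin; lra.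
rewrite mE; have -> : A `&` neg = set0.
  apply/seteqP; split => // x [/Apos]; rewrite /pos /neg /= !in_itv /= andbT.
  by move=> /lt_le_trans h /h; rewrite ltxx.
by rewrite measure0 adde0 muleA -EFinM mulfV ?mul1e ?gt_eqF.
Qed.

Let radial_kappa (h : R -> \bar R) : measurable_fun setT h ->
  (forall x, 0 <= h x)%E ->
  (\int[nu]_p h (rsq p) = kappa%:E * \int[mu]_(x in pos) h x)%E.
Proof.
move=> mh h0.
pose f : R * R -> measurableTypeR R := rsq.
have mf : measurable_fun setT f by exact: measurable_rsq.
have mpos : measurable (pos : set (measurableTypeR R)) by exact: measurable_itv.
have -> : (\int[nu]_p h (rsq p) = \int[pushforward nu f]_x h x)%E.
  by rewrite ge0_integral_pushforward// preimage_setT.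
have mneg : measurable (neg : set (measurableTypeR R)) by exact: measurable_itv.
have nu0 : pushforward nu f neg = 0%E.
  have e : f @^-1` neg = disc 0.
    by apply/seteqP; split => p; rewrite /neg /disc /= in_itv.
  by refine (etrans _ disc0); rewrite /pushforward e.
have := @ge0_negligible_integral _ _ _ (pushforward nu f : {measure set (measurableTypeR R) -> \bar R}) setT neg h mneg
  measurableT mh (fun x _ => h0 x) nu0.
move=> ->.
have -> : setT `\` neg = pos.
  by rewrite setTD /neg /pos setCitvl.
rewrite (eq_measure_integral (mscale (NngNum (ltW kappa_gt0)) mu)); last first.
  by move=> B mB Bpos; exact: push_rsq.
by rewrite ge0_integral_mscale//; exact: measurable_funS mh.
Qed.

(** The Gaussian integral determines the area of the unit disc. *)
Let kappaE : kappa = pi.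
Proof.
have mh : measurable_fun setT (fun x : R => (expR (- x))%:E).
  by apply/measurable_EFinP; apply: measurableT_comp.
have := @radial_kappa _ mh (fun x => _); rewrite /pos.
have -> : (\int[mu]_(x in `]0%R, +oo[) (expR (- x))%:E = 1)%E.
  rewrite integral_itv_obnd_cbnd; last exact: measurable_funS mh.
  rewrite -(@integral_exponential_pdf R 1)// [LHS]integral_mkcond.
  apply: eq_integral => x _; rewrite /exponential_pdf !patchE.
  by case: ifP => // _; rewrite mul1r mulN1r.
rewrite mule1 => e; apply/EFin_inj; rewrite -e; last by move=> x; rewrite lee_fin expR_ge0.
rewrite (@fubini_tonelli1 _ _ _ _ _ mu mu (fun p => (expR (- rsq p))%:E)) /fubini_F//=; last first.
  apply/measurable_EFinP; apply: measurableT_comp => //; apply: measurableT_comp => //.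
  exact: measurable_rsq.
under eq_integral => x _.
  rewrite (_ : (fun y => _) = (fun y => (gauss_fun x)%:E * (gauss_fun y)%:E)%E); last first.
    by apply/funext => y; rewrite -EFinM /gauss_fun -expRD /rsq/= opprD.
  rewrite ge0_integralZl//; [|by apply/measurable_EFinP; exact: measurable_gauss_fun|
    by move=> y _; rewrite lee_fin gauss_fun_ge0|by rewrite lee_fin gauss_fun_ge0].
  rewrite integralT_gauss; over.
rewrite ge0_integralZr//; [|by apply/measurable_EFinP; exact: measurable_gauss_fun|
    by move=> y _; rewrite lee_fin gauss_fun_ge0].
by rewrite integralT_gauss -EFinM -expr2 sqr_sqrtr// pi_ge0.
Qed.

Lemma ge0_integral_rsq (h : R -> \bar R) : measurable_fun setT h ->
  (forall x, 0 <= h x)%E ->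
  (\int[nu]_p h (rsq p) = pi%:E * \int[mu]_(x in `]0%R, +oo[) h x)%E.
Proof. by move=> mh h0; rewrite radial_kappa// kappaE. Qed.

Lemma integrable_rsq (h : R -> R) : measurable_fun setT h ->
  mu.-integrable `]0, +oo[ (EFin \o h) ->
  nu.-integrable setT (EFin \o (fun p => h (rsq p))).
Proof.
move=> mh /integrableP[_ hoo]; apply/integrableP; split.
  by apply/measurable_EFinP; exact: (measurableT_comp mh measurable_rsq).
rewrite (ge0_integral_rsq (h := fun x => `|(h x)%:E|%E))//.
  by rewrite lte_mul_pinfty// lee_fin pi_ge0.
by apply: measurableT_comp => //; exact/measurable_EFinP.
Qed.

Lemma Rintegral_rsq (h : R -> R) : measurable_fun setT h ->
  mu.-integrable `]0, +oo[ (EFin \o h) ->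
  Rintegral nu setT (fun p => h (rsq p)) = pi * Rintegral mu `]0, +oo[ h.
Proof.
move=> mh hi.
have mEh : measurable_fun setT (EFin \o h) by exact/measurable_EFinP.
rewrite /Rintegral integralE.
rewrite (_ : (\int[nu]_x _ = pi%:E * \int[mu]_(x in `]0%R, +oo[) ((EFin \o h)^\+ x))%E); last first.
  rewrite -ge0_integral_rsq//; last exact: measurable_funepos.
  by apply: eq_integral => x _; rewrite !funeposE.
rewrite (_ : (\int[nu]_x ((fun x => (h (rsq x))%:E)^\- x) =
    pi%:E * \int[mu]_(x in `]0%R, +oo[) ((EFin \o h)^\- x))%E); last first.
  rewrite -ge0_integral_rsq//; last exact: measurable_funeneg.
  by apply: eq_integral => x _; rewrite !funenegE.
rewrite [in RHS]integralE.
have mpos : measurable (`]0%R, +oo[%classic : set (measurableTypeR R)).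
  exact: measurable_itv.
have h1 := integrable_pos_fin_num mpos hi; have h2 := integrable_neg_fin_num mpos hi.
by rewrite -muleBr ?fin_num_adde_defr// fineM// fin_numB h1 h2.
Qed.

End Radial.

(** * Powers of a quadratic denominator *)

Section Denominator.
Context (R : realType).
Implicit Types (alpha : 'I_2 -> R) (e : R) (c : R[i]) (g p v : G R) (i j k : 'I_2).

Definition quad alpha g : R := \sum_(j < 2) alpha j * normsq (zc j g).

Definition den c alpha e g : R[i] := c * (tc g)%:C + (quad alpha g + e)%:C.

Definition unit_im c := c = 'i%C \/ c = - 'i%C.

Lemma unit_im_sqr c : unit_im c -> c * c = -1.
Proof. by case=> ->; rewrite ?mulrNN -expr2 sqr_i. Qed.

Lemma Re_den c alpha e g : unit_im c -> Re (den c alpha e g) = quad alpha g + e.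
Proof. by case=> ->; rewrite /den ReD ReM /=; ring. Qed.

Lemma Im_den_sqr c alpha e g : unit_im c -> Im (den c alpha e g) ^+ 2 = tc g ^+ 2.
Proof. by case=> ->; rewrite /den ImD ImM /=; ring. Qed.

Lemma normsq_den c alpha e g : unit_im c ->
  normsq (den c alpha e g) = (quad alpha g + e) ^+ 2 + tc g ^+ 2.
Proof. by move=> hc; rewrite /normsq Re_den// Im_den_sqr. Qed.

Lemma quad_ge0 alpha g : (forall j, 0 <= alpha j) -> 0 <= quad alpha g.
Proof. by move=> a0; apply: sumr_ge0 => j _; rewrite mulr_ge0 ?normsq_ge0. Qed.

Lemma den_neq0 c alpha e g : unit_im c -> (forall j, 0 <= alpha j) -> 0 < e ->
  den c alpha e g != 0.
Proof.
move=> hc a0 e0; apply: contraTneq (ltr_wpDl (quad_ge0 g a0) e0) => d0.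
by rewrite -(Re_den _ _ _ hc) d0 ltxx.
Qed.

Lemma normsq_ze j g : (normsq (zc j g))%:C = ze 'i%C j g * ze (- 'i%C) j g.
Proof. by apply: complexP; rewrite /ze /normsq !(ReM,ImM,ReD,ImD,ReN,ImN)/=; ring. Qed.

Lemma den_ze c alpha e g : den c alpha e g = c * (tc g)%:C +
  ((alpha ord0)%:C * (ze 'i%C ord0 g * ze (- 'i%C) ord0 g) +
   (alpha ord_max)%:C * (ze 'i%C ord_max g * ze (- 'i%C) ord_max g)) + e%:C.
Proof.
rewrite -!normsq_ze /den /quad sum_I2; apply: complexP; rewrite !(ReM,ImM,ReD,ImD)/=; ring.
Qed.

Lemma smoothC_t : smoothC (fun g : G R => (tc g)%:C).
Proof.
move=> n; split; last exact: Cn_cst.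
by apply: Cn_linear; [move=> -[a t]; exact: cvg_snd|].
Qed.

Lemma smoothC_den c alpha e : smoothC (den c alpha e).
Proof.
rewrite (funext (den_ze c alpha e)).
have z i := smoothCM (smoothC_cst (alpha i)%:C) (smoothCM (@smoothC_ze R 'i%C i) (smoothC_ze (- 'i%C) i)).
exact: smoothCD (smoothCD (smoothCM (smoothC_cst c) smoothC_t) (smoothCD (z _) (z _))) (smoothC_cst e%:C).
Qed.

Definition dden c alpha p v : R[i] := c * (tc v)%:C +
  ((alpha ord0)%:C * (ze 'i%C ord0 p * ze (- 'i%C) ord0 v + ze 'i%C ord0 v * ze (- 'i%C) ord0 p) +
   (alpha ord_max)%:C *
     (ze 'i%C ord_max p * ze (- 'i%C) ord_max v + ze 'i%C ord_max v * ze (- 'i%C) ord_max p)).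

Lemma cderive_t p v : is_cderive p v (fun g : G R => (tc g)%:C) (tc v)%:C.
Proof.
split => /=; last exact: is_derive_cst.
by apply: (derive_linear p v).
Qed.

Lemma cderive_den c alpha e p v : is_cderive p v (den c alpha e) (dden c alpha p v).
Proof.
rewrite (funext (den_ze c alpha e)).
have z i := is_cderiveM (is_cderive_cst p v (alpha i)%:C)
  (is_cderiveM (@cderive_ze R p v 'i%C i) (cderive_ze p v (- 'i%C) i)).
have h := is_cderiveD (is_cderiveD (is_cderiveM (is_cderive_cst p v c) (cderive_t p v))
  (is_cderiveD (z ord0) (z ord_max))) (is_cderive_cst p v e%:C).
apply: (eq_ind _ (is_cderive p v _) h); rewrite /dden.
have alg (u t t' a b x x' y y' : R[i]) :
  u * t' + 0 * t + (a * x' + 0 * x + (b * y' + 0 * y)) + 0 = u * t' + (a * x' + b * y') by ring.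
exact: alg.
Qed.

Lemma ze_other eta i j : i != j -> ze eta i (e_x R j) = 0 /\ ze eta i (e_y R j) = 0.
Proof.
move=> ij; rewrite /ze /zc /e_x /e_y.
by case: (I2_cases i) ij => ->; case: (I2_cases j) => -> //= _;
  split; apply: complexP; rewrite !(ReD,ImD,ReM,ImM)/=; ring.
Qed.

Lemma tc_exy j : tc (e_x R j) = 0 /\ tc (e_y R j) = 0.
Proof. by []. Qed.

(** The derivative of |z_j|^2 along the constant-coefficient part of the field
    is z_j or its conjugate. *)
Lemma dden_eta c alpha p eta j : unit_im eta ->
  2^-1 * (dden c alpha p (e_x R j) + eta * dden c alpha p (e_y R j)) = (alpha j)%:C * ze eta j p.
Proof.
move=> he; have [tx ty] := tc_exy j.
have hx := fun q : R[i] => @ze_x R q j; have hy := fun q : R[i] => @ze_y R q j.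
have ii : 'i%C * 'i%C = -1 :> R[i] by rewrite -expr2 sqr_i.
rewrite /dden tx ty.
case: (I2_cases j) => ej; subst j.
- have [a1 a2] := @ze_other 'i%C ord_max ord0 isT; have [b1 b2] := @ze_other (- 'i%C) ord_max ord0 isT.
  rewrite !hx !hy a1 a2 b1 b2.
  case: he => ->; move: ii; move: (ze 'i%C _ p) (ze (- 'i%C) _ p) (ze 'i%C _ p) (ze (- 'i%C) _ p) => x y z w;
  move: ('i%C : R[i]) => I ii; by field: ii.
- have [a1 a2] := @ze_other 'i%C ord0 ord_max isT; have [b1 b2] := @ze_other (- 'i%C) ord0 ord_max isT.
  rewrite !hx !hy a1 a2 b1 b2.
  case: he => ->; move: ii; move: (ze 'i%C _ p) (ze (- 'i%C) _ p) (ze 'i%C _ p) (ze (- 'i%C) _ p) => x y z w;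
  move: ('i%C : R[i]) => I ii; by field: ii.
Qed.

Lemma dden_t c alpha p : dden c alpha p (e_t R) = c.
Proof. by rewrite /dden !ze_t /=; ring. Qed.

End Denominator.

Section QuadraticKernel.
Context (R : realType) (sigma : 'I_2 -> R).
Variables (c : R[i]) (alpha : 'I_2 -> R) (e : R).
Hypotheses (hc : unit_im c) (a0 : forall j, 0 <= alpha j) (e0 : 0 < e).
Implicit Types (p v g : G R) (f : G R -> R[i]).

Let b g := (den c alpha e g)^-1.

Lemma contCV f : contC f -> (forall g, f g != 0) -> contC (fun g => (f g)^-1).
Proof.
move=> [c1 c2] f0.
have n0 g := normsq_neq0 (f0 g).
have cn : continuous (fun g => (normsq (f g))^-1).
  move=> g; apply: cvgV => //.
  by apply: cvgD; apply: cvgM; try exact: c1; exact: c2.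
split.
  under eq_fun do rewrite ReV.
  by move=> g; apply: cvgM; [exact: c1|exact: cn].
under eq_fun do rewrite ImV.
by move=> g; apply: cvgN; apply: cvgM; [exact: c2|exact: cn].
Qed.

Let den0 g : den c alpha e g != 0. Proof. exact: den_neq0. Qed.

Lemma contC_inv_den : contC b.
Proof. by apply: contCV => //; apply: smoothC_cont; exact: smoothC_den. Qed.

Let db p v : is_cderive p v b (- dden c alpha p v * b p ^+ 2).
Proof. exact: is_cderiveV (cderive_den c alpha e p v). Qed.

Let db2 p v : is_cderive p v (fun g => b g ^+ 2) (- (2 * dden c alpha p v * b p ^+ 3)).
Proof.
apply: (eq_ind _ (is_cderive p v _) (is_cderiveM (db p v) (db p v))).
have alg (x d : R[i]) : x * (- d * x ^+ 2) + - d * x ^+ 2 * x = - (2 * d * x ^+ 3) by ring.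
exact: alg.
Qed.

Let db3 p v : is_cderive p v (fun g => b g ^+ 3) (- (3 * dden c alpha p v * b p ^+ 4)).
Proof.
apply: (eq_ind _ (is_cderive p v _) (is_cderiveM (db p v) (db2 p v))).
have alg (x d : R[i]) : x * (- (2 * d * x ^+ 3)) + - d * x ^+ 2 * x ^+ 2 = - (3 * d * x ^+ 4) by ring.
exact: alg.
Qed.

Let smooth_dden v : smoothC (fun p => dden c alpha p v).
Proof.
have z (eta : R[i]) i := @smoothC_ze R eta i.
have m i := smoothCM (smoothC_cst (alpha i)%:C) (smoothCD
  (smoothCM (z 'i%C i) (smoothC_cst (ze (- 'i%C) i v)))
  (smoothCM (smoothC_cst (ze 'i%C i v)) (z (- 'i%C) i))).
exact: smoothCD (smoothC_cst (c * (tc v)%:C)) (smoothCD (m _) (m _)).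
Qed.

Let contb n : contC (fun g => b g ^+ n).
Proof.
elim: n => [|n IH]; first exact: contC_cst.
by under eq_fun do rewrite exprS; exact: contCM contC_inv_den IH.
Qed.

(** The field with parameter eta maps the denominator to this multiple of
    [ze eta j]. *)
Definition vfield_den_coef (eta : R[i]) j : R[i] := (alpha j)%:C + eta * (sigma j)%:C * c.

Let vfield_b2 eta j f : unit_im eta -> testfun f ->
  Cintegral (@haar R) setT (fun g => b g ^+ 2 * vfield sigma eta j f g) =
  2 * vfield_den_coef eta j * Cintegral (@haar R) setT (fun g => (b g ^+ 3 * ze eta j g) * f g).
Proof.
move=> he hf; have [sf bf] := hf.
have cK v : contC (fun p => - (2 * dden c alpha p v * b p ^+ 3)).
  have h := contCM (smoothC_cont (smoothCM (smoothC_cst (- 2)) (smooth_dden v))) (contb 3).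
  apply: (eq_ind _ (@contC R) h); apply/funext => p; by rewrite !mulNr.
have ck : contC (fun g => b g ^+ 3 * ze eta j g).
  exact: contCM (contb 3) (smoothC_cont (smoothC_ze _ _)).
have h := locint_mul (contC_locint ck) (smoothC_cont sf) bf.
rewrite (vfield_parts sigma eta (contb 2) (cK _) (cK _) (cK _) (db2 ^~ _) (db2 ^~ _) (db2 ^~ _) hf).
transitivity (- Cintegral (@haar R) setT
    (fun g => - (2 * vfield_den_coef eta j) * (b g ^+ 3 * ze eta j g * f g))); last first.
  by rewrite CintegralZ// mulNr opprK.
congr (- _); apply: eq_Cintegral => g _.
have e1 := dden_eta c alpha g j he; have e2 := dden_t c alpha g.
rewrite e2 /vfield_den_coef.
have alg (H x y et z u t a s w : R[i]) : H * (x + et * y) = a * z ->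
    (H * (- (2 * x * u) + et * - (2 * y * u)) + et * s * z * - (2 * t * u)) * w =
    - (2 * (a + et * s * t)) * (u * z * w).
  move=> E; transitivity (- 2 * (H * (x + et * y) + et * s * z * t) * u * w); first by ring.
  by rewrite E; ring.
exact: (alg _ _ _ _ _ _ _ _ _ _ e1).
Qed.

Let vfield_b3ze eta j f : unit_im eta -> testfun f ->
  Cintegral (@haar R) setT (fun g => b g ^+ 3 * ze eta j g * vfield sigma (- eta) j f g) =
  Cintegral (@haar R) setT (fun g =>
    (3 * vfield_den_coef (- eta) j * (normsq (zc j g))%:C * b g ^+ 4 - b g ^+ 3) * f g).
Proof.
move=> he hf; have [sf bf] := hf.
have heN : unit_im (- eta) by case: he => ->; [right|left; rewrite opprK].
pose K v p : R[i] := b p ^+ 3 * ze eta j v + - (3 * dden c alpha p v * b p ^+ 4) * ze eta j p.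
have cz := smoothC_cont (smoothC_ze eta j).
have ck : contC (fun g => b g ^+ 3 * ze eta j g) by exact: contCM (contb 3) cz.
have cK v : contC (K v).
  apply: contCD; first exact: contCM (contb 3) (contC_cst _).
  apply: contCM => //.
  have h := contCM (smoothC_cont (smoothCM (smoothC_cst (- 3)) (smooth_dden v))) (contb 4).
  apply: (eq_ind _ (@contC R) h); apply/funext => p; by rewrite !mulNr.
have dK v p : is_cderive p v (fun g => b g ^+ 3 * ze eta j g) (K v p).
  exact: is_cderiveM (db3 p v) (cderive_ze p v eta j).
rewrite (vfield_parts sigma (- eta) ck (cK _) (cK _) (cK _) (dK _) (dK _) (dK _) hf).
have d1 : contC (fun g => 2^-1 * (K (e_x R j) g + - eta * K (e_y R j) g) +
     - eta * (sigma j)%:C * ze (- eta) j g * K (e_t R) g).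
  apply: contCD.
    apply: contCM; first exact: contC_cst.
    by apply: contCD => //; apply: contCM => //; exact: contC_cst.
  apply: contCM => //; apply: contCM; first exact: contC_cst.
  exact: smoothC_cont (smoothC_ze _ _).
have hi := locint_mul (contC_locint d1) (smoothC_cont sf) bf.
rewrite -CintegralN//; apply: eq_Cintegral => g _.
have e1 := dden_eta c alpha g j heN; have e2 := dden_t c alpha g.
have n1 : (normsq (zc j g))%:C = ze eta j g * ze (- eta) j g.
  rewrite normsq_ze; case: he => -> //; by rewrite opprK mulrC.
have ee := unit_im_sqr he.
rewrite /K e2 n1 /vfield_den_coef ze_x ze_y ze_t.
have alg (x y et z zb u v t a s w : R[i]) : et * et = -1 ->
    2^-1 * (x + - et * y) = a * zb ->
    - ((2^-1 * (u * 1 + - (3 * x * v) * z + - et * (u * et + - (3 * y * v) * z)) +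
     - et * s * zb * (u * 0 + - (3 * t * v) * z)) * w) =
    (3 * (a + - et * s * t) * (z * zb) * v - u) * w.
  move=> E1 E2; transitivity (- ((2^-1 * (1 - et * et) * u - 3 * (2^-1 * (x + - et * y)) * v * z
    + 3 * et * s * zb * t * v * z) * w)); first by ring.
  by rewrite E2 E1; field.
exact: (alg _ _ _ _ _ _ _ _ _ _ _ ee e1).
Qed.

(** The product of the coefficients for eta and - eta is alpha_j^2 - sigma_j^2,
    because eta and c are square roots of -1. *)
Let vfield_pair eta j f : unit_im eta -> testfun f ->
  Cintegral (@haar R) setT (fun g => b g ^+ 2 * vfield sigma eta j (vfield sigma (- eta) j f) g) =
  Cintegral (@haar R) setT (fun g =>
    (6 * (alpha j ^+ 2 - sigma j ^+ 2)%:C * (normsq (zc j g))%:C * b g ^+ 4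
     - 2 * vfield_den_coef eta j * b g ^+ 3) * f g).
Proof.
move=> he hf; rewrite vfield_b2//; last exact: testfun_vfield.
rewrite vfield_b3ze// -CintegralZ//; last first.
  have [sf bf] := hf; apply: locint_mul => //; last exact: smoothC_cont.
  apply: contC_locint; apply: contCD; last first.
    have h := contCM (contC_cst (-1)) (contb 3).
    by apply: (eq_ind _ (@contC R) h); apply/funext => p; rewrite mulN1r.
  apply: contCM => //; apply: smoothC_cont.
  have h := smoothCM (smoothC_cst (3 * vfield_den_coef (- eta) j))
    (smoothCM (smoothC_ze 'i%C j) (smoothC_ze (- 'i%C) j)).
  by apply: (eq_ind _ (@smoothC R) h); apply/funext => p; rewrite -normsq_ze.
apply: eq_Cintegral => g _; rewrite /vfield_den_coef.
have E : ((alpha j)%:C + eta * (sigma j)%:C * c) * ((alpha j)%:C + - eta * (sigma j)%:C * c) =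
  (alpha j ^+ 2 - sigma j ^+ 2)%:C.
  transitivity ((alpha j)%:C * (alpha j)%:C - (eta * eta) * (c * c) * ((sigma j)%:C * (sigma j)%:C)).
    by ring.
  rewrite (unit_im_sqr he) (unit_im_sqr hc).
  by apply: complexP; rewrite !(ReM,ReD,ReN,ImM,ImD,ImN) /=; ring.
rewrite -E.
have alg (x y n u v w : R[i]) : 2 * x * ((3 * y * n * v - u) * w) =
  (6 * (x * y) * n * v - 2 * x * u) * w by ring.
exact: alg.
Qed.

(** The value of Box_k on the inverse square of the denominator. *)
Definition Box_inv_den2 k g : R[i] :=
  2 * (vfield_den_coef (- 'i%C) k + vfield_den_coef 'i%C (other k)) * b g ^+ 3
  - 6 * (\sum_(j < 2) (alpha j ^+ 2 - sigma j ^+ 2) * normsq (zc j g))%:C * b g ^+ 4.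

Lemma contC_Box_inv_den2 k : contC (Box_inv_den2 k).
Proof.
have cs : contC (fun g => (\sum_(j < 2) (alpha j ^+ 2 - sigma j ^+ 2) * normsq (zc j g))%:C).
  have z j := smoothCM (smoothC_cst (alpha j ^+ 2 - sigma j ^+ 2)%:C)
    (smoothCM (@smoothC_ze R 'i%C j) (smoothC_ze (- 'i%C) j)).
  have := smoothC_cont (smoothCD (z ord0) (z ord_max)).
  congr (contC _); apply/funext => g.
  by rewrite -!normsq_ze sum_I2; apply: complexP; rewrite !(ReM,ReD,ImM,ImD)/=; ring.
have h := contCM (contCM (contC_cst (- 6)) cs) (contb 4).
have := contCD (contCM (contC_cst (2 * (vfield_den_coef (- 'i%C) k + vfield_den_coef 'i%C (other k)))) (contb 3)) h.
by congr (contC _); apply/funext => g; rewrite /Box_inv_den2 !mulNr.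
Qed.

(** The derivatives are moved from f to the kernel one at a time; the inverse
    powers of the denominator have continuous first derivatives. *)
Lemma Box_tr_inv_den2 k f : testfun f ->
  Cintegral (@haar R) setT (fun g => b g ^+ 2 * Box_tr sigma k f g) =
  Cintegral (@haar R) setT (fun g => Box_inv_den2 k g * f g).
Proof.
move=> hf; have [sf bf] := hf.
have im1 : unit_im ('i%C : R[i]) by left.
have im2 : unit_im (- 'i%C : R[i]) by right.
have h1 := vfield_pair k im2 hf; have h2 := vfield_pair (other k) im1 hf.
rewrite opprK in h1.
have i1 : Cintegrable (@haar R) setT (fun g => b g ^+ 2 *
    vfield sigma (- 'i%C) k (vfield sigma 'i%C k f) g).
  have [s1 b1] := testfun_vfield sigma (- 'i%C) k (testfun_vfield sigma 'i%C k hf).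
  exact: locint_mul (contC_locint (contb 2)) (smoothC_cont s1) b1.
have i2 : Cintegrable (@haar R) setT (fun g => b g ^+ 2 *
    vfield sigma 'i%C (other k) (vfield sigma (- 'i%C) (other k) f) g).
  have [s1 b1] := testfun_vfield sigma 'i%C (other k) (testfun_vfield sigma (- 'i%C) (other k) hf).
  exact: locint_mul (contC_locint (contb 2)) (smoothC_cont s1) b1.
have cn (a : R) j : contC (fun g => 6 * a%:C * (normsq (zc j g))%:C * b g ^+ 4).
  apply: contCM => //; apply: smoothC_cont.
  have h := smoothCM (smoothC_cst (6 * a%:C))
    (smoothCM (@smoothC_ze R 'i%C j) (smoothC_ze (- 'i%C) j)).
  by apply: (eq_ind _ (@smoothC R) h); apply/funext => p; rewrite -normsq_ze.
have ci (a : R) (u : R[i]) j : Cintegrable (@haar R) setT (fun g =>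
    (6 * a%:C * (normsq (zc j g))%:C * b g ^+ 4 - 2 * u * b g ^+ 3) * f g).
  apply: locint_mul => //; last exact: smoothC_cont.
  apply: contC_locint; apply: contCD => //.
  have h := contCM (contC_cst (- (2 * u))) (contb 3).
  by apply: (eq_ind _ (@contC R) h); apply/funext => p; rewrite mulNr.
transitivity (- Cintegral (@haar R) setT (fun g => b g ^+ 2 *
    vfield sigma (- 'i%C) k (vfield sigma 'i%C k f) g) -
  Cintegral (@haar R) setT (fun g => b g ^+ 2 *
    vfield sigma 'i%C (other k) (vfield sigma (- 'i%C) (other k) f) g)).
  have iN := CintegrableN (mu := @haar R) measurableT i1.
  refine (etrans _ (etrans (CintegralB (mu := @haar R) measurableT iN i2)
    (congr1 (fun x => x - _) (CintegralN (mu := @haar R) measurableT i1)))).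
  apply: eq_Cintegral => g _; rewrite /Box_tr.
  have alg (x y z : R[i]) : x * (- y - z) = - (x * y) - x * z by ring.
  exact: alg.
refine (etrans (congr2 (fun x y => - x - y) h1 h2) _).
have c1 := ci (alpha k ^+ 2 - sigma k ^+ 2) (vfield_den_coef (- 'i%C) k) k.
have c2 := ci (alpha (other k) ^+ 2 - sigma (other k) ^+ 2) (vfield_den_coef 'i%C (other k)) (other k).
have iN := CintegrableN (mu := @haar R) measurableT c1.
refine (etrans (esym (etrans (CintegralB (mu := @haar R) measurableT iN c2)
  (congr1 (fun x => x - _) (CintegralN (mu := @haar R) measurableT c1)))) _).
apply: eq_Cintegral => g _; rewrite /Box_inv_den2 (sum_I2_other _ k).
have alg (x1 n1 e1 x2 n2 e2 u v w s : R[i]) : s = x1 * n1 + x2 * n2 ->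
  - ((6 * x1 * n1 * u - 2 * e1 * v) * w) - (6 * x2 * n2 * u - 2 * e2 * v) * w =
  (2 * (e1 + e2) * v - 6 * s * u) * w by move=> ->; ring.
apply: alg.
by apply: complexP; rewrite !(ReM,ReD,ImM,ImD) /=; ring.
Qed.
End QuadraticKernel.

(** * Dependence on the parameter r *)

Section CFTC.
Context (R : realType).
Implicit Types (f F : R -> R[i]) (x a b : R).

Lemma is_derive_inv (f : R -> R) x d : f x != 0 -> is_derive x 1 f d ->
  is_derive x 1 (fun y => (f y)^-1) (- d * (f x)^-1 ^+ 2).
Proof.
move=> fx0 [f1 f2]; apply: DeriveDef; first exact: derivableV.
by rewrite deriveV// f2 -[_ *: _]/(_ * _) exprVn mulNr mulNr mulrC.
Qed.

Lemma is_derive_mul (f g : R -> R) x d d' : is_derive x 1 f d -> is_derive x 1 g d' ->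
  is_derive x 1 (fun y => f y * g y) (f x * d' + g x * d).
Proof. by move=> h1 h2; exact: is_deriveM. Qed.

Definition cder f x := exists d, is_cderive x 1 f d.

Lemma cder_cst (k : R[i]) x : cder (fun=> k) x.
Proof. by exists 0; exact: is_cderive_cst. Qed.

Lemma cderD f g x : cder f x -> cder g x -> cder (fun y => f y + g y) x.
Proof. by move=> [d h] [d' h']; eexists; exact: is_cderiveD h h'. Qed.

Lemma cderM f g x : cder f x -> cder g x -> cder (fun y => f y * g y) x.
Proof. by move=> [d h] [d' h']; eexists; exact: is_cderiveM h h'. Qed.

Lemma cderX f n x : cder f x -> cder (fun y => f y ^+ n) x.
Proof.
move=> h; elim: n => [|n IH]; first exact: cder_cst.
by under eq_fun do rewrite exprS; exact: cderM.
Qed.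

Lemma cderV f x : f x != 0 -> cder f x -> cder (fun y => (f y)^-1) x.
Proof. by move=> f0 [d h]; eexists; exact: is_cderiveV h. Qed.

Lemma is_cderive_real (f : R -> R) x d : is_derive x 1 f d ->
  is_cderive x 1 (fun y => (f y)%:C) d%:C.
Proof. by move=> h; split => //=; exact: is_derive_cst. Qed.

Lemma cder_real (f : R -> R) x d : is_derive x 1 f d -> cder (fun y => (f y)%:C) x.
Proof. by move=> h; exists d%:C; exact: is_cderive_real. Qed.

Let cont_of (f : R -> R) x d : is_derive x 1 f d -> {for x, continuous f}.
Proof.
by move=> [h _]; apply: differentiable_continuous; apply/derivable1_diffP.
Qed.

Let ftc (F f df : R -> R) a b : a < b ->
  (forall x, a <= x <= b -> is_derive x 1 F (f x)) ->
  (forall x, a <= x <= b -> is_derive x 1 f (df x)) ->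
  Rintegral lebesgue_measure `[a, b] f = F b - F a.
Proof.
move=> ab dF df0; rewrite /Rintegral (@continuous_FTC2 _ f F)//.
- apply: continuous_in_subspaceT => x; rewrite inE /= in_itv /= => h.
  exact: cont_of (df0 _ h).
- split.
  + move=> x; rewrite in_itv /= => /andP[/ltW h1 /ltW h2].
    by case: (dF x) => //; rewrite h1.
  + by apply: cvg_at_right_filter; apply: cont_of (dF a _); rewrite lexx ltW.
  + by apply: cvg_at_left_filter; apply: cont_of (dF b _); rewrite lexx ltW.
- move=> x; rewrite in_itv /= derive1E => /andP[/ltW h1 /ltW h2].
  by case: (dF x) => //; rewrite h1.
Qed.

Lemma Cftc F f a b : a < b ->
  (forall x, a <= x <= b -> is_cderive x 1 F (f x)) ->
  (forall x, a <= x <= b -> cder f x) ->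
  Cintegral lebesgue_measure `[a, b] f = F b - F a.
Proof.
move=> ab dF df.
pose d x := xget 0 [set d | is_cderive x 1 f d].
have hd x : a <= x <= b -> is_cderive x 1 f (d x) by move=> /df; exact: xgetPex.
apply: complexP; rewrite ?ReD ?ImD ?ReN ?ImN /=.
  apply: (@ftc (fun x => Re (F x)) _ (fun x => Re (d x))) => // x h.
    by case: (dF x h).
  by case: (hd x h).
apply: (@ftc (fun x => Im (F x)) _ (fun x => Im (d x))) => // x h.
  by case: (dF x h).
by case: (hd x h).
Qed.

End CFTC.

Section RadialParameter.
Context (R : realType) (sigma : 'I_2 -> R).
Hypothesis sigma_gt0 : forall j, 0 < sigma j.
Implicit Types (r : R) (i j k m : 'I_2).

Definition quad_coef r j : R := s_ sigma j r * sigma j.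

Definition kernel_weight m r : R :=
  r `^ (sigma m - 1) / ((1 - r `^ sigma ord0) * (1 - r `^ sigma ord_max)).

Definition boundary_weight m r : R :=
  r `^ sigma m / ((1 - r `^ sigma ord0) * (1 - r `^ sigma ord_max)).

Lemma powR_lt1 r j : 0 <= r < 1 -> r `^ sigma j < 1.
Proof.
move=> /andP[r0 r1]; have -> : 1 = 1 `^ sigma j :> R by rewrite powR1.
by apply: gt0_ltr_powR; rewrite ?nnegrE.
Qed.

Lemma onem_neq0 r j : 0 < r < 1 -> 1 - r `^ sigma j != 0.
Proof. by move=> /andP[/ltW r0 r1]; rewrite subr_eq0 eq_sym lt_eqF// powR_lt1// r0. Qed.

Lemma quad_coef_ge0 r j : 0 <= r < 1 -> 0 <= quad_coef r j.
Proof.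
move=> r01; rewrite mulr_ge0 ?(ltW (sigma_gt0 j))// /s_ divr_ge0//.
  by rewrite addr_ge0 ?powR_ge0.
by rewrite subr_ge0 ltW ?powR_lt1.
Qed.

Let d_pow (a r : R) : 0 < r -> is_derive r 1 (fun x => x `^ a) (a * (r `^ a / r)).
Proof.
move=> r0; have := is_derive1_powR a r0.
by rewrite powRB ?powRr1 ?(ltW r0)// (gt_eqF r0) implybT.
Qed.

Let d_onem r j : 0 < r ->
  is_derive r 1 (fun x => 1 - x `^ sigma j) (- (sigma j * (r `^ sigma j / r))).
Proof.
move=> r0; have h := is_deriveB (is_derive_cst (1 : R) r 1) (d_pow (sigma j) r0).
by apply: (is_derive_eq h); rewrite sub0r.
Qed.

Lemma kernel_weightE m r : 0 < r -> kernel_weight m r = boundary_weight m r / r.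
Proof.
move=> r0; rewrite /kernel_weight /boundary_weight powRB ?powRr1 ?(ltW r0) ?(gt_eqF r0) ?implybT//.
by rewrite mulrAC.
Qed.

(** The coefficient alpha_j solves a Riccati equation in the variable log r. *)
Lemma is_derive_quad_coef r j : 0 < r < 1 -> is_derive r 1 (fun x => quad_coef x j) ((quad_coef r j ^+ 2 - sigma j ^+ 2) / (2 * r)).
Proof.
move=> r01; have n0 := onem_neq0 j r01; have /andP[r0 _] := r01.
have h1 : is_derive r 1 (fun x => 1 + x `^ sigma j) (0 + sigma j * (r `^ sigma j / r)).
  exact: is_deriveD (is_derive_cst (1 : R) r 1) (d_pow (sigma j) r0).
have hv := @is_derive_inv R (fun x => 1 - x `^ sigma j) r _ n0 (d_onem j r0).
have h2 := is_derive_mul (is_derive_mul h1 hv) (is_derive_cst (sigma j) r 1).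
apply: (is_derive_eq h2); rewrite /quad_coef /s_ /=.
move: (r `^ sigma j) n0 => a n0; field.
by rewrite n0 gt_eqF.
Qed.

Lemma is_derive_boundary_weight r m : 0 < r < 1 ->
  is_derive r 1 (boundary_weight m) (kernel_weight m r * (sigma m + \sum_(j < 2) (quad_coef r j - sigma j) / 2)).
Proof.
move=> r01; have n0 := onem_neq0 ord0 r01; have n1 := onem_neq0 ord_max r01.
have /andP[r0 _] := r01.
have hv := @is_derive_inv R (fun x => (1 - x `^ sigma ord0) * (1 - x `^ sigma ord_max)) r _
  (mulf_neq0 n0 n1) (is_derive_mul (d_onem ord0 r0) (d_onem ord_max r0)).
have h := is_derive_mul (d_pow (sigma m) r0) hv.
apply: (is_derive_eq h); rewrite kernel_weightE// /boundary_weight sum_I2 /quad_coef /s_.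
move: (r `^ sigma ord0) (r `^ sigma ord_max) (r `^ sigma m) n0 n1 => a b d n0 n1; field.
by rewrite n0 n1 gt_eqF.
Qed.

Lemma is_derive_kernel_weight_ex r m : 0 < r < 1 -> exists d, is_derive r 1 (kernel_weight m) d.
Proof.
move=> r01; have n0 := onem_neq0 ord0 r01; have n1 := onem_neq0 ord_max r01.
have /andP[r0 _] := r01; eexists.
have hv := @is_derive_inv R (fun x => (1 - x `^ sigma ord0) * (1 - x `^ sigma ord_max)) r _
  (mulf_neq0 n0 n1) (is_derive_mul (d_onem ord0 r0) (d_onem ord_max r0)).
exact: is_derive_mul (d_pow (sigma m - 1) r0) hv.
Qed.

Variables (c : R[i]) (e : R) (hc : unit_im c) (e0 : 0 < e).

Let B g r := den c (quad_coef r) e g.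

Let d_den g r : 0 < r < 1 ->
  is_cderive r 1 (B g)
    (\sum_(j < 2) (quad_coef r j ^+ 2 - sigma j ^+ 2) * normsq (zc j g) / (2 * r))%:C.
Proof.
move=> r01.
have a j := is_derive_mul (is_derive_quad_coef j r01) (is_derive_cst (normsq (zc j g)) r 1).
have h := is_cderive_real (is_deriveD (is_deriveD (a ord0) (a ord_max)) (is_derive_cst e r 1)).
have h2 := is_cderiveD (is_cderive_cst r 1 (c * (tc g)%:C)) h.
have -> : B g = fun x => c * (tc g)%:C + (quad_coef x ord0 * normsq (zc ord0 g) + quad_coef x ord_max * normsq (zc ord_max g) + e)%:C.
  by apply/funext => x; rewrite /B /den /quad sum_I2.
apply: (eq_ind _ (is_cderive r 1 _) h2); rewrite add0r; congr (_%:C).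
rewrite sum_I2.
have alg (x y p q u v i : R) : x * 0 + p * (u * i) + (y * 0 + q * (v * i)) + 0 =
  u * p * i + v * q * i by ring.
exact: alg.
Qed.

Let den0 g r : 0 < r < 1 -> B g r != 0.
Proof. by move=> /andP[/ltW r0 r1]; apply: den_neq0 => // j; apply: quad_coef_ge0; rewrite r0. Qed.

(** The two cases in which the exponent of the weight fits the sign of t. *)
Definition admissible k m := (c = 'i%C /\ m = k) \/ (c = - 'i%C /\ m = other k).

(** The terms in B^-4 match by the Riccati equation for alpha_j; those in B^-3
    match exactly when the exponent of r is the admissible one. *)
Lemma is_cderive_boundary k m g r : admissible k m -> 0 < r < 1 ->
  is_cderive r 1 (fun x => 4 * (boundary_weight m x)%:C * (B g x)^-1 ^+ 3)
    ((kernel_weight m r)%:C * Box_inv_den2 sigma c (quad_coef r) e k g).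
Proof.
move=> adm r01; have hP := is_cderive_real (is_derive_boundary_weight m r01).
have hB := is_cderiveV (den0 g r01) (d_den g r01).
have hB3 := is_cderiveM hB (is_cderiveM hB hB).
have h := is_cderiveM (is_cderiveM (is_cderive_cst r 1 4) hP) hB3.
apply: (eq_ind _ (is_cderive r 1 _) h); rewrite /Box_inv_den2 /= -/(B g r).
have [r0 _] := andP r01.
have Pr : (boundary_weight m r)%:C = r%:C * (kernel_weight m r)%:C.
  by rewrite kernel_weightE//; apply: complexP; rewrite !(ReM,ImM)/=; field; rewrite gt_eqF.
have rn : r%:C != 0 by rewrite -[0]/(0%:C) (inj_eq (@complexI R)) gt_eqF.
pose S : R := \sum_(j < 2) (quad_coef r j ^+ 2 - sigma j ^+ 2) * normsq (zc j g).
have S1 : (\sum_(j < 2) (quad_coef r j ^+ 2 - sigma j ^+ 2) * normsq (zc j g) / (2 * r))%:C = S%:C / (2 * r%:C).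
  by rewrite -mulr_suml -/S rmorphM fmorphV rmorphM rmorph_nat.
have S2 : 2 * (kernel_weight m r * (sigma m + \sum_(j < 2) (quad_coef r j - sigma j) / 2))%:C =
   (kernel_weight m r)%:C * (vfield_den_coef sigma c (quad_coef r) (- 'i%C) k + vfield_den_coef sigma c (quad_coef r) 'i%C (other k)).
  rewrite /vfield_den_coef (sum_I2_other _ k).
  case: adm => -[-> ->]; apply: complexP; rewrite !(ReM,ImM,ReD,ImD,ReN,ImN)/=; by field.
rewrite Pr S1 -/S.
move: S2; set E := vfield_den_coef _ _ _ _ _ + _; move: E (B g r)^-1 => E b.
move: (kernel_weight m r * _)%:C => Q EQ.
have -> : (kernel_weight m r)%:C * (2 * E * b ^+ 3 - 6 * S%:C * b ^+ 4) =
  2 * ((kernel_weight m r)%:C * E) * b ^+ 3 - 6 * (kernel_weight m r)%:C * S%:C * b ^+ 4 by ring.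
by rewrite -EQ; field; rewrite rn.
Qed.

Lemma cder_Box_inv_den2 k m g r : 0 < r < 1 ->
  cder (fun x => (kernel_weight m x)%:C * Box_inv_den2 sigma c (quad_coef x) e k g) r.
Proof.
move=> r01; have [d hp] := is_derive_kernel_weight_ex m r01.
apply: cderM; first exact: cder_real hp.
have cb : cder (fun x => (B g x)^-1) r.
  by apply: cderV; [exact: den0|eexists; exact: d_den].
have ca j : cder (fun x => (quad_coef x j)%:C) r by apply: cder_real; exact: is_derive_quad_coef.
have ce eta j : cder (fun x => vfield_den_coef sigma c (quad_coef x) eta j) r.
  by apply: cderD => //; exact: cder_cst.
apply: cderD.
  apply: cderM; last exact: cderX.
  by apply: cderM; [exact: cder_cst|exact: cderD].
have q j : cder (fun x => ((quad_coef x j ^+ 2 - sigma j ^+ 2) * normsq (zc j g))%:C) r.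
  have h := is_derive_mul (is_deriveB (is_derive_mul (is_derive_quad_coef j r01) (is_derive_quad_coef j r01))
    (is_derive_cst (sigma j ^+ 2) r 1)) (is_derive_cst (normsq (zc j g)) r 1).
  exact: cder_real h.
have qs : cder (fun x => (\sum_(j < 2) (quad_coef x j ^+ 2 - sigma j ^+ 2) * normsq (zc j g))%:C) r.
  have := cderD (q ord0) (q ord_max); congr (cder _ _); apply/funext => x.
  by rewrite sum_I2 rmorphD.
have := cderM (cder_cst (- 6) r) (cderM qs (cderX 4 cb)).
by congr (cder _ _); apply/funext => x; rewrite !mulNr mulrA.
Qed.

Lemma ftc_boundary k m g (w : R[i]) (a b : R) : admissible k m -> 0 < a -> a < b -> b < 1 ->
  Cintegral lebesgue_measure `[a, b] (fun r => w * ((kernel_weight m r)%:C * Box_inv_den2 sigma c (quad_coef r) e k g)) =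
  w * (4 * (boundary_weight m b)%:C * (den c (quad_coef b) e g)^-1 ^+ 3)
  - w * (4 * (boundary_weight m a)%:C * (den c (quad_coef a) e g)^-1 ^+ 3).
Proof.
move=> adm a0 ab b1.
have sub x : a <= x <= b -> 0 < x < 1.
  by move=> /andP[h1 h2]; rewrite (lt_le_trans a0 h1) (le_lt_trans h2 b1).
apply: (Cftc (F := fun x => w * (4 * (boundary_weight m x)%:C * (den c (quad_coef x) e g)^-1 ^+ 3)) ab) => x /sub h.
  have := is_cderiveM (is_cderive_cst x 1 w) (is_cderive_boundary g adm h).
  by rewrite mul0r addr0.
by apply: cderM; [exact: cder_cst|exact: cder_Box_inv_den2].
Qed.

End RadialParameter.

(** * Domination of the kernel *)

Section AlmostEverywhere.
Context d1 d2 (T1 : measurableType d1) (T2 : measurableType d2) (R : realType).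
Variable m1 : {sigma_finite_measure set T1 -> \bar R}.
Variable m2 : {sigma_finite_measure set T2 -> \bar R}.

Lemma ae_fst (P : T1 -> Prop) : {ae m1, forall x, P x} ->
  {ae (m1 \x m2)%E, forall p, P p.1}.
Proof.
move=> [A [mA A0 PA]]; exists (A `*` setT); split; first exact: measurableX.
  rewrite product_measure1E//; refine (etrans (congr1 (fun z => z * _)%E A0) _).
  by rewrite mul0e.
by move=> p /= h; split => //; exact: PA.
Qed.

Lemma ae_snd (P : T2 -> Prop) : {ae m2, forall x, P x} ->
  {ae (m1 \x m2)%E, forall p, P p.2}.
Proof.
move=> [A [mA A0 PA]]; exists (setT `*` A); split; first exact: measurableX.
  rewrite product_measure1E//; refine (etrans (congr1 (fun z => _ * z)%E A0) _).
  by rewrite mule0.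
by move=> p /= h; split => //; exact: PA.
Qed.

End AlmostEverywhere.

Section AeDomination.
Context d (T : measurableType d) (R : realType) (mu : {measure set T -> \bar R}).

Lemma ae_and (P Q : T -> Prop) : {ae mu, forall x, P x} -> {ae mu, forall x, Q x} ->
  {ae mu, forall x, P x /\ Q x}.
Proof. by move=> h1 h2; apply: filterS2 h1 h2. Qed.

Lemma ae_imp (P Q : T -> Prop) : (forall x, P x -> Q x) -> {ae mu, forall x, P x} ->
  {ae mu, forall x, Q x}.
Proof. by move=> PQ; apply: filterS. Qed.

Lemma le_Cintegrable_ae (f : T -> R[i]) (g : T -> R) (P : T -> Prop) : Cmeas setT f ->
  mu.-integrable setT (EFin \o g) -> {ae mu, forall x, P x} ->
  (forall x, P x -> modC (f x) <= g x) -> Cintegrable mu setT f.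
Proof.
move=> mf ig [A [mA A0 PA]] fg.
have mCA : measurable (setT `\` A) by exact: measurableD.
have h : Cintegrable mu (setT `\` A) f.
  apply: (@le_Cintegrable _ _ _ mu _ mCA f g).
  - by case: mf => m1 m2; split; [exact: measurable_funS m1|exact: measurable_funS m2].
  - exact: integrableS ig.
  - by move=> x [_ Ax]; apply: fg; apply: contrapT => /PA.
case: mf h => m1 m2 [h1 h2]; split.
  by apply/(negligible_integrable mA measurableT _ A0) => //; exact/measurable_EFinP.
by apply/(negligible_integrable mA measurableT _ A0) => //; exact/measurable_EFinP.
Qed.

End AeDomination.

Section Bounds.
Context (R : realType).
Implicit Types (x y t s w Q : R).

Let lnE x : 0 < x -> {a | x = expR a}.
Proof. by move=> x0; exists (ln x); rewrite lnK. Qed.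

(** Weighing the two lower bounds of Q with the exponents 3/4 and 1/4 makes each
    factor integrable near its zero. In logarithmic variables the claim is
    linear. *)
Lemma geometric_bound s w Q r1 k x1 x2 x3 x4 t :
  0 < s -> 0 < w -> 0 < r1 -> 0 < k -> 0 < x1 -> 0 < x2 -> 0 < x3 -> 0 < x4 -> 0 < t ->
  s / w * (x1 * x2 * (x3 * x4)) <= Q -> t ^+ 2 <= Q -> k * r1 ^+ 2 <= w ->
  s / (w * Q) <= s `^ 4^-1 / k `^ 4^-1 * (x1 `^ (4^-1 - 1) * x2 `^ (4^-1 - 1) *
    (x3 `^ (4^-1 - 1) * x4 `^ (4^-1 - 1)) * t `^ (2^-1 - 1) * r1 `^ (2^-1 - 1)).
Proof.
move=> s0 w0 r0 k0 x10 x20 x30 x40 t0 h1 h2 h3.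
have Q0 : 0 < Q by apply: lt_le_trans h2; rewrite exprn_gt0.
move: s0 w0 r0 k0 x10 x20 x30 x40 t0 Q0 h1 h2 h3.
(* Every factor is positive, so each is an exponential. *)
move=> /lnE[? ->] /lnE[? ->] /lnE[? ->] /lnE[? ->] /lnE[? ->] /lnE[? ->] /lnE[? ->] /lnE[? ->] /lnE[? ->] /lnE[? ->].
rewrite !expr2 -!expRM -!expRN -!expRD -!expRN -!expRD !ler_expR.
lra.
Qed.

(** Bernoulli's inequality for r^sg, raised to a power n with n sg >= 1. *)
Lemma onem_powR_ge (sg : R) : 0 < sg -> exists2 k : R, 0 < k &
  forall r, 0 < r < 1 -> k * (1 - r) <= 1 - r `^ sg.
Proof.
move=> sg0; have /archi_boundP : 0 <= sg^-1 by rewrite invr_ge0 ltW.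
set n := Num.Def.archi_bound _ => hn.
have n0 : 0 < n%:R :> R by apply: lt_trans hn; rewrite invr_gt0.
exists n%:R^-1; first by rewrite invr_gt0.
move=> r /andP[r0 r1]; rewrite mulrC ler_pdivrMr//.
set a := r `^ sg.
have a0 : 0 <= a by exact: powR_ge0.
have a1 : a <= 1.
  by rewrite /a -(powRr0 r) ger_powR ?r0 ?(ltW r1) ?(ltW sg0).
have bern : 1 - (1 - a) * n%:R <= a ^+ n.
  elim: n {hn n0} => [|n IH]; first by rewrite mulr0 expr0 subr0.
  rewrite exprS -natr1; apply: (le_trans _ (ler_wpM2l a0 IH)).
  have : 0 <= n%:R * (1 - a) ^+ 2 by rewrite mulr_ge0 ?sqr_ge0.
  by move: (n%:R) a {IH a0 a1} => N b; nra.
suff : a ^+ n <= r by lra.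
rewrite /a -powR_mulrn ?powR_ge0// -powRrM.
rewrite -[leRHS]powRr1 ?(ltW r0)// ger_powR ?r0 ?(ltW r1)//.
by rewrite mulrC -ler_pdivrMr// div1r ltW.
Qed.

End Bounds.

Section Domination.
Context (R : realType) (sigma : 'I_2 -> R).
Hypothesis sigma_gt0 : forall j, 0 < sigma j.
Implicit Types (r e M : R) (c : R[i]) (g : G R) (m : 'I_2).

Definition coords_neq0 g : Prop :=
  [/\ g.1.1.1 != 0, g.1.1.2 != 0, g.1.2.1 != 0, g.1.2.2 != 0 & g.2 != 0].

(** The dominating function takes the value 0 where a coordinate vanishes, so
    this null set has to be left out. *)
Lemma ae_coords : {ae @haar R, forall g, coords_neq0 g}.
Proof.
have h0 : {ae @lebesgue_measure R, forall x, x != 0}.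
  exists [set 0]; split => //; first exact: lebesgue_measure_set1.
  by move=> x /= /negP; rewrite negbK => /eqP.
have hf : {ae @lebesgueC R, forall p, p.1 != 0} := ae_fst (@lebesgue_measure R) h0.
have hs : {ae @lebesgueC R, forall p, p.2 != 0} := ae_snd (@lebesgue_measure R) h0.
have up (P : R * R -> Prop) : {ae @lebesgueC R, forall p, P p} ->
    {ae @haar R, forall g, P g.1.1} /\ {ae @haar R, forall g, P g.1.2}.
  move=> hP.
  have h1 : {ae @lebesgueC2 R, forall q, P q.1} := ae_fst (@lebesgueC R) hP.
  have h2 : {ae @lebesgueC2 R, forall q, P q.2} := ae_snd (@lebesgueC R) hP.
  by split; [exact: (ae_fst (@lebesgue_measure R) h1)|exact: (ae_fst (@lebesgue_measure R) h2)].
have [h1 h3] := up _ hf; have [h2 h4] := up _ hs.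
have h5 : {ae @haar R, forall g, g.2 != 0} := ae_snd (@lebesgueC2 R) h0.
have h := ae_and h1 (ae_and h2 (ae_and h3 (ae_and h4 h5))).
apply: ae_imp h => g [g1 [g2 [g3 [g4 g5]]]]; by split.
Qed.

Let w r : R := (1 - r `^ sigma ord0) * (1 - r `^ sigma ord_max).

Let w_gt0 r : 0 < r < 1 -> 0 < w r.
Proof.
move=> /andP[/ltW r0 r1].
by rewrite mulr_gt0// subr_gt0; apply: powR_lt1 => //; rewrite r0.
Qed.

Let ss := sigma ord0 * sigma ord_max.
Let ss_gt0 : 0 < ss. Proof. exact: mulr_gt0. Qed.

Let quad2 r g : 0 < r < 1 ->
  ss / w r * (4 * (normsq (zc ord0 g) * normsq (zc ord_max g))) <= quad (quad_coef sigma r) g ^+ 2.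
Proof.
move=> r01; have n0 := onem_neq0 sigma_gt0 ord0 r01; have n1 := onem_neq0 sigma_gt0 ord_max r01.
have [/ltW r0 r1] := andP r01.
have a1 j : 0 <= 1 - r `^ sigma j.
  by rewrite subr_ge0 ltW// powR_lt1// r0.
have ge j : sigma j / (1 - r `^ sigma j) <= quad_coef sigma r j.
  rewrite /quad_coef /s_ [leRHS]mulrAC ler_wpM2r ?invr_ge0//.
  by rewrite ler_peMl ?(ltW (sigma_gt0 j))// lerDl powR_ge0.
have p j : 0 <= sigma j / (1 - r `^ sigma j) by rewrite divr_ge0 ?(ltW (sigma_gt0 j)).
have -> : ss / w r = (sigma ord0 / (1 - r `^ sigma ord0)) * (sigma ord_max / (1 - r `^ sigma ord_max)).
  by rewrite /ss /w; field; rewrite n0 n1.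
rewrite /quad sum_I2.
move: (ge ord0) (ge ord_max) (p ord0) (p ord_max).
move: (sigma ord0 / _) (sigma ord_max / _) (quad_coef sigma r ord0) (quad_coef sigma r ord_max).
move=> p0 p1 q0 q1 h0 h1 P0 P1.
have u0 := normsq_ge0 (zc ord0 g); have u1 := normsq_ge0 (zc ord_max g).
move: (normsq (zc ord0 g)) (normsq (zc ord_max g)) u0 u1 => u0 u1 U0 U1.
have A : p0 * p1 <= q0 * q1 by apply: ler_pM.
apply: (@le_trans _ _ (4 * (q0 * u0) * (q1 * u1))).
  have -> : 4 * (q0 * u0) * (q1 * u1) = q0 * q1 * (4 * (u0 * u1)) by ring.
  by apply: ler_wpM2r => //; do !apply: mulr_ge0.
have := sqr_ge0 (q0 * u0 - q1 * u1); nra.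
Qed.

Definition reg_factor c m e (p : G R * R) : R[i] :=
  (den c (quad_coef sigma p.2) e p.1)^-1 ^+ 2 * (kernel_weight sigma m p.2)%:C.

Let modK c m e g r : unit_im c -> 0 < r < 1 ->
  modC (reg_factor c m e (g, r)) = kernel_weight sigma m r / normsq (den c (quad_coef sigma r) e g).
Proof.
move=> hc r01; have w0 := w_gt0 r01.
rewrite /reg_factor /= modCM modCX modCV modCR ger0_norm; last first.
  by rewrite divr_ge0 ?powR_ge0// ltW.
by rewrite modCE exprVn sqr_sqrtr ?normsq_ge0// mulrC.
Qed.

Let normsq_ge c e g r : unit_im c -> 0 <= e -> 0 < r < 1 ->
  quad (quad_coef sigma r) g ^+ 2 <= normsq (den c (quad_coef sigma r) e g) /\
  tc g ^+ 2 <= normsq (den c (quad_coef sigma r) e g).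
Proof.
move=> hc e0 /andP[/ltW r0 r1]; rewrite normsq_den//.
have q0 : 0 <= quad (quad_coef sigma r) g by apply: quad_ge0 => j; apply: quad_coef_ge0; rewrite ?r0.
split; last by rewrite lerDr sqr_ge0.
apply: (@le_trans _ _ ((quad (quad_coef sigma r) g + e) ^+ 2)); last by rewrite lerDl sqr_ge0.
by rewrite ler_pXn2r ?nnegrE ?addr_ge0// lerDl.
Qed.

(** The inequality of the two means gives A^2 >= 4 alpha_1 alpha_2 |z_1 z_2|^2,
    and alpha_j >= sigma_j / (1 - r^sigma_j) absorbs the poles of the weight. *)
Lemma modC_reg_factor_le c m e g r : unit_im c -> 0 <= e -> 0 < r < 1 ->
  0 < normsq (zc ord0 g) -> 0 < normsq (zc ord_max g) ->
  ss * modC (reg_factor c m e (g, r)) <=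
  (4 * (normsq (zc ord0 g) * normsq (zc ord_max g)))^-1 * r `^ (sigma m - 1).
Proof.
move=> hc e0 r01 u0 u1; rewrite modK//.
have [h _] := normsq_ge g hc e0 r01; have w0 := w_gt0 r01.
have := le_trans (quad2 g r01) h.
set Q := normsq (den _ _ _ _); set Y := 4 * _ => hQ.
have Y0 : 0 < Y by rewrite !mulr_gt0.
have Q0 : 0 < Q by apply: lt_le_trans hQ; rewrite mulr_gt0 ?divr_gt0.
rewrite /kernel_weight -/(w r).
have -> : ss * (r `^ (sigma m - 1) / w r / Q) = (ss / w r / Q) * r `^ (sigma m - 1) by ring.
rewrite ler_wpM2r ?powR_ge0// ler_pdivrMr//.
by rewrite [leRHS]mulrC ler_pdivlMr.
Qed.

Definition dominant m M C (p : G R * R) : R :=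
  C * ((((cutpow_abs 4^-1 M p.1.1.1.1 * cutpow_abs 4^-1 M p.1.1.1.2) *
   (cutpow_abs 4^-1 M p.1.1.2.1 * cutpow_abs 4^-1 M p.1.1.2.2)) *
   cutpow_abs 2^-1 M p.1.2) * betafun (sigma m) p.2).

Lemma integrable_dominant m M C : 0 < M ->
  (@haar R \x @lebesgue_measure R)%E.-integrable setT (EFin \o dominant m M C).
Proof.
move=> M0.
have h1 : (@lebesgue_measure R).-integrable setT (EFin \o cutpow_abs 4^-1 M).
  exact: integrable_cutpow_abs.
have h2 : (@lebesgue_measure R).-integrable setT (EFin \o cutpow_abs 2^-1 M).
  exact: integrable_cutpow_abs.
have hC : (@lebesgueC R).-integrable setT (EFin \o _) := integrable_tensor h1 h1.
have hC2 : (@lebesgueC2 R).-integrable setT (EFin \o _) := integrable_tensor hC hC.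
have hG : (@haar R).-integrable setT (EFin \o _) := integrable_tensor hC2 h2.
have h := integrable_tensor hG (integrable_betafun (sigma_gt0 m)).
by have := integrableZl measurableT C h; apply: eq_integrable.
Qed.

(** The bound does not depend on e: it serves for the local integrability of the
    kernel and for the removal of the regularization. *)
Lemma modC_reg_factor_dominant m M : 0 < M -> exists2 C, 0 <= C & forall c e g r, unit_im c -> 0 <= e ->
  0 < r < 1 -> `|g| < M -> coords_neq0 g ->
  ss * modC (reg_factor c m e (g, r)) <= dominant m M C (g, r).
Proof.
move=> M0; have [k0 k00 hk0] := onem_powR_ge (sigma_gt0 ord0).
have [k1 k10 hk1] := onem_powR_ge (sigma_gt0 ord_max).
exists (ss `^ 4^-1 / (k0 * k1) `^ 4^-1); first by rewrite divr_ge0 ?powR_ge0.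
move=> c e g r hc e0 r01 gM [x0 y0 x1 y1 t0]; rewrite modK// /dominant /=.
have [r0 r1] := andP r01; have w0 := w_gt0 r01.
have [hq ht] := normsq_ge g hc e0 r01.
have : [&& `|g.1.1.1| < M, `|g.1.1.2| < M, `|g.1.2.1| < M, `|g.1.2.2| < M & `|g.2| < M].
  by move: gM; rewrite !prod_normE !gt_max -!andbA.
move=> /and5P[b1 b2 b3 b4 b5].
rewrite !cutpow_absE// /betafun !cutpowE ?r0//; last by rewrite mulN1r addrC subr_gt0 r1 gtrBl.
have := le_trans (quad2 g r01) hq.
set Q := normsq (den _ _ _ _) => hQ.
have ht2 : `|g.2| ^+ 2 <= Q by rewrite real_normK ?num_real.
have n0 (x : R) : x != 0 -> 0 < `|x| by rewrite normr_gt0.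
have hw : k0 * k1 * (-1 * r + 1) ^+ 2 <= w r.
  have -> : k0 * k1 * (-1 * r + 1) ^+ 2 = (k0 * (1 - r)) * (k1 * (1 - r)) by ring.
  by apply: ler_pM; rewrite ?hk0 ?hk1// mulr_ge0 ?ltW// subr_gt0.
have r10 : 0 < -1 * r + 1 by rewrite mulN1r addrC subr_gt0.
(* Here |z_1|^2 |z_2|^2 >= |x_1 y_1 x_2 y_2|. *)
have hX : ss / w r * (`|g.1.1.1| * `|g.1.1.2| * (`|g.1.2.1| * `|g.1.2.2|)) <= Q.
  apply: le_trans hQ; rewrite ler_wpM2l ?divr_ge0 ?(ltW ss_gt0) ?(ltW w0)//.
  have amgm (a b : R) : `|a| * `|b| <= a ^+ 2 + b ^+ 2.
    rewrite -(real_normK (num_real a)) -(real_normK (num_real b)).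
    move: (normr_ge0 a) (normr_ge0 b); move: `|a| `|b| => x y x_ge0 y_ge0.
    have := sqr_ge0 (x - y); have := mulr_ge0 x_ge0 y_ge0; lra.
  have h1 := amgm g.1.1.1 g.1.1.2; have h2 := amgm g.1.2.1 g.1.2.2.
  have := ler_pM (mulr_ge0 (normr_ge0 _) (normr_ge0 _)) (mulr_ge0 (normr_ge0 _) (normr_ge0 _)) h1 h2.
  move=> h; apply: (le_trans h); rewrite ler_peMl ?mulr_ge0 ?addr_ge0 ?sqr_ge0//.
  by rewrite ler1n.
have := geometric_bound ss_gt0 w0 r10 (mulr_gt0 k00 k10) (n0 _ x0) (n0 _ y0) (n0 _ x1) (n0 _ y1)
  (n0 _ t0) hX ht2 hw.
rewrite /kernel_weight -/(w r) => h.
have -> : ss * (r `^ (sigma m - 1) / w r / Q) = ss / (w r * Q) * r `^ (sigma m - 1).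
  have alg (s p v q : R) : s * (p / v / q) = s / (v * q) * p by rewrite invfM; ring.
  exact: alg.
apply: (le_trans (ler_wpM2r (powR_ge0 _ _) h)).
rewrite le_eqVlt; apply/orP; left; apply/eqP.
by ring.
Qed.

End Domination.

(** * Absolute convergence and local integrability of the kernel *)

Section Indicators.
Context d (T : measurableType d) (R : realType) (mu : {measure set T -> \bar R}).
Variables (D : set T) (mD : measurable D).
Implicit Types f g : T -> R[i].

Definition ind (x : T) : R[i] := (\1_D x : R)%:C.

Lemma ind1 x : D x -> ind x = 1.
Proof. by move=> Dx; rewrite /ind indicE mem_set. Qed.

Lemma ind0 x : ~ D x -> ind x = 0.
Proof. by move=> Dx; rewrite /ind indicE memNset. Qed.

Lemma Cmeas_ind : Cmeas setT ind.
Proof. by split => //=; exact: measurable_indic. Qed.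

Lemma modC_ind x : modC (ind x) <= 1.
Proof. by rewrite /ind modCR indicE; case: (_ \in _); rewrite ?normr1 ?normr0. Qed.

Let patchE' f (part : R[i] -> R) : (forall a z : _, part (a%:C * z) = a * part z) ->
  ((fun x => (part (f x))%:E) \_ D) = (fun x => (part (ind x * f x))%:E).
Proof.
move=> h; apply/funext => x; rewrite patchE /ind h indicE.
by case: (_ \in _); rewrite ?mul1r ?mul0r.
Qed.

Let ReR (a : R) z : Re (a%:C * z) = a * Re z.
Proof. by rewrite ReM /= mul0r subr0. Qed.

Let ImR (a : R) z : Im (a%:C * z) = a * Im z.
Proof. by rewrite ImM /= mul0r addr0. Qed.

Lemma Cintegral_ind f : Cintegral mu D f = Cintegral mu setT (fun x => ind x * f x).
Proof.
by congr Complex; rewrite /Rintegral integral_mkcond;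
  [rewrite (patchE' f ReR)|rewrite (patchE' f ImR)].
Qed.

Lemma Cintegrable_ind f :
  Cintegrable mu D f <-> Cintegrable mu setT (fun x => ind x * f x).
Proof.
have h1 := patchE' f ReR; have h2 := patchE' f ImR.
have g1 : mu.-integrable D (EFin \o (fun x => Re (f x))) <->
    mu.-integrable setT (EFin \o (fun x => Re (ind x * f x))).
  by rewrite integrable_mkcond// -[EFin \o (fun x => Re (ind x * f x))]/(fun x => _) -h1.
have g2 : mu.-integrable D (EFin \o (fun x => Im (f x))) <->
    mu.-integrable setT (EFin \o (fun x => Im (ind x * f x))).
  by rewrite integrable_mkcond// -[EFin \o (fun x => Im (ind x * f x))]/(fun x => _) -h2.
by split=> -[/g1 ? /g2].
Qed.

Lemma Cintegral0 : Cintegral mu setT (fun=> 0) = 0 :> R[i].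
Proof. by congr Complex; rewrite /Rintegral /= integral0. Qed.

Lemma ae_eq_Cintegral f g : Cmeas setT f -> Cmeas setT g ->
  {ae mu, forall x, f x = g x} -> Cintegral mu setT f = Cintegral mu setT g.
Proof.
move=> [f1 f2] [g1 g2] fg; congr Complex; rewrite /Rintegral; congr fine;
  apply: ae_eq_integral => //; try exact/measurable_EFinP;
  by move: fg; apply: filterS => x /= ->.
Qed.

End Indicators.

Section Limits.
Context (R : realType).
Implicit Types (u v : nat -> R[i]) (a b : R[i]).

Lemma cvgC_cst a : cvgC (fun=> a) a.
Proof. by split; exact: cvg_cst. Qed.

Lemma cvgCD u v a b : cvgC u a -> cvgC v b -> cvgC (fun n => u n + v n) (a + b).
Proof.
move=> [u1 u2] [v1 v2]; split; rewrite ?ReD ?ImD.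
  by under eq_fun do rewrite ReD; exact: cvgD.
by under eq_fun do rewrite ImD; exact: cvgD.
Qed.

Lemma cvgCM u v a b : cvgC u a -> cvgC v b -> cvgC (fun n => u n * v n) (a * b).
Proof.
move=> [u1 u2] [v1 v2]; split; rewrite ?ReM ?ImM.
  by under eq_fun do rewrite ReM; apply: cvgB; exact: cvgM.
by under eq_fun do rewrite ImM; apply: cvgD; exact: cvgM.
Qed.

Lemma cvgCX u a n : cvgC u a -> cvgC (fun k => u k ^+ n) (a ^+ n).
Proof.
move=> h; elim: n => [|n IH]; first exact: cvgC_cst.
by rewrite exprS; under eq_fun do rewrite exprS; exact: cvgCM.
Qed.

Lemma cvgCV u a : a != 0 -> cvgC u a -> cvgC (fun n => (u n)^-1) a^-1.
Proof.
move=> /normsq_neq0 a0 [u1 u2].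
have h : (fun n => (normsq (u n))^-1) @ \oo --> (normsq a)^-1.
  apply: cvgV => //; rewrite /normsq expr2 expr2.
  by apply: cvgD; under eq_fun do rewrite expr2; exact: cvgM.
split; rewrite ?ReV ?ImV.
  by under eq_fun do rewrite ReV; exact: cvgM.
by under eq_fun do rewrite ImV; apply: cvgN; exact: cvgM.
Qed.

Lemma cvgC_unique u a b : cvgC u a -> cvgC u b -> a = b.
Proof.
move=> [u1 u2] [v1 v2]; apply: complexP.
  exact: (cvg_unique (@norm_hausdorff R R^o) u1 v1).
exact: (cvg_unique (@norm_hausdorff R R^o) u2 v2).
Qed.

Lemma cvgCR (x : nat -> R) (l : R) : x @ \oo --> l -> cvgC (fun n => (x n)%:C) l%:C.
Proof. by move=> h; split => //=; exact: cvg_cst. Qed.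

Lemma cvgC0_le u (x : nat -> R) : (forall n, modC (u n) <= x n) ->
  x @ \oo --> (0 : R) -> cvgC u 0.
Proof.
move=> ux x0.
have x0N : (fun n => - x n) @ \oo --> (0 : R) by rewrite -oppr0; exact: cvgN.
split=> /=.
  apply: (squeeze_cvgr _ x0N x0); apply: nearW => n.
  by rewrite -ler_norml (le_trans (Re_le_modC _)).
apply: (squeeze_cvgr _ x0N x0); apply: nearW => n.
by rewrite -ler_norml (le_trans (Im_le_modC _)).
Qed.

End Limits.

Section KernelMeasurability.
Context (R : realType) (sigma : 'I_2 -> R).
Hypothesis sigma_gt0 : forall j, 0 < sigma j.
Implicit Types (r e M : R) (c : R[i]) (g : G R) (m : 'I_2) (phi : G R -> R[i]).

Lemma measurable_powr (a : R) : measurable_fun setT (fun p : G R * R => p.2 `^ a).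
Proof.
by apply: (measurableT_comp (f := fun x : R => x `^ a)) => //; exact: measurable_powR.
Qed.

Lemma measurable_quad_coef j : measurable_fun setT (fun p : G R * R => quad_coef sigma p.2 j).
Proof.
apply: measurable_funM => //; apply: measurable_funM.
  by apply: measurable_funD => //; exact: measurable_powr.
by apply: measurable_invr => //; apply: measurable_funB => //; exact: measurable_powr.
Qed.

Lemma measurable_kernel_weight m : measurable_fun setT (fun p : G R * R => kernel_weight sigma m p.2).
Proof.
apply: measurable_funM; first exact: measurable_powr.
apply: measurable_invr => //.
by apply: measurable_funM; apply: measurable_funB => //; exact: measurable_powr.
Qed.

Lemma measurable_normsqr j : measurable_fun setT (fun p : G R * R => normsq (zc j p.1)).
Proof.
apply: (measurableT_comp (f := fun g : G R => normsq (zc j g))) => //.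
apply: continuous_measurableG => g.
by apply: cvgD; apply: cvgM; try exact: Re_zc_continuous; exact: Im_zc_continuous.
Qed.

Lemma Cmeas_denr c e : Cmeas setT (fun p : G R * R => den c (quad_coef sigma p.2) e p.1).
Proof.
apply: CmeasD; last apply: CmeasR.
  apply: CmeasM; [exact: Cmeas_cst|apply: CmeasR].
  exact: (measurableT_comp measurable_snd measurable_fst).
apply: measurable_funD => //; rewrite /quad.
under eq_fun do rewrite sum_I2.
by apply: measurable_funD; apply: measurable_funM;
  (exact: measurable_quad_coef || exact: measurable_normsqr).
Qed.

Lemma Cmeas_reg_factor c m e : Cmeas setT (reg_factor sigma c m e).
Proof.
apply: CmeasM; last by apply: CmeasR; exact: measurable_kernel_weight.
by apply: CmeasX; apply: CmeasV => //; exact: Cmeas_denr.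
Qed.

Definition reg_kernel c m e (p : G R * R) : R[i] := (sigma ord0 * sigma ord_max)%:C * reg_factor sigma c m e p.

Lemma Cmeas_reg_kernel c m e : Cmeas setT (reg_kernel c m e).
Proof. by apply: CmeasM; [exact: Cmeas_cst|exact: Cmeas_reg_factor]. Qed.

Lemma kernel_integrandE c m g r : kernel_integrand sigma c m g r = reg_kernel c m 0 (g, r).
Proof.
rewrite /kernel_integrand /reg_kernel /reg_factor /den /quad /= addr0 -exprVn.
by rewrite -mulrA; congr (_ * (_ * _)).
Qed.

Lemma modC_reg_kernel c m e p : modC (reg_kernel c m e p) = sigma ord0 * sigma ord_max * modC (reg_factor sigma c m e p).
Proof. by rewrite /reg_kernel modCM modCR ger0_norm// ltW// mulr_gt0. Qed.

Local Notation J := (`]0, 1[%classic : set R).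
Local Notation leb := (@lebesgue_measure R).

Let mJ : measurable (J : set (measurableTypeR R)). Proof. exact: measurable_itv. Qed.

Lemma Cintegrable_reg_kernel c m e g : unit_im c -> 0 <= e ->
  zc ord0 g != 0 -> zc ord_max g != 0 -> Cintegrable leb J (fun r => reg_kernel c m e (g, r)).
Proof.
move=> hc e0 z0 z1.
have u0 : 0 < normsq (zc ord0 g) by rewrite lt_neqAle normsq_ge0 eq_sym normsq_neq0.
have u1 : 0 < normsq (zc ord_max g) by rewrite lt_neqAle normsq_ge0 eq_sym normsq_neq0.
have [m1 m2] := Cmeas_reg_kernel c m e.
have mg : measurable_fun setT (fun r : R => (g, r)) by exact: measurable_fun_pair.
apply: (@le_Cintegrable _ _ _ leb J mJ _
  (fun r => (4 * (normsq (zc ord0 g) * normsq (zc ord_max g)))^-1 * r `^ (sigma m - 1))).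
- split.
    apply: (@measurable_funS _ _ _ _ setT) => //; exact: (measurableT_comp m1 mg).
  apply: (@measurable_funS _ _ _ _ setT) => //; exact: (measurableT_comp m2 mg).
- have := integrableZl mJ (4 * (normsq (zc ord0 g) * normsq (zc ord_max g)))^-1
    (integrable_powR_itv (sigma_gt0 m) ltr01).
  by apply: eq_integrable.
- by move=> r; rewrite /= in_itv /= => r01; rewrite modC_reg_kernel modC_reg_factor_le.
Qed.

Definition paired_kernel c m e phi (p : G R * R) : R[i] := ind R J p.2 * reg_kernel c m e p * phi p.1.

Lemma Cmeas_fst phi : Cmeas setT phi -> Cmeas setT (fun p : G R * R => phi p.1).
Proof. by move=> [m1 m2]; split; [exact: (measurableT_comp m1)|exact: (measurableT_comp m2)]. Qed.

Lemma Cmeas_snd (f : R -> R[i]) : Cmeas setT f -> Cmeas setT (fun p : G R * R => f p.2).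
Proof. by move=> [m1 m2]; split; [exact: (measurableT_comp m1)|exact: (measurableT_comp m2)]. Qed.

Lemma Cmeas_paired_kernel c m e phi : Cmeas setT phi -> Cmeas setT (paired_kernel c m e phi).
Proof.
move=> mphi; apply: CmeasM; last exact: Cmeas_fst.
by apply: CmeasM; [apply: Cmeas_snd; exact: Cmeas_ind|exact: Cmeas_reg_kernel].
Qed.

Local Notation hl := (@haar R \x leb)%E.

Lemma ae_coordsr : {ae hl, forall p, coords_neq0 p.1}.
Proof. exact: (ae_fst leb (@ae_coords R)). Qed.

Lemma paired_kernel_dominated m phi C M : (forall g, modC (phi g) <= C) ->
  (forall g, M < `|g| -> phi g = 0) ->
  exists2 D : G R * R -> R, hl.-integrable setT (EFin \o D) &
    forall c e p, unit_im c -> 0 <= e -> coords_neq0 p.1 -> modC (paired_kernel c m e phi p) <= D p.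
Proof.
move=> phiC phiM.
have C0 : 0 <= C by apply: le_trans (phiC 0); exact: modC_ge0.
(* The bound is strict inside the box, hence the margin 1. *)
pose M' := `|M| + 1; have M0 : 0 < M' by rewrite ltr_wpDl.
have [C' C'0 hC'] := modC_reg_factor_dominant sigma_gt0 m M0.
exists (fun p => C * dominant sigma m M' C' p).
  by have := integrableZl measurableT C (integrable_dominant sigma_gt0 m C' M0); apply: eq_integrable.
move=> c e [g r] hc e0 /= cg.
have dom0 : 0 <= dominant sigma m M' C' (g, r).
  have a := @cutpow_abs_ge0 R; have b := @cutpow_ge0 R.
  exact: mulr_ge0 C'0 (mulr_ge0 (mulr_ge0 (mulr_ge0 (mulr_ge0 (a _ _ _) (a _ _ _))
    (mulr_ge0 (a _ _ _) (a _ _ _))) (a _ _ _)) (mulr_ge0 (b _ _ _) (b _ _ _))).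
rewrite /paired_kernel /=; have [r01|r01] := pselect (J r); last first.
  by rewrite ind0// !mul0r modC0 mulr_ge0.
have [gM|gM] := ltP `|g| M'; last first.
  rewrite phiM ?mulr0; last by rewrite (lt_le_trans _ gM)// ltr_pwDr// ler_norm.
  by rewrite modC0 mulr_ge0.
rewrite ind1// mul1r modCM mulrC ler_pM ?modC_ge0//.
by rewrite modC_reg_kernel hC'//; move: r01; rewrite /= in_itv.
Qed.

Lemma Cintegrable_paired_kernel c m e phi C M : unit_im c -> 0 <= e -> Cmeas setT phi ->
  (forall g, modC (phi g) <= C) -> (forall g, M < `|g| -> phi g = 0) ->
  Cintegrable hl setT (paired_kernel c m e phi).
Proof.
move=> hc e0 mphi phiC phiM; have [D iD hD] := paired_kernel_dominated m phiC phiM.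
apply: (@le_Cintegrable_ae _ _ _ hl _ D (fun p => coords_neq0 p.1)
  (Cmeas_paired_kernel c m e mphi) iD ae_coordsr) => p cp; exact: hD.
Qed.

(** Fubini's theorem for the integrand times the indicator function of a box. *)
Lemma locint_kernel_integral c m : unit_im c -> locint (kernel_integral sigma c m).
Proof.
move=> hc M; have mB := @measurable_boxG R M.
have supp g : M < `|g| -> ind R (boxG M) g = 0.
  by move=> gM; apply: ind0; rewrite /boxG /= leNgt gM.
have [h _] := Cfubini1 (Cintegrable_paired_kernel m hc (lexx 0) (Cmeas_ind R mB) (modC_ind R (boxG M)) supp).
apply: (iffRL (Cintegrable_ind (@haar R) mB _)); move: h; apply: eq_Cintegrable => // g _.
have [gM|gM] := pselect (boxG M g); last first.
  rewrite [RHS](_ : _ = 0); last by rewrite ind0// mul0r.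
  rewrite -(Cintegral0 leb); apply: eq_Cintegral => r _.
  by rewrite /paired_kernel /= [X in _ * X]ind0// mulr0.
rewrite ind1// mul1r /kernel_integral (Cintegral_ind leb); apply: eq_Cintegral => r _.
by rewrite /paired_kernel /= [X in _ * X]ind1// mulr1 kernel_integrandE.
Qed.

(** The test function enters the integral in r wherever that integral converges
    absolutely, hence almost everywhere. *)
Lemma pairing_kernel_integral c m f : unit_im c -> contC f -> bsupp f ->
  Cintegral (@haar R) setT (fun g => kernel_integral sigma c m g * f g) =
  Cintegral hl setT (paired_kernel c m 0 f).
Proof.
move=> hc cf bf; have [C _ hC] := bsupp_boundedC cf bf; have [M hM] := bf.
have [h1 h2] := Cfubini1 (Cintegrable_paired_kernel m hc (lexx 0) (contC_meas cf) hC hM).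
refine (etrans _ (esym h2)).
have hi := locint_mul (@locint_kernel_integral c m hc) cf bf.
apply: (@ae_eq_Cintegral _ _ _ (@haar R)).
- exact: Cintegrable_meas hi.
- exact: Cintegrable_meas h1.
apply: ae_imp (@ae_coords R) => g [x0 y0 x1 y1 _].
have z j : zc j g != 0.
  case: (I2_cases j) => ->; rewrite /zc /=.
    by apply: contra x0 => /eqP[-> _].
  by apply: contra x1 => /eqP[-> _].
have ig := Cintegrable_reg_kernel m hc (lexx 0) (z ord0) (z ord_max).
rewrite /kernel_integral.
rewrite mulrC -CintegralZ//; last first.
  by move: ig; apply: eq_Cintegrable => // r _; rewrite kernel_integrandE.
rewrite (Cintegral_ind leb); apply: eq_Cintegral => r _.
by rewrite /paired_kernel /= kernel_integrandE; ring.
Qed.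

End KernelMeasurability.

(** * The truncated identity *)

Section Truncated.
Context (R : realType) (sigma : 'I_2 -> R).
Hypothesis sigma_gt0 : forall j, 0 < sigma j.
Implicit Types (r : R) (g : G R) (j : 'I_2).
Variables (c : R[i]) (e : R) (k m : 'I_2) (f : G R -> R[i]).
Hypotheses (hc : unit_im c) (e0 : 0 < e) (adm : admissible c k m) (hf : testfun f).
Variables (a b : R).
Hypotheses (a0 : 0 < a) (ab : a < b) (b1 : b < 1).

Local Notation J := (`]0, 1[%classic : set R).
Local Notation leb := (@lebesgue_measure R).
Local Notation hl := (@haar R \x leb)%E.
Local Notation ss := ((sigma ord0 * sigma ord_max)%:C : R[i]).

Let I : set R := `[a, b]%classic.
Let mI : measurable (I : set (measurableTypeR R)). Proof. exact: measurable_itv. Qed.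

Let IJ r : I r -> 0 < r < 1.
Proof.
by rewrite /I /= in_itv /= => /andP[h1 h2]; rewrite (lt_le_trans a0 h1) (le_lt_trans h2 b1).
Qed.

Let IJ2 r : I r -> J r. Proof. by move=> /IJ; rewrite /= in_itv. Qed.

Let bb (p : G R * R) : R[i] := (den c (quad_coef sigma p.2) e p.1)^-1.

(** The operator multiplies the kernel by a function that is bounded for r away
    from 1, so the integrability of the kernel is inherited. *)
Let Q (p : G R * R) : R[i] :=
  2 * (vfield_den_coef sigma c (quad_coef sigma p.2) (- 'i%C) k + vfield_den_coef sigma c (quad_coef sigma p.2) 'i%C (other k)) * bb p
  - 6 * (\sum_(j < 2) (quad_coef sigma p.2 j ^+ 2 - sigma j ^+ 2) * normsq (zc j p.1))%:C * bb p ^+ 2.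

Let boxQ g r : Box_inv_den2 sigma c (quad_coef sigma r) e k g = bb (g, r) ^+ 2 * Q (g, r).
Proof.
rewrite /Box_inv_den2 /Q -/(bb (g, r)) /=; move: (bb _) (_%:C) (vfield_den_coef _ _ _ _ _ + _) => x y z.
by ring.
Qed.

Let sigma_le_quad_coef r j : 0 < r < 1 -> sigma j <= quad_coef sigma r j.
Proof.
move=> /andP[/ltW r0 r1]; rewrite /quad_coef /s_ ler_peMl ?(ltW (sigma_gt0 j))//.
have h : 0 < 1 - r `^ sigma j by rewrite subr_gt0 powR_lt1// r0.
by rewrite ler_pdivlMr// mul1r lerBlDr -addrA lerDl addr_ge0 ?powR_ge0.
Qed.

Let quad_coef_le r j : I r -> quad_coef sigma r j <= quad_coef sigma b j.
Proof.
move=> Ir; have /andP[r0 r1] := IJ Ir; rewrite /quad_coef ler_wpM2r ?(ltW (sigma_gt0 j))// /s_.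
have rb : r `^ sigma j <= b `^ sigma j.
  move: Ir; rewrite /I /= in_itv /= => /andP[_ rb].
  by rewrite ge0_ler_powR ?nnegrE ?(ltW (sigma_gt0 j)) ?(ltW r0)// (le_trans (ltW r0)).
have hb : b `^ sigma j < 1 by rewrite powR_lt1// b1 ltW// (lt_trans a0).
have hr := le_lt_trans rb hb.
apply: ler_pM; rewrite ?addr_ge0 ?powR_ge0 ?invr_ge0 ?subr_ge0 ?(ltW hr)//.
  by rewrite lerD2l.
by rewrite lef_pV2 ?posrE ?subr_gt0// lerD2l lerN2.
Qed.

Let A : R := quad_coef sigma b ord0 + quad_coef sigma b ord_max.

Let modQ p : I p.2 -> modC (Q p) <= 10 * A / e.
Proof.
case: p => g r /= Ir; have r01 := IJ Ir; have [r0 r1] := andP r01.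
have al0 j : 0 <= quad_coef sigma r j by apply: quad_coef_ge0; rewrite ?r1 ?(ltW r0).
have q0 : 0 <= quad (quad_coef sigma r) g by exact: quad_ge0.
pose N := Num.sqrt (normsq (den c (quad_coef sigma r) e g)).
have NE : modC (bb (g, r)) = N^-1 by rewrite /bb modCV modCE.
have Nq : quad (quad_coef sigma r) g + e <= N.
  rewrite -[leLHS]ger0_norm; last by rewrite addr_ge0// ltW.
  by rewrite -sqrtr_sqr ler_wsqrtr// normsq_den// lerDl sqr_ge0.
have N0 : 0 < N by apply: lt_le_trans Nq; rewrite ltr_wpDl.
have Ne : N^-1 <= e^-1 by rewrite lef_pV2 ?posrE// (le_trans _ Nq)// lerDr.
have qN : quad (quad_coef sigma r) g / N <= 1.
  by rewrite ler_pdivrMr// mul1r (le_trans _ Nq)// lerDl ltW.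
have ei (eta : R[i]) j : unit_im eta -> modC (vfield_den_coef sigma c (quad_coef sigma r) eta j) <= 2 * quad_coef sigma b j.
  move=> he; have [s ->] : exists s : bool, vfield_den_coef sigma c (quad_coef sigma r) eta j =
      (quad_coef sigma r j + (-1) ^+ s * sigma j)%:C.
    case: he => ->; case: hc => ->; [exists true|exists false|exists false|exists true];
      by apply: complexP; rewrite /vfield_den_coef !(ReM,ImM,ReD,ImD,ReN,ImN)/=; ring.
  rewrite modCR; apply: (le_trans (ler_normD _ _)).
  rewrite normrMsign.
  rewrite !gtr0_norm ?sigma_gt0 ?(lt_le_trans (sigma_gt0 j) (sigma_le_quad_coef j r01))//.
  have h1 := quad_coef_le j Ir; have h2 := sigma_le_quad_coef j r01.
  by move: (quad_coef sigma r j) (quad_coef sigma b j) h1 h2 => x y h1 h2; lra.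
have sq : modC (\sum_(j < 2) (quad_coef sigma r j ^+ 2 - sigma j ^+ 2) * normsq (zc j g))%:C <=
    A * quad (quad_coef sigma r) g.
  have h j : 0 <= (quad_coef sigma r j ^+ 2 - sigma j ^+ 2) * normsq (zc j g).
    rewrite mulr_ge0 ?normsq_ge0// subr_ge0 ler_pXn2r ?nnegrE ?(ltW (sigma_gt0 j))//.
    exact: sigma_le_quad_coef.
  rewrite modCR ger0_norm ?sumr_ge0// /quad mulr_sumr; apply: ler_sum => j _.
  rewrite mulrA ler_wpM2r ?normsq_ge0//.
  apply: (@le_trans _ _ (quad_coef sigma r j ^+ 2)); first by rewrite gerBl sqr_ge0.
  rewrite expr2 ler_wpM2r// /A; apply: (le_trans (quad_coef_le j Ir)).
  have alb i : 0 <= quad_coef sigma b i by apply: quad_coef_ge0 => //; rewrite b1 ltW// (lt_trans a0).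
  by case: (I2_cases j) => ->; rewrite ?lerDl ?lerDr.
have A0 : 0 <= A by apply: (le_trans _ (lerD (quad_coef_le ord0 Ir) (quad_coef_le ord_max Ir))); rewrite addr_ge0.
rewrite /Q /=; apply: (le_trans (le_modCD _ _)); rewrite modCN.
have n2 (n : nat) : modC (n%:R : R[i]) = n%:R.
  by have := @modCR R n%:R; rewrite rmorph_nat normr_nat.
have -> : 10 * A / e = 2 * (2 * A) / e + 6 * A / e by rewrite -mulrDl; congr (_ / _); ring.
apply: lerD.
  rewrite !modCM n2 NE; apply: ler_pM; rewrite ?modC_ge0 ?mulr_ge0 ?modC_ge0 ?invr_ge0 ?(ltW N0)//.
  rewrite ler_wpM2l//; apply: (le_trans (le_modCD _ _)).
  have h1 : modC (vfield_den_coef sigma c (quad_coef sigma r) (- 'i%C) k) <= 2 * quad_coef sigma b k by apply: ei; right.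
  have h2 : modC (vfield_den_coef sigma c (quad_coef sigma r) 'i%C (other k)) <= 2 * quad_coef sigma b (other k) by apply: ei; left.
  apply: (le_trans (lerD h1 h2)); rewrite -mulrDr /A.
  by case: (I2_cases k) => ->; rewrite /other //= addrC.
rewrite modCM modCM n2 modCX NE.
apply: (@le_trans _ _ (6 * (A * quad (quad_coef sigma r) g) * N^-1 ^+ 2)).
  by rewrite ler_wpM2r ?sqr_ge0// ler_wpM2l.
have -> : 6 * (A * quad (quad_coef sigma r) g) * N^-1 ^+ 2 = 6 * A * ((quad (quad_coef sigma r) g / N) * N^-1) by ring.
rewrite -mulrA -[leRHS]mulrA ler_wpM2l// ler_wpM2l// -[leRHS]mul1r.
by apply: ler_pM; rewrite ?divr_ge0 ?invr_ge0 ?(ltW N0).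
Qed.

Let F1 (p : G R * R) : R[i] := ind R I p.2 * (reg_kernel sigma c m e p * Box_tr sigma k f p.1).

Let F2 (p : G R * R) : R[i] := (ind R I p.2 * Q p) * paired_kernel sigma c m e f p.

Let F1E p : F1 p = ind R I p.2 * paired_kernel sigma c m e (Box_tr sigma k f) p.
Proof.
rewrite /F1 /paired_kernel; have [Ir|Ir] := pselect (I p.2); last by rewrite [ind R I _]ind0// !mul0r.
by rewrite [ind R J _]ind1 ?mul1r//; exact: IJ2.
Qed.

Let Cmeas_Q : Cmeas setT Q.
Proof.
have mb : Cmeas setT bb by apply: CmeasV => //; exact: Cmeas_denr.
have mal j : Cmeas setT (fun p : G R * R => (quad_coef sigma p.2 j)%:C) by apply: CmeasR; exact: measurable_quad_coef.
have me eta j : Cmeas setT (fun p : G R * R => vfield_den_coef sigma c (quad_coef sigma p.2) eta j).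
  by apply: CmeasD => //; exact: Cmeas_cst.
apply: CmeasD.
  apply: CmeasM; last exact: mb.
  by apply: CmeasM; [exact: Cmeas_cst|apply: CmeasD; exact: me].
have h : Cmeas setT (fun p : G R * R =>
    -1 * (6 * (\sum_(j < 2) (quad_coef sigma p.2 j ^+ 2 - sigma j ^+ 2) * normsq (zc j p.1))%:C * bb p ^+ 2)).
  apply: CmeasM; first exact: Cmeas_cst.
  apply: CmeasM; last exact: CmeasX.
  apply: CmeasM; [exact: Cmeas_cst|apply: CmeasR].
  under eq_fun do rewrite sum_I2.
  by apply: measurable_funD; apply: measurable_funM; try exact: measurable_normsqr;
    apply: measurable_funB => //; apply: measurable_funX; exact: measurable_quad_coef.
by move: h; congr (Cmeas _ _); apply/funext => p; rewrite mulN1r.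
Qed.

Let iF1 : Cintegrable hl setT F1.
Proof.
have [sb bb'] := testfun_Box_tr sigma k hf; have cb := smoothC_cont sb.
have [C _ hC] := bsupp_boundedC cb bb'; have [M hM] := bb'.
have h := Cintegrable_paired_kernel sigma_gt0 m hc (ltW e0) (contC_meas cb) hC hM.
rewrite (funext F1E).
apply: (@CintegrableMb _ _ _ hl setT measurableT _ _ 1) => //.
  by apply: Cmeas_snd; exact: Cmeas_ind.
by move=> p _; exact: modC_ind.
Qed.

Let iF2 : Cintegrable hl setT F2.
Proof.
have [sf bf] := hf; have cf := smoothC_cont sf.
have [C _ hC] := bsupp_boundedC cf bf; have [M hM] := bf.
have h := Cintegrable_paired_kernel sigma_gt0 m hc (ltW e0) (contC_meas cf) hC hM.
apply: (@CintegrableMb _ _ _ hl setT measurableT (fun p => ind R I p.2 * Q p) _ (10 * A / e)); last exact: h.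
  by apply: CmeasM => //; apply: Cmeas_snd; exact: Cmeas_ind.
move=> p _; have [Ir|Ir] := pselect (I p.2); first by rewrite ind1// mul1r; exact: modQ.
rewrite ind0// mul0r modC0.
have alb i : 0 <= quad_coef sigma b i by apply: quad_coef_ge0 => //; rewrite b1 ltW// (lt_trans a0).
by rewrite divr_ge0 ?(ltW e0)// mulr_ge0// addr_ge0.
Qed.

Let F2E g r : F2 (g, r) = ind R I r * (ss * f g * ((kernel_weight sigma m r)%:C * Box_inv_den2 sigma c (quad_coef sigma r) e k g)).
Proof.
rewrite /F2 /paired_kernel /=; have [Ir|Ir] := pselect (I r); last by rewrite [ind R I _]ind0// !mul0r.
rewrite [ind R J _]ind1; last exact: IJ2.
by rewrite boxQ /reg_kernel /reg_factor -/(bb (g, r)) /=; ring.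
Qed.

(** For fixed r the derivatives are moved to the kernel; for fixed g the result
    is integrated in r. Fubini's theorem is applied once in each direction. *)
Lemma truncated_identity :
  Cintegral hl setT (fun p => ind R I p.2 * paired_kernel sigma c m e (Box_tr sigma k f) p) =
  4 * ss * ((boundary_weight sigma m b)%:C * Cintegral (@haar R) setT (fun g => (den c (quad_coef sigma b) e g)^-1 ^+ 3 * f g)
   - (boundary_weight sigma m a)%:C * Cintegral (@haar R) setT (fun g => (den c (quad_coef sigma a) e g)^-1 ^+ 3 * f g)).
Proof.
rewrite -(funext F1E).
have [_ ->] := Cfubini2 iF1.
have [sf bf] := hf; have cf := smoothC_cont sf.
have alJ r j : 0 < r < 1 -> 0 <= quad_coef sigma r j.
  by move=> /andP[r0 r1]; apply: quad_coef_ge0; rewrite ?r1 ?(ltW r0).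
transitivity (Cintegral leb setT (fun r => Cintegral (@haar R) setT (fun g => F2 (g, r)))).
  apply: eq_Cintegral => r _.
  have [Ir|Ir] := pselect (I r); last first.
    by apply: eq_Cintegral => g _; rewrite /F1 /F2 ind0// !mul0r.
  have h := @Box_tr_inv_den2 R sigma c (quad_coef sigma r) e hc (fun j => alJ r j (IJ Ir)) e0 k f hf.
  have cb := @contC_inv_den R c (quad_coef sigma r) e hc (fun j => alJ r j (IJ Ir)) e0.
  have [sB bB] := testfun_Box_tr sigma k hf.
  have i1 : Cintegrable (@haar R) setT (fun g => (den c (quad_coef sigma r) e g)^-1 ^+ 2 * Box_tr sigma k f g).
    apply: locint_mul => //; last exact: smoothC_cont.
    by apply: contC_locint; exact: contCM.
  transitivity (ss * (kernel_weight sigma m r)%:C * Cintegral (@haar R) setT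
      (fun g => (den c (quad_coef sigma r) e g)^-1 ^+ 2 * Box_tr sigma k f g)).
    rewrite -CintegralZ//; apply: eq_Cintegral => g _.
    by rewrite /F1 ind1// mul1r /reg_kernel /reg_factor /=; ring.
  rewrite h.
  have i2 : Cintegrable (@haar R) setT (fun g => Box_inv_den2 sigma c (quad_coef sigma r) e k g * f g).
    apply: locint_mul => //; apply: contC_locint.
    exact: (@contC_Box_inv_den2 R sigma c (quad_coef sigma r) e hc (fun j => alJ r j (IJ Ir)) e0 k).
  rewrite -CintegralZ//; apply: eq_Cintegral => g _.
  by rewrite F2E ind1// mul1r; ring.
have [_ <-] := Cfubini2 iF2; have [_ ->] := Cfubini1 iF2.
transitivity (Cintegral (@haar R) setT (fun g =>
   4 * ss * (boundary_weight sigma m b)%:C * ((den c (quad_coef sigma b) e g)^-1 ^+ 3 * f g) -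
   4 * ss * (boundary_weight sigma m a)%:C * ((den c (quad_coef sigma a) e g)^-1 ^+ 3 * f g))).
  apply: eq_Cintegral => g _.
  transitivity (Cintegral leb setT (fun r => ind R I r *
      (ss * f g * ((kernel_weight sigma m r)%:C * Box_inv_den2 sigma c (quad_coef sigma r) e k g)))).
    by apply: eq_Cintegral => r _; exact: F2E.
  rewrite -(Cintegral_ind leb) (ftc_boundary sigma_gt0 hc e0 g (ss * f g) adm a0 ab b1).
  by ring.
have ib r : 0 < r < 1 -> Cintegrable (@haar R) setT (fun g => (den c (quad_coef sigma r) e g)^-1 ^+ 3 * f g).
  move=> r01; have cb := @contC_inv_den R c (quad_coef sigma r) e hc (fun j => alJ r j r01) e0.
  by apply: locint_mul => //; apply: contC_locint; exact: contCM cb (contCM cb cb).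
have iba := ib a; have ibb := ib b.
rewrite a0 (lt_trans ab b1) in iba; rewrite (lt_trans a0 ab) b1 in ibb.
rewrite (CintegralB (mu := @haar R) measurableT (CintegrableZ (mu := @haar R) measurableT _ (ibb isT))
  (CintegrableZ (mu := @haar R) measurableT _ (iba isT))).
rewrite (CintegralZ (mu := @haar R) measurableT _ (ibb isT)) (CintegralZ (mu := @haar R) measurableT _ (iba isT)).
have alg (u v p q x y : R[i]) : 4 * u * p * x - 4 * u * q * y = 4 * u * (p * x - q * y) by ring.
exact: alg.
Qed.
End Truncated.

(** * Integrals over the half-line and over C^2 *)

Section HalfLine.
Context (R : realType).
Local Notation leb := (@lebesgue_measure R).
Local Notation half := (`]0%R, +oo[%classic : set R).
Implicit Types (x C : R) (z : R[i]) (n : nat).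

Let mhalf : measurable (half : set (measurableTypeR R)). Proof. exact: measurable_itv. Qed.

Lemma measurable_shiftVX C n : measurable_fun setT (fun x : R => (x + C)^-1 ^+ n).
Proof. by apply: measurable_funX; apply: measurable_invr => //; exact: measurable_funD. Qed.

Lemma is_derive_pow (f : R -> R) x d n : is_derive x 1 f d ->
  is_derive x 1 (fun y => f y ^+ n.+1) (n.+1%:R * f x ^+ n * d).
Proof.
move=> h; elim: n => [|n IH]; first by rewrite mulr1 mul1r.
under eq_fun do rewrite exprS.
by apply: (is_derive_eq (is_derive_mul h IH)); rewrite [n.+2%:R]mulrSr exprS; ring.
Qed.

Let d_shiftVX C n x : 0 < C -> 0 <= x ->
  is_derive x 1 (fun y => - (n.+1%:R^-1 * (y + C)^-1 ^+ n.+1)) ((x + C)^-1 ^+ n.+2).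
Proof.
move=> C0 x0; have n0 : x + C != 0 by rewrite gt_eqF// ltr_wpDl.
have h : is_derive x 1 (fun y : R => y + C) (1 + 0).
  exact: is_deriveD.
have hX := is_derive_pow n (@is_derive_inv R (fun y => y + C) x _ n0 h).
have hM := @is_derive_mul R (fun=> n.+1%:R^-1) _ x _ _ (is_derive_cst (n.+1%:R^-1 : R) x 1) hX.
apply: (is_derive_eq (is_deriveN hM)) => /=.
rewrite mulr0 !addr0.
have alg (u k v : R) : k * u = 1 -> - (u * (k * v ^+ n * (-1 * v ^+ 2))) = v ^+ n.+2.
  move=> ku; transitivity (k * u * (v ^+ n * v ^+ 2)); first by ring.
  by rewrite ku mul1r -exprD addn2.
by apply: alg; rewrite mulfV// pnatr_eq0.
Qed.

Lemma ge0_integral_shiftVX C n : 0 < C ->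
  (\int[leb]_(x in half) ((x + C)^-1 ^+ n.+2)%:E = (n.+1%:R^-1 * C^-1 ^+ n.+1)%:E)%E.
Proof.
move=> C0; have mf := measurable_shiftVX C n.+2.
rewrite integral_itv_obnd_cbnd; last by apply/measurable_EFinP; exact: measurable_funS mf.
pose F y := - (n.+1%:R^-1 * (y + C)^-1 ^+ n.+1).
have cont x (f : R -> R) d : is_derive x 1 f d -> {for x, continuous f}.
  by move=> [h _]; apply: differentiable_continuous; apply/derivable1_diffP.
rewrite (@ge0_continuous_FTC2y _ _ F 0 0).
- by rewrite sub0e -EFinN /F add0r opprK.
- by move=> x x0; rewrite exprn_ge0// invr_ge0 addr_ge0// ltW.
- apply: continuous_in_subspaceT => x; rewrite inE /= in_itv /= andbT => x0.
  have n0 : x + C != 0 by rewrite gt_eqF// ltr_wpDl.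
  have h : is_derive x 1 (fun y : R => y + C) (1 + 0).
    exact: is_deriveD.
  exact: cont (is_derive_pow n.+1 (@is_derive_inv R (fun y => y + C) x _ n0 h)).
- have V0 : (fun x => (x + C)^-1) x @[x --> +oo] --> (0 : R).
    apply/gtr0_cvgV0; last exact: cvg_addrr.
    by near=> x; rewrite addr_gt0//; near: x; exact: nbhs_pinfty_gt.
  have VX k : (x + C)^-1 ^+ k.+1 @[x --> +oo] --> (0 : R).
    elim: k => [|k IH]; first exact: V0.
    under eq_fun do rewrite exprS; rewrite -(mulr0 (0 : R)); exact: cvgM.
  rewrite /F -oppr0; apply: cvgN; rewrite -(mulr0 (n.+1%:R^-1 : R)).
  by apply: cvgM; [exact: cvg_cst|exact: VX].
- by move=> x /ltW x0; case: (d_shiftVX n C0 x0).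
- by apply: cvg_at_right_filter; exact: cont (d_shiftVX n C0 (lexx 0)).
- move=> x; rewrite in_itv /= andbT => /ltW x0; rewrite derive1E.
  by case: (d_shiftVX n C0 x0).
Unshelve. all: by end_near.
Qed.

Lemma integrable_shiftVX C n : 0 < C -> leb.-integrable half (EFin \o (fun x => (x + C)^-1 ^+ n.+2)).
Proof.
move=> C0; apply/integrableP; split.
  by apply/measurable_EFinP; apply: measurable_funS (measurable_shiftVX C n.+2).
under eq_integral => x xh.
  rewrite /= ger0_norm; first over.
  move: xh; rewrite inE /= in_itv /= andbT => x0.
  by rewrite exprn_ge0// invr_ge0 addr_ge0// ltW.
by rewrite ge0_integral_shiftVX// ltry.
Qed.

Lemma Cmeas_shiftVX z n : Cmeas setT (fun x : R => (x%:C + z)^-1 ^+ n).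
Proof.
apply: CmeasX; apply: CmeasV => //; apply: CmeasD; last exact: Cmeas_cst.
exact: CmeasR.
Qed.

Lemma modC_shift_le z x : 0 < Re z -> 0 <= x -> modC ((x%:C + z)^-1) <= (x + Re z)^-1.
Proof.
move=> z0 x0; have h : 0 < x + Re z by rewrite ltr_wpDl.
have h2 : x + Re z <= modC (x%:C + z).
  by apply: le_trans (Re_le_modC _); rewrite ReD /= ler_norm.
by rewrite modCV lef_pV2 ?posrE ?(lt_le_trans h h2).
Qed.

Lemma modC_shiftX_le z x n : 0 < Re z -> 0 <= x -> modC ((x%:C + z)^-1 ^+ n) <= (x + Re z)^-1 ^+ n.
Proof.
move=> z0 x0; rewrite modCX; have h : 0 < x + Re z by rewrite ltr_wpDl.
by apply: lerXn2r; rewrite ?nnegrE ?modC_ge0 ?invr_ge0 ?(ltW h)// modC_shift_le.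
Qed.

Lemma Cintegrable_shiftVX z n : 0 < Re z ->
  Cintegrable leb half (fun x => (x%:C + z)^-1 ^+ n.+2).
Proof.
move=> z0; have [m1 m2] := Cmeas_shiftVX z n.+2.
apply: (@le_Cintegrable _ _ _ leb half mhalf _ (fun x => (x + Re z)^-1 ^+ n.+2)).
- by split; [exact: measurable_funS m1|exact: measurable_funS m2].
- exact: integrable_shiftVX.
- by move=> x; rewrite /= in_itv /= andbT => /ltW x0; exact: modC_shiftX_le.
Qed.

Let dshift z n x : 0 < Re z -> 0 <= x ->
  is_cderive x 1 (fun y : R => - n.+1%:R^-1 * (y%:C + z)^-1 ^+ n.+1) ((x%:C + z)^-1 ^+ n.+2).
Proof.
move=> z0 x0.
have n0 : x%:C + z != 0.
  apply: contraTneq (ltr_wpDl x0 z0) => /(congr1 (@complex.Re R)); rewrite ReD /= => ->.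
  by rewrite ltxx.
have h1 : is_cderive x 1 (fun y : R => y%:C + z) (1%:C + 0).
  by apply: is_cderiveD; [apply: is_cderive_real; exact: is_derive_id|exact: is_cderive_cst].
have h2 := is_cderiveV n0 h1.
have hX k : is_cderive x 1 (fun y : R => (y%:C + z)^-1 ^+ k.+1) (- k.+1%:R * (x%:C + z)^-1 ^+ k.+2).
  elim: k => [|k IH].
    by apply: (eq_ind _ (is_cderive x 1 _) h2); rewrite addr0.
  have h := is_cderiveM h2 IH.
  under eq_fun do rewrite exprS.
  apply: (eq_ind _ (is_cderive x 1 _) h); rewrite addr0.
  rewrite [k.+2%:R]mulrSr !exprS; ring.
apply: (eq_ind _ (is_cderive x 1 _) (is_cderiveM (is_cderive_cst x 1 (- n.+1%:R^-1)) (hX n))).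
by rewrite mul0r addr0 mulrA mulrNN mulVf ?mul1r// pnatr_eq0.
Qed.

Let cder_shift z n x : 0 < Re z -> 0 <= x -> cder (fun y : R => (y%:C + z)^-1 ^+ n) x.
Proof.
move=> z0 x0; apply: cderX; apply: cderV.
  apply: contraTneq (ltr_wpDl x0 z0) => /(congr1 (@complex.Re R)); rewrite ReD /= => ->.
  by rewrite ltxx.
by apply: cderD; [apply: cder_real; exact: is_derive_id|exact: cder_cst].
Qed.

(** The primitive is explicit; both ends of the half-line are reached by
    dominated convergence along the intervals [1/(i+1), i+2]. *)
Lemma Cintegral_shiftVX z n : 0 < Re z ->
  Cintegral leb half (fun x => (x%:C + z)^-1 ^+ n.+2) = n.+1%:R^-1 * z^-1 ^+ n.+1.
Proof.
move=> z0; set f := fun x => _.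
have z_neq0 : z != 0 by apply: contraTneq z0 => ->; rewrite ltxx.
pose F (y : R) : R[i] := - n.+1%:R^-1 * (y%:C + z)^-1 ^+ n.+1.
pose lo (i : nat) : R := i.+1%:R^-1; pose hi (i : nat) : R := i.+2%:R.
have lo0 i : 0 < lo i by rewrite invr_gt0.
have lohi i : lo i < hi i.
  by apply: (@le_lt_trans _ _ 1); rewrite ?invf_le1 ?ler1n ?ltr1n.
have clo : lo @ \oo --> (0 : R) by exact: cvg_harmonic.
have mI i : measurable (`[lo i, hi i]%classic : set (measurableTypeR R)) by exact: measurable_itv.
have cv : cvgC (fun i => Cintegral leb setT (fun x => ind R `[lo i, hi i]%classic x * f x))
    (Cintegral leb setT (fun x => ind R half x * f x)).
  apply: (@Cdominated _ _ _ leb setT measurableT _ _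
    (fun x => modC (ind R half x * f x))).
  - by move=> i; apply: CmeasM; [exact: Cmeas_ind|exact: Cmeas_shiftVX].
  - by apply: CmeasM; [exact: Cmeas_ind|exact: Cmeas_shiftVX].
  - apply: (@Cintegrable_mod _ _ _ leb setT measurableT).
    by apply: (iffLR (Cintegrable_ind leb mhalf _)); exact: Cintegrable_shiftVX.
  - apply: aeW => x _; apply: cvgCM; last exact: cvgC_cst.
    have [x0|x0] := pselect (half x).
      rewrite [X in cvgC _ X]ind1//; split => /=; last exact: cvg_cst.
      apply: cvg_near_cst; move: x0; rewrite /= in_itv /= andbT => x0.
      have h1 : \forall i \near \oo, lo i < x by apply: (cvgr_lt 0).
      have h2 : \forall i \near \oo, x <= hi i.
        have /archi_boundP := ltW x0; set N := Num.Def.archi_bound _ => hN.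
        exists N => // i /= Ni; apply: (le_trans (ltW hN)); rewrite /hi ler_nat.
        by rewrite (leq_trans Ni)// -addn2 leq_addr.
      near=> i; rewrite indicE mem_set//= in_itv /=; apply/andP; split; last by near: i.
      by apply: ltW; near: i.
    have -> : (fun i => ind R `[lo i, hi i]%classic x) = fun=> 0.
      apply/funext => i; rewrite ind0//= in_itv /= => /andP[h _]; apply: x0.
      by rewrite /= in_itv /= andbT (lt_le_trans (lo0 i)).
    by rewrite ind0//; exact: cvgC_cst.
  - apply: aeW => x _ i; have [xI|xI] := pselect (`[lo i, hi i]%classic x); last first.
      by rewrite ind0// mul0r modC0 modC_ge0.
    rewrite ind1// [ind R half x]ind1// /= in_itv /= andbT.
    by move: xI; rewrite /= in_itv /= => /andP[h _]; rewrite (lt_le_trans (lo0 i)).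
rewrite (Cintegral_ind leb); apply: (cvgC_unique cv).
have e i : Cintegral leb setT (fun x => ind R `[lo i, hi i]%classic x * f x) = F (hi i) - F (lo i).
  rewrite -(Cintegral_ind leb) (@Cftc R F f (lo i) (hi i))// => x /andP[h _].
    by apply: dshift => //; exact: le_trans (ltW (lo0 i)) h.
  by apply: cder_shift => //; exact: le_trans (ltW (lo0 i)) h.
rewrite (funext e).
have -> : n.+1%:R^-1 * z^-1 ^+ n.+1 = 0 + - 1 * (- n.+1%:R^-1 * z^-1 ^+ n.+1) by ring.
have -> : (fun i => F (hi i) - F (lo i)) = (fun i => F (hi i) + - 1 * F (lo i)).
  by apply/funext => i; rewrite mulN1r.
apply: cvgCD.
  rewrite -(mulr0 (- n.+1%:R^-1)); apply: cvgCM; first exact: cvgC_cst.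
  have h : cvgC (fun i => ((hi i)%:C + z)^-1) 0.
    apply: (@cvgC0_le _ _ lo) => // i; apply: (le_trans (modC_shift_le z0 _)) => //.
    rewrite /lo /hi lef_pV2 ?posrE ?ltr_wpDl//.
    by rewrite (@le_trans _ _ i.+2%:R) ?ler_nat// lerDl ltW.
  by have := cvgCX n.+1 h; rewrite expr0n.
apply: cvgCM; first exact: cvgC_cst.
apply: cvgCM; first exact: cvgC_cst.
apply: cvgCX; apply: cvgCV => //.
rewrite -[X in cvgC _ X]add0r; apply: cvgCD; last exact: cvgC_cst.
exact: (cvgCR clo).
Unshelve. all: by end_near.
Qed.

End HalfLine.

Section RadialPlane.
Context (R : realType).
Local Notation leb := (@lebesgue_measure R).
Local Notation half := (`]0%R, +oo[%classic : set R).
Local Notation nuC := (@lebesgueC R).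
Local Notation nuC2 := (@lebesgueC2 R).
Implicit Types (z : R[i]).

Lemma Cintegral_rsq (h : R -> R[i]) : Cmeas setT h -> Cintegrable leb half h ->
  Cintegrable nuC setT (fun p => h (rsq p)) /\
  Cintegral nuC setT (fun p => h (rsq p)) = pi%:C * Cintegral leb half h.
Proof.
move=> [m1 m2] [i1 i2]; split.
  by split; [exact: (integrable_rsq m1 i1)|exact: (integrable_rsq m2 i2)].
apply: complexP; rewrite ?ReM ?ImM /= mul0r ?subr0 ?addr0.
  exact: (Rintegral_rsq m1 i1).
exact: (Rintegral_rsq m2 i2).
Qed.

Lemma measurable_rsq12 : measurable_fun setT (fun q : (R * R) * (R * R) => rsq q.1 + rsq q.2).
Proof.
by apply: measurable_funD; apply: (measurableT_comp (f := @rsq R)) => //; exact: measurable_rsq.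
Qed.

Lemma integrable_rsqV3 (C : R) : 0 < C ->
  nuC2.-integrable setT (EFin \o (fun q => (rsq q.1 + rsq q.2 + C)^-1 ^+ 3)).
Proof.
move=> C0; apply/integrable12ltyP.
  apply/measurable_EFinP; apply: measurable_funX; apply: measurable_invr => //.
  by apply: measurable_funD => //; exact: measurable_rsq12.
have p0 (p : R * R) : 0 < rsq p + C by rewrite ltr_wpDl ?rsq_ge0.
have ext x (c : R) n : 0 < c -> 0 <= ((rsq x + c)^-1 ^+ n).
  by move=> c0; rewrite exprn_ge0// invr_ge0 addr_ge0 ?rsq_ge0// ltW.
have key (c : R) n : 0 < c -> (\int[nuC]_y ((rsq y + c)^-1 ^+ n.+2)%:E =
    (pi * (n.+1%:R^-1 * c^-1 ^+ n.+1))%:E)%E.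
  move=> c0; have mh : measurable_fun setT (fun x : R => (`|(x + c)^-1 ^+ n.+2|)%:E).
    by apply/measurable_EFinP; apply: measurableT_comp => //; exact: measurable_shiftVX.
  have := @ge0_integral_rsq R _ mh (fun x => _).
  rewrite (@eq_integral _ _ _ nuC setT (fun y => ((rsq y + c)^-1 ^+ n.+2)%:E)); last first.
    by move=> y _; rewrite ger0_norm// ext.
  move=> ->; last by move=> x; rewrite lee_fin.
  rewrite EFinM; congr (_ * _)%E; rewrite -ge0_integral_shiftVX//.
  apply: eq_integral => x; rewrite inE /= in_itv /= andbT => x0.
  by rewrite ger0_norm// exprn_ge0// invr_ge0 addr_ge0// ltW.
rewrite (@eq_integral _ _ _ nuC setT (fun x => (pi / 2)%:E * ((rsq x + C)^-1 ^+ 2)%:E)%E); last first.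
  move=> x _; rewrite -EFinM.
  refine (etrans _ (etrans (key (rsq x + C) 1%N (p0 x)) _)).
    apply: eq_integral => y _.
    rewrite /= ger0_norm; last first.
      by rewrite exprn_ge0// invr_ge0 (ltW (ltr_wpDl (addr_ge0 (rsq_ge0 x) (rsq_ge0 y)) C0)).
    by rewrite (addrC (rsq x)) -addrA.
  by congr EFin; rewrite mulrA.
rewrite ge0_integralZl ?lee_fin ?divr_ge0 ?pi_ge0//.
- apply: (@le_lt_trans _ _ ((pi / 2)%:E * (pi * (1%:R^-1 * C^-1 ^+ 1))%:E)%E).
    by rewrite -(key C 0%N C0).
  by rewrite -EFinM ltry.
- apply/measurable_EFinP.
  exact: (measurableT_comp (measurable_shiftVX C 2) (@measurable_rsq R)).
- by move=> x _; rewrite lee_fin ext.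
Qed.

Definition rsq2 (q : (R * R) * (R * R)) : R := rsq q.1 + rsq q.2.

(** Polar coordinates in each copy of C lower the exponent by one. *)
Lemma Cintegral_rsqV3 z : 0 < Re z ->
  Cintegrable nuC2 setT (fun q => ((rsq2 q)%:C + z)^-1 ^+ 3) /\
  Cintegral nuC2 setT (fun q => ((rsq2 q)%:C + z)^-1 ^+ 3) = (pi ^+ 2 / 2)%:C * z^-1.
Proof.
move=> z0.
have r0 q : 0 <= rsq2 q by rewrite addr_ge0 ?rsq_ge0.
have i3 : Cintegrable nuC2 setT (fun q => ((rsq2 q)%:C + z)^-1 ^+ 3).
  apply: (@le_Cintegrable _ _ _ nuC2 setT measurableT _
    (fun q => (rsq q.1 + rsq q.2 + Re z)^-1 ^+ 3)).
  - have [m1 m2] := Cmeas_shiftVX z 3.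
    by split; [exact: (measurableT_comp m1 measurable_rsq12)|exact: (measurableT_comp m2 measurable_rsq12)].
  - exact: integrable_rsqV3.
  - by move=> q _; exact: modC_shiftX_le.
split=> //; have [_ e] := @Cfubini1 _ _ _ _ R nuC nuC _ i3.
apply: (etrans e).
have inner (p : R * R) : Cintegral nuC setT (fun q => ((rsq2 (p, q))%:C + z)^-1 ^+ 3) =
    (pi / 2)%:C * (((rsq p)%:C + z)^-1 ^+ 2).
  have zp : 0 < Re ((rsq p)%:C + z) by rewrite ReD /= ltr_wpDl// rsq_ge0.
  have [_ h] := Cintegral_rsq (Cmeas_shiftVX ((rsq p)%:C + z) 3) (Cintegrable_shiftVX 1 zp).
  transitivity (Cintegral nuC setT (fun q => ((rsq q)%:C + ((rsq p)%:C + z))^-1 ^+ 3)).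
    by apply: eq_Cintegral => q _; rewrite /rsq2 /= rmorphD addrCA addrA.
  refine (etrans h _); rewrite Cintegral_shiftVX// mulrA rmorphM fmorphV rmorph_nat.
  by [].
have [i2 h2] := Cintegral_rsq (Cmeas_shiftVX z 2) (Cintegrable_shiftVX 0 z0).
transitivity (Cintegral nuC setT (fun p => (pi / 2)%:C * (((rsq p)%:C + z)^-1 ^+ 2))).
  by apply: eq_Cintegral => p _; exact: inner.
rewrite (CintegralZ (mu := nuC) measurableT _ i2); refine (etrans (congr1 ( *%R _) h2) _).
rewrite Cintegral_shiftVX// invr1 mul1r expr1 mulrA -rmorphM; congr (_%:C * _).
by rewrite mulrAC expr2.
Qed.

End RadialPlane.

(** * The boundary terms *)

Section ParameterLimits.
Context (R : realType) (sigma : 'I_2 -> R).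
Hypothesis sigma_gt0 : forall j, 0 < sigma j.
Implicit Types (n : nat) (j m : 'I_2).

(** The shift by 3 keeps the two cuts on different sides of 1/2. *)
Definition lower_cut n : R := n.+3%:R^-1.
Definition upper_cut n : R := 1 - lower_cut n.

Lemma lower_cut_gt0 n : 0 < lower_cut n. Proof. by rewrite invr_gt0. Qed.

Lemma lower_cut_lt n : lower_cut n < 2^-1.
Proof. by rewrite /lower_cut ltf_pV2 ?posrE// ltr_nat. Qed.

Lemma lower_upper_cut n : lower_cut n < upper_cut n.
Proof. by have := lower_cut_lt n; rewrite /upper_cut; lra. Qed.

Lemma upper_cut_lt1 n : upper_cut n < 1.
Proof. by rewrite /upper_cut gtrBl lower_cut_gt0. Qed.

Lemma upper_cut01 n : 0 < upper_cut n < 1.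
Proof. by rewrite upper_cut_lt1 (lt_trans (lower_cut_gt0 n) (lower_upper_cut n)). Qed.

Lemma lower_cut01 n : 0 < lower_cut n < 1.
Proof. by rewrite lower_cut_gt0 (lt_trans (lower_upper_cut n) (upper_cut_lt1 n)). Qed.

Lemma cvg_lower_cut : lower_cut @ \oo --> (0 : R).
Proof.
have h : (fun n => harmonic (n + 2)%N : R) @ \oo --> (0 : R).
  by rewrite (cvg_shiftn 2 (@harmonic R)); exact: cvg_harmonic.
by move: h; under eq_fun do rewrite addn2.
Qed.

Lemma cvg_upper_cut : upper_cut @ \oo --> (1 : R).
Proof. by rewrite -[X in _ --> X]subr0; apply: cvgB; [exact: cvg_cst|exact: cvg_lower_cut]. Qed.

Lemma cvg_lower_cut_pow (s : R) : 0 < s -> (fun n => lower_cut n `^ s) @ \oo --> (0 : R).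
Proof.
move=> s0; move/cvg_at_rightP : (powR_cvg0 s0); apply; split; first exact: lower_cut_gt0.
exact: cvg_lower_cut.
Qed.

Lemma cvg_upper_cut_pow (s : R) : (fun n => upper_cut n `^ s) @ \oo --> (1 : R).
Proof.
have c1 : {for 1, continuous (fun x : R => x `^ s)}.
  have [h _] := is_derive1_powR s (ltr01 : (0 : R) < 1).
  by apply: differentiable_continuous; apply/derivable1_diffP.
by move: (cvg_comp _ _ cvg_upper_cut c1); rewrite powR1.
Qed.

Lemma cvg_quad_coef_lower j : (fun n => quad_coef sigma (lower_cut n) j) @ \oo --> sigma j.
Proof.
rewrite -[X in _ --> X]mul1r; apply: cvgM; last exact: cvg_cst.
rewrite (_ : 1 = (1 + 0) / (1 - 0)); last by rewrite addr0 subr0 divr1.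
have h := cvg_lower_cut_pow (sigma_gt0 j); apply: cvgM.
  by apply: cvgD => //; exact: cvg_cst.
apply: cvgV; first by rewrite subr0 oner_neq0.
by apply: cvgB => //; exact: cvg_cst.
Qed.

Lemma cvg_boundary_weight_lower m : (fun n => boundary_weight sigma m (lower_cut n)) @ \oo --> (0 : R).
Proof.
rewrite (_ : 0 = 0 / ((1 - 0) * (1 - 0))); last by rewrite mul0r.
have h j := cvg_lower_cut_pow (sigma_gt0 j); apply: cvgM => //.
apply: cvgV; first by rewrite subr0 mulr1 oner_neq0.
by apply: cvgM; apply: cvgB => //; exact: cvg_cst.
Qed.

Lemma cvg_quad_coefV_upper j : (fun n => (quad_coef sigma (upper_cut n) j)^-1) @ \oo --> (0 : R).
Proof.
have -> : (fun n => (quad_coef sigma (upper_cut n) j)^-1) =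
    (fun n => (1 - upper_cut n `^ sigma j) * ((1 + upper_cut n `^ sigma j) * sigma j)^-1).
  by apply/funext => n; rewrite /quad_coef /s_ !invfM invrK; ring.
rewrite (_ : 0 = (1 - 1) * ((1 + 1) * sigma j)^-1); last by rewrite subrr mul0r.
have h := cvg_upper_cut_pow (sigma j); apply: cvgM.
  by apply: cvgB => //; exact: cvg_cst.
apply: cvgV; first by rewrite mulf_neq0// gt_eqF// sigma_gt0.
by apply: cvgM; [apply: cvgD => //|]; exact: cvg_cst.
Qed.

(** Near r = 1 the weight compensates the Jacobian of the scaling of z_j by
    alpha_j^(-1/2). *)
Lemma cvg_boundary_weight_upper m : (fun n => 4 * (sigma ord0 * sigma ord_max) *
   (boundary_weight sigma m (upper_cut n) / (quad_coef sigma (upper_cut n) ord0 * quad_coef sigma (upper_cut n) ord_max))) @ \oo --> (1 : R).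
Proof.
have -> : (fun n => 4 * (sigma ord0 * sigma ord_max) *
     (boundary_weight sigma m (upper_cut n) / (quad_coef sigma (upper_cut n) ord0 * quad_coef sigma (upper_cut n) ord_max))) =
   (fun n => 4 * (upper_cut n `^ sigma m * ((1 + upper_cut n `^ sigma ord0) * (1 + upper_cut n `^ sigma ord_max))^-1)).
  apply/funext => n; have r01 := upper_cut01 n.
  have n0 := onem_neq0 sigma_gt0 ord0 r01; have n1 := onem_neq0 sigma_gt0 ord_max r01.
  have p j : 1 + upper_cut n `^ sigma j != 0 by rewrite gt_eqF// ltr_pwDl// powR_ge0.
  have s j : sigma j != 0 by rewrite gt_eqF// sigma_gt0.
  rewrite /boundary_weight /quad_coef /s_; move: (p ord0) (p ord_max) (s ord0) (s ord_max) n0 n1.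
  move: (upper_cut n `^ sigma ord0) (upper_cut n `^ sigma ord_max) (upper_cut n `^ sigma m) => x y w.
  by move=> h1 h2 h3 h4 h5 h6; field; rewrite h1 h2 h3 h4 h5 h6.
rewrite [X in _ --> X](_ : _ = 4 * (1 * ((1 + 1) * (1 + 1))^-1) :> R); last by field.
have h j := cvg_upper_cut_pow (sigma j).
apply: cvgM; first exact: cvg_cst.
apply: cvgM; first exact: h.
apply: cvgV; first by rewrite mulf_neq0// gt_eqF.
by apply: cvgM; apply: cvgD => //; exact: cvg_cst.
Qed.

End ParameterLimits.

Lemma cvg_pair_seq (U V : topologicalType) (u : nat -> U) (v : nat -> V) (a : U) (b : V) :
  u @ \oo --> a -> v @ \oo --> b -> (fun n => (u n, v n)) @ \oo --> (a, b).
Proof. by move=> ua vb; apply: cvg_pair. Qed.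

Section BoundaryTerms.
Context (R : realType) (sigma : 'I_2 -> R).
Hypothesis sigma_gt0 : forall j, 0 < sigma j.
Variables (c : R[i]) (e : R) (f : G R -> R[i]).
Hypotheses (hc : unit_im c) (e0 : 0 < e) (cf : contC f) (bf : bsupp f).
Implicit Types (n : nat) (g : G R) (j m : 'I_2).

Local Notation leb := (@lebesgue_measure R).

Let modden (alpha : 'I_2 -> R) g : (forall j, 0 <= alpha j) ->
  modC ((den c alpha e g)^-1 ^+ 3) <= (quad alpha g + e)^-1 ^+ 3.
Proof.
move=> a0; have q0 := quad_ge0 g a0.
have h : 0 < quad alpha g + e by rewrite ltr_wpDl.
rewrite modCX; apply: lerXn2r; rewrite ?nnegrE ?modC_ge0 ?invr_ge0 ?(ltW h)//.
have h2 : quad alpha g + e <= modC (den c alpha e g).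
  by apply: le_trans (Re_le_modC _); rewrite Re_den// ler_norm.
by rewrite modCV lef_pV2 ?posrE ?(lt_le_trans h h2).
Qed.

Let quad_coef_upper_gt0 n j : 0 < quad_coef sigma (upper_cut R n) j.
Proof.
have /andP[r0 r1] := upper_cut01 R n; rewrite mulr_gt0// divr_gt0//.
  by rewrite ltr_pwDl// powR_ge0.
by rewrite subr_gt0 powR_lt1// (ltW r0).
Qed.

(** The denominators converge to the one with coefficients sigma_j, while the
    weight tends to zero. *)
Lemma cvg_lower_term m : cvgC (fun n => (boundary_weight sigma m (lower_cut R n))%:C *
    Cintegral (@haar R) setT (fun g => (den c (quad_coef sigma (lower_cut R n)) e g)^-1 ^+ 3 * f g)) 0.
Proof.
have alge j n : 0 <= quad_coef sigma (lower_cut R n) j.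
  by have /andP[h1 h2] := lower_cut01 R n; apply: quad_coef_ge0; rewrite ?h2 ?(ltW h1).
have sge j : 0 <= sigma j by exact: ltW.
rewrite -(mul0r (Cintegral (@haar R) setT (fun g => (den c sigma e g)^-1 ^+ 3 * f g))).
apply: cvgCM; first exact: (cvgCR (cvg_boundary_weight_lower sigma_gt0 m)).
have mden alpha : (forall j, 0 <= alpha j) -> contC (fun g => (den c alpha e g)^-1 ^+ 3).
  by move=> a0; have cb := contC_inv_den hc a0 e0; exact: contCM cb (contCM cb cb).
have i0 : Cintegrable (@haar R) setT (fun g => (e^-1 ^+ 3)%:C * f g).
  by apply: locint_mul => //; apply: contC_locint; exact: contC_cst.
apply: (@Cdominated _ _ _ (@haar R) setT measurableT _ _ (fun g => modC ((e^-1 ^+ 3)%:C * f g))).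
- by move=> n; apply: contC_meas; apply: contCM => //; apply: mden.
- by apply: contC_meas; apply: contCM => //; apply: mden.
- exact: (@Cintegrable_mod _ _ _ (@haar R) setT measurableT _ i0).
- apply: aeW => g _; apply: cvgCM; last exact: cvgC_cst.
  apply: cvgCX; apply: cvgCV; first exact: den_neq0.
  apply: cvgCD; first exact: cvgC_cst.
  apply: cvgCR; apply: cvgD; last exact: cvg_cst.
  rewrite /quad sum_I2; under eq_fun do rewrite sum_I2.
  by apply: cvgD; apply: cvgM; try exact: cvg_cst; exact: cvg_quad_coef_lower.
- apply: aeW => g _ n; rewrite [leLHS]modCM [leRHS]modCM ler_wpM2r ?modC_ge0//.
  apply: (le_trans (modden g (alge ^~ n))); rewrite modCR ger0_norm ?exprn_ge0 ?invr_ge0 ?(ltW e0)//.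
  have q0 := quad_ge0 g (alge ^~ n).
  apply: lerXn2r; rewrite ?nnegrE ?invr_ge0 ?addr_ge0 ?(ltW e0)//.
  by rewrite lef_pV2 ?posrE ?ltr_wpDl// lerDr.
Qed.

Definition dilate_coef (alpha : 'I_2 -> R) (i : nat) : R :=
  nth 1 [:: (Num.sqrt (alpha ord0))^-1; (Num.sqrt (alpha ord0))^-1;
            (Num.sqrt (alpha ord_max))^-1; (Num.sqrt (alpha ord_max))^-1] i.

Definition dilate alpha : G R -> G R := haar_map (dilate_coef alpha) (fun=> 0) (fun=> 0).

Let dilateE alpha g : dilate alpha g =
  ((((Num.sqrt (alpha ord0))^-1 * g.1.1.1, (Num.sqrt (alpha ord0))^-1 * g.1.1.2),
    ((Num.sqrt (alpha ord_max))^-1 * g.1.2.1, (Num.sqrt (alpha ord_max))^-1 * g.1.2.2)), g.2).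
Proof. by rewrite /dilate /haar_map /dilate_coef /= !addr0 mul1r. Qed.

Let mdil alpha : measurable_fun setT (dilate alpha).
Proof. by apply: measurable_haar_map. Qed.

Let den_dil alpha g : (forall j, 0 < alpha j) ->
  den c alpha e (dilate alpha g) = c * (g.2)%:C + ((rsq2 g.1)%:C + e%:C).
Proof.
move=> a0; rewrite /den dilateE /tc /= -rmorphD; congr (_ + (_ + _)%:C).
rewrite /quad sum_I2 /zc /normsq /rsq2 /rsq /= !exprMn !exprVn !sqr_sqrtr ?(ltW (a0 _))//.
by field; rewrite !gt_eqF.
Qed.

Definition limit_kernel (g : G R) : R[i] := ((rsq2 g.1)%:C + (e%:C + c * (g.2)%:C))^-1 ^+ 3.

(** The dilation turns the quadratic form into |z_1|^2 + |z_2|^2. *)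
Lemma scaled_integral alpha : (forall j, 0 < alpha j) ->
  Cintegral (@haar R) setT (fun g => (den c alpha e g)^-1 ^+ 3 * f g) =
  ((alpha ord0 * alpha ord_max)^-1)%:C *
  Cintegral (@haar R) setT (fun g => limit_kernel g * f (dilate alpha g)).
Proof.
move=> a0; have age j : 0 <= alpha j by exact: ltW.
have cb := contC_inv_den hc age e0.
have i0 : Cintegrable (@haar R) setT (fun g => (den c alpha e g)^-1 ^+ 3 * f g).
  by apply: locint_mul => //; apply: contC_locint; exact: contCM cb (contCM cb cb).
have P0 : 0 < alpha ord0 * alpha ord_max by rewrite mulr_gt0.
have hm A : measurable A ->
    (@haar R (dilate alpha @^-1` A) = (alpha ord0 * alpha ord_max)%:E * @haar R A)%E.
  move=> mA; rewrite /dilate haar_haar_map//; last first.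
    have s j : (Num.sqrt (alpha j))^-1 != 0 by rewrite invr_eq0 gt_eqF// sqrtr_gt0.
    move=> i; rewrite /dilate_coef; do 4 (case: i => [|i] //=).
    by rewrite nth_nil oner_neq0.
  congr (_%:E * _)%E; rewrite /dilate_coef /= normr1 invr1 mulr1.
  by rewrite !ger0_norm ?invr_ge0// !invrK -!expr2 !sqr_sqrtr.
have [_ h] := @Cintegral_scale R _ _ (@haar R) _ (dilate alpha) (ltW P0) (mdil alpha) hm _ i0.
have -> : Cintegral (@haar R) setT (fun g => limit_kernel g * f (dilate alpha g)) =
  (alpha ord0 * alpha ord_max)%:C * Cintegral (@haar R) setT (fun g => (den c alpha e g)^-1 ^+ 3 * f g).
  rewrite -h; apply: eq_Cintegral => g _ /=.
  have alg (x y w : R[i]) : x + (y + w) = y + (w + x) by rewrite addrC addrA.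
  by rewrite den_dil// /limit_kernel (alg (c * _)).
by rewrite mulrA -rmorphM mulVf ?mul1r// gt_eqF.
Qed.

Let zRe (t : R) : Re (e%:C + c * t%:C) = e.
Proof. by case: hc => ->; rewrite ReD ReM /=; ring. Qed.

(** The dilations contract the z-variables to 0, and f is supported in |t| <= M;
    this leaves an integrable bound that no longer involves f. *)
Lemma cvg_upper_integral :
  cvgC (fun n => Cintegral (@haar R) setT (fun g => limit_kernel g * f (dilate (quad_coef sigma (upper_cut R n)) g)))
    (Cintegral (@haar R) setT (fun g => limit_kernel g * f (0, g.2))) /\
  Cintegrable (@haar R) setT (fun g => limit_kernel g * f (0, g.2)).
Proof.
have [C C0 hC] := bsupp_boundedC cf bf; have [M hM] := bf.
(* The dilations fix t, so f vanishes at the dilated point for |t| > M. *)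
pose D g : R := C * ((rsq g.1.1 + rsq g.1.2 + e)^-1 ^+ 3 * \1_(`[- M, M]%classic : set R) g.2).
have iD : (@haar R).-integrable setT (EFin \o D).
  have h := @integrable_tensor _ _ _ _ R (@lebesgueC2 R) leb _ _ (integrable_rsqV3 e0)
    (integrable_indic_itv (- M) M true false).
  by have := @integrableZl _ _ _ (@haar R) setT measurableT C _ h; apply: eq_integrable.
have mf2 (phi : G R -> G R) : measurable_fun setT phi -> Cmeas setT (fun g => f (phi g)).
  have [m1 m2] := contC_meas cf => mphi.
  by split; [exact: (measurableT_comp m1 mphi)|exact: (measurableT_comp m2 mphi)].
have mbq : Cmeas setT limit_kernel.
  apply: CmeasX; apply: CmeasV => //; apply: CmeasD.
    apply: CmeasR; apply: (measurableT_comp (@measurable_rsq12 R)); exact: measurable_fst.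
  apply: CmeasD; first exact: Cmeas_cst.
  by apply: CmeasM; [exact: Cmeas_cst|apply: CmeasR].
have m0 : measurable_fun setT (fun g : G R => ((0, g.2) : G R)) by exact: measurable_fun_pair.
have dom g (x : G R) : x.2 = g.2 -> modC (limit_kernel g * f x) <= D g.
  move=> xg; rewrite /D modCM.
  have [gM|gM] := boolP (`|g.2| <= M); last first.
    rewrite [f x]hM; last first.
      rewrite (lt_le_trans _ (_ : `|x.2| <= `|x|))//; first by rewrite xg ltNge.
      by rewrite prod_normE le_max lexx orbT.
    rewrite modC0 mulr0 mulr_ge0// mulr_ge0 ?indicE//.
    by rewrite exprn_ge0// invr_ge0 addr_ge0 ?(ltW e0)// addr_ge0// rsq_ge0.
  rewrite indicE mem_set ?mulr1; last by rewrite /= in_itv /= -ler_norml.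
  rewrite mulrC ler_pM ?modC_ge0//.
  have z0 : 0 < Re (e%:C + c * (g.2)%:C) by rewrite zRe.
  have := modC_shiftX_le 3 z0 (addr_ge0 (rsq_ge0 g.1.1) (rsq_ge0 g.1.2)).
  by rewrite zRe.
have dil2 alpha g : (dilate alpha g).2 = g.2 by rewrite dilateE.
split; last first.
  apply: (@le_Cintegrable _ _ _ (@haar R) setT measurableT _ D) => //.
    by apply: CmeasM => //; exact: mf2.
  by move=> g _; exact: dom.
apply: (@Cdominated _ _ _ (@haar R) setT measurableT _ _ D) => //.
- by move=> n; apply: CmeasM => //; exact: mf2.
- by apply: CmeasM => //; exact: mf2.
- apply: aeW => g _; apply: cvgCM; first exact: cvgC_cst.
  have cp j : (fun n => (Num.sqrt (quad_coef sigma (upper_cut R n) j))^-1) @ \oo --> (0 : R).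
    have -> : (fun n => (Num.sqrt (quad_coef sigma (upper_cut R n) j))^-1) =
        Num.sqrt \o (fun n => (quad_coef sigma (upper_cut R n) j)^-1).
      by apply/funext => n /=; rewrite sqrtrV// ltW.
    have h := cvg_comp _ _ (cvg_quad_coefV_upper sigma_gt0 j) (@sqrt_continuous R 0).
    by move: h; rewrite sqrtr0.
  have cq j (x : R) : (fun n => (Num.sqrt (quad_coef sigma (upper_cut R n) j))^-1 * x) @ \oo --> (0 : R).
    by rewrite -(mul0r x); apply: cvgM => //; exact: cvg_cst.
  have cd : (fun n => dilate (quad_coef sigma (upper_cut R n)) g) @ \oo --> ((0, g.2) : G R).
    under eq_fun do rewrite dilateE.
    apply: (@cvg_pair_seq ((R * R) * (R * R))%type R _ _ (0 : (R * R) * (R * R)) g.2);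
      last exact: cvg_cst.
    apply: (@cvg_pair_seq (R * R)%type (R * R)%type _ _ (0 : R * R) (0 : R * R));
      exact: (@cvg_pair_seq R R).
  have [c1 c2] := cf.
  by split; [exact: (cvg_comp _ _ cd (c1 _))|exact: (cvg_comp _ _ cd (c2 _))].
- by apply: aeW => g _ n; exact: dom.
Qed.

Lemma upper_limit : Cintegral (@haar R) setT (fun g => limit_kernel g * f (0, g.2)) =
  (pi ^+ 2 / 2)%:C * Cintegral leb setT (fun t => (e%:C + c * t%:C)^-1 * f (0, t)).
Proof.
have [_ ib] := cvg_upper_integral.
have [i2 e2] := @Cfubini2 _ _ _ _ R (@lebesgueC2 R) leb _ ib.
have inner t : Cintegral (@lebesgueC2 R) setT (fun q => limit_kernel (q, t) * f (0, t)) =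
    (pi ^+ 2 / 2)%:C * ((e%:C + c * t%:C)^-1 * f (0, t)).
  have z0 : 0 < Re (e%:C + c * t%:C) by rewrite zRe.
  have [iq hq] := Cintegral_rsqV3 z0.
  transitivity (f (0, t) * Cintegral (@lebesgueC2 R) setT (fun q => limit_kernel (q, t))).
    rewrite -(@CintegralZ _ _ _ (@lebesgueC2 R) setT measurableT); last exact: iq.
    by apply: eq_Cintegral => q _; rewrite mulrC.
  refine (etrans (congr1 ( *%R _) hq) _).
  by rewrite mulrC -mulrA.
refine (etrans e2 _).
have P0 : pi ^+ 2 / 2 != 0 :> R by rewrite gt_eqF// divr_gt0// exprn_gt0// pi_gt0.
have i3 : Cintegrable leb setT (fun t => (e%:C + c * t%:C)^-1 * f (0, t)).
  have := @CintegrableZ _ _ _ leb setT measurableT ((pi ^+ 2 / 2)^-1)%:C _ i2.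
  apply: eq_Cintegrable => // t _; rewrite /= (inner t) mulrA -rmorphM mulVf ?mul1r//.
rewrite -(@CintegralZ _ _ _ leb setT measurableT)//.
by apply: eq_Cintegral => t _; exact: inner.
Qed.

End BoundaryTerms.

(** * Removal of the regularization *)

Section Regularized.
Context (R : realType) (sigma : 'I_2 -> R).
Hypothesis sigma_gt0 : forall j, 0 < sigma j.
Local Notation leb := (@lebesgue_measure R).
Local Notation hl := (@haar R \x leb)%E.
Local Notation J := (`]0, 1[%classic : set R).
Implicit Types (c : R[i]) (e : R) (k m : 'I_2) (f : G R -> R[i]).

(** Both ends of the truncated identity pass to the limit; only the end r = 1
    contributes. *)
Lemma regularized_pairing c e k m f : unit_im c -> 0 < e -> admissible c k m -> testfun f ->
  Cintegral hl setT (paired_kernel sigma c m e (Box_tr sigma k f)) =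
  (pi ^+ 2 / 2)%:C * Cintegral leb setT (fun t => (e%:C + c * t%:C)^-1 * f (0, t)).
Proof.
move=> hc e0 adm hf; have [sf bf] := hf; have cf := smoothC_cont sf.
have [sB bB] := testfun_Box_tr sigma k hf; have cB := smoothC_cont sB.
have [C _ hC] := bsupp_boundedC cB bB; have [M hM] := bB.
have iK := Cintegrable_paired_kernel sigma_gt0 m hc (ltW e0) (contC_meas cB) hC hM.
set phi := Box_tr sigma k f in sB bB cB hC hM iK *.
pose T n p := ind R (`[lower_cut R n, upper_cut R n]%classic : set R) p.2 * paired_kernel sigma c m e phi p.
have cv1 : cvgC (fun n => Cintegral hl setT (T n)) (Cintegral hl setT (paired_kernel sigma c m e phi)).
  apply: (@Cdominated _ _ _ hl setT measurableT T _ (fun p => modC (paired_kernel sigma c m e phi p))).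
  - move=> n; apply: CmeasM; last exact: Cintegrable_meas iK.
    by apply: Cmeas_snd; apply: Cmeas_ind; exact: measurable_itv.
  - exact: Cintegrable_meas iK.
  - exact: (@Cintegrable_mod _ _ _ hl setT measurableT _ iK).
  - apply: aeW => -[g r] _; rewrite /T /=.
    have [r01|r01] := pselect (J r); last first.
      rewrite (_ : (fun n => _) = fun=> 0); last first.
        by apply/funext => n; rewrite /paired_kernel /= [ind R J r]ind0// !mul0r mulr0.
      by rewrite /paired_kernel /= [ind R J r]ind0// !mul0r; exact: cvgC_cst.
    rewrite -[X in cvgC _ X]mul1r; apply: cvgCM; last exact: cvgC_cst.
    split => /=; last exact: cvg_cst.
    move: r01; rewrite /= in_itv /= => /andP[r0 r1].
    apply: cvg_near_cst.
    have h1 : \forall n \near \oo, lower_cut R n < r by apply: (cvgr_lt 0) => //; exact: cvg_lower_cut.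
    have h2 : \forall n \near \oo, r < upper_cut R n by apply: (cvgr_gt 1) => //; exact: cvg_upper_cut.
    near=> n; rewrite indicE mem_set//= in_itv /=; apply/andP; split; apply: ltW; by near: n.
  - apply: aeW => p _ n; rewrite /T modCM ler_piMl ?modC_ge0//; exact: modC_ind.
apply: (cvgC_unique cv1).
have eT n := truncated_identity sigma_gt0 hc e0 adm hf (lower_cut_gt0 R n) (lower_upper_cut R n) (upper_cut_lt1 R n).
have alhi n j : 0 < quad_coef sigma (upper_cut R n) j.
  have /andP[r0 r1] := upper_cut01 R n; rewrite mulr_gt0// divr_gt0//.
    by rewrite ltr_pwDl// powR_ge0.
  by rewrite subr_gt0 powR_lt1// (ltW r0).
have eS n := scaled_integral hc e0 cf bf (alhi n).
have [cv2 _] := cvg_upper_integral sigma_gt0 hc e0 cf bf.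
have cv3 := cvg_lower_term sigma_gt0 hc e0 cf bf m.
rewrite -(upper_limit sigma_gt0 hc e0 cf bf).
have -> : (fun n => Cintegral hl setT (T n)) = (fun n =>
   (4 * (sigma ord0 * sigma ord_max) *
     (boundary_weight sigma m (upper_cut R n) / (quad_coef sigma (upper_cut R n) ord0 * quad_coef sigma (upper_cut R n) ord_max)))%:C *
   Cintegral (@haar R) setT (fun g => limit_kernel c e g * f (dilate (quad_coef sigma (upper_cut R n)) g))
   + (- 4 * (sigma ord0 * sigma ord_max)%:C) * ((boundary_weight sigma m (lower_cut R n))%:C *
    Cintegral (@haar R) setT (fun g => (den c (quad_coef sigma (lower_cut R n)) e g)^-1 ^+ 3 * f g))).
  apply/funext => n; refine (etrans (eT n) _).
  refine (etrans (congr1 (fun x => 4 * _ * (_ * x - _)) (eS n)) _).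
  have alg (s p q : R) (a x y : R[i]) : 4 * s%:C * (p%:C * ((q^-1)%:C * x) - y) =
      (4 * s * (p / q))%:C * x + - 4 * s%:C * y.
    by rewrite !rmorphM /= rmorph_nat; ring.
  exact: (alg _ _ _ 0).
set L := Cintegral _ _ _.
rewrite -[L]addr0 -[X in _ + X](mulr0 (- 4 * (sigma ord0 * sigma ord_max)%:C)).
apply: cvgCD; last by apply: cvgCM => //; exact: cvgC_cst.
rewrite -[L]mul1r; apply: cvgCM => //.
exact: (cvgCR (cvg_boundary_weight_upper sigma_gt0 m)).
Unshelve. all: by end_near.
Qed.

Lemma cvg_regularized c k m f : unit_im c -> testfun f ->
  cvgC (fun n => Cintegral hl setT (paired_kernel sigma c m (n.+1%:R^-1) (Box_tr sigma k f)))
       (Cintegral hl setT (paired_kernel sigma c m 0 (Box_tr sigma k f))).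
Proof.
move=> hc hf; have [sB bB] := testfun_Box_tr sigma k hf; have cB := smoothC_cont sB.
have [C _ hC] := bsupp_boundedC cB bB; have [M hM] := bB.
have [D iD hD] := paired_kernel_dominated sigma_gt0 m hC hM.
have mK e := Cmeas_paired_kernel sigma c m e (contC_meas cB).
have hcv p : coords_neq0 p.1 ->
    cvgC (fun n => paired_kernel sigma c m (n.+1%:R^-1) (Box_tr sigma k f) p) (paired_kernel sigma c m 0 (Box_tr sigma k f) p).
  case: p => g r /= [_ _ _ _ t0]; rewrite /paired_kernel /=.
  apply: cvgCM; last exact: cvgC_cst.
  have [r01|r01] := pselect (J r); last first.
    by rewrite [ind R J r]ind0// mul0r; under eq_fun do rewrite mul0r; exact: cvgC_cst.
  apply: cvgCM; first exact: cvgC_cst.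
  apply: cvgCM; first exact: cvgC_cst.
  apply: cvgCM; last exact: cvgC_cst.
  apply: cvgCX; apply: cvgCV.
    apply: contra t0 => /eqP d0; have := normsq_den (quad_coef sigma r) 0 g hc.
    rewrite /= d0 /normsq /= expr0n /= addr0 => /esym/eqP.
    by rewrite paddr_eq0 ?sqr_ge0// !sqrf_eq0 => /andP[_].
  apply: cvgCD; first exact: cvgC_cst.
  apply: cvgCR; apply: cvgD; first exact: cvg_cst.
  exact: cvg_harmonic.
have hdom p : coords_neq0 p.1 -> forall n,
    modC (paired_kernel sigma c m (n.+1%:R^-1) (Box_tr sigma k f) p) <= D p.
  by move=> cp n; apply: hD => //; rewrite invr_ge0.
apply: (@Cdominated _ _ _ hl setT measurableT
  (fun n => paired_kernel sigma c m (n.+1%:R^-1) (Box_tr sigma k f)) _ D).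
- by move=> n; exact: mK.
- exact: mK.
- exact: iD.
- by apply: ae_imp (@ae_coordsr R) => p cp _; exact: hcv.
- by apply: ae_imp (@ae_coordsr R) => p cp _; exact: hdom.
Qed.

End Regularized.

Section CauchyKernel.
Context (R : realType).
Local Notation leb := (@lebesgue_measure R).
Implicit Types (c : R[i]) (e t : R) (h : R -> R[i]).

Lemma integral_oneDsqrV : (\int[leb]_x ((oneDsqr x)^-1)%:E = (pi : R)%:E)%E.
Proof.
rewrite (@ge0_symfun_integralT R (fun x => (oneDsqr x)^-1)).
- have -> : [set x : R | 0 <= x] = `[0, +oo[%classic.
    by apply/seteqP; split => x; rewrite /= in_itv /= andbT.
  by rewrite integral0y_oneDsqr -EFinM mulrC divfK.
- by move=> x; rewrite invr_ge0 ltW// oneDsqr_gt0.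
- exact: continuous_oneDsqrV.
- by move=> x; rewrite /= /oneDsqr sqrrN.
Qed.

Lemma integrable_oneDsqrV : leb.-integrable setT (EFin \o (fun x : R => (oneDsqr x)^-1)).
Proof.
apply/integrableP; split.
  apply/measurable_EFinP; apply: measurable_invr => //.
  by apply: measurable_funD => //; exact: measurable_funX.
under eq_integral do rewrite /= ger0_norm ?invr_ge0 ?(ltW (oneDsqr_gt0 _))//.
by rewrite integral_oneDsqrV ltry.
Qed.

Variables (h : R -> R[i]) (C M : R).
Hypotheses (mh : Cmeas setT h) (hC : forall t, modC (h t) <= C)
  (hM : forall t, M < `|t| -> h t = 0).
Hypothesis h0 : forall u : nat -> R, u @ \oo --> (0 : R) -> cvgC (fun n => h (u n)) (h 0).

Let C0 : 0 <= C. Proof. exact: le_trans (modC_ge0 _) (hC 0). Qed.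

Lemma Cintegrable_cauchy c e : unit_im c -> 0 < e ->
  Cintegrable leb setT (fun t => (e%:C + c * t%:C)^-1 * h t).
Proof.
move=> hc e0.
have z t : Re (e%:C + c * t%:C) = e by case: hc => ->; rewrite ReD ReM /=; ring.
apply: (@le_Cintegrable _ _ _ leb setT measurableT _
  (fun t => e^-1 * C * \1_(`[- M, M]%classic : set R) t)).
- apply: CmeasM => //; apply: CmeasV => //; apply: CmeasD; first exact: Cmeas_cst.
  by apply: CmeasM; [exact: Cmeas_cst|exact: CmeasR].
- have := integrableZl measurableT (e^-1 * C) (integrable_indic_itv (- M) M true false).
  by apply: eq_integrable.
- move=> t _; rewrite modCM; have [tM|tM] := leP `|t| M; last first.
    by rewrite hM// modC0 mulr0 mulr_ge0// ?indicE// mulr_ge0// invr_ge0 ltW.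
  rewrite indicE mem_set ?mulr1; last by rewrite /= in_itv /= -ler_norml.
  apply: ler_pM; rewrite ?modC_ge0// modCV.
  have h2 : e <= modC (e%:C + c * t%:C).
    by apply: le_trans (Re_le_modC _); rewrite z ler_norm.
  by rewrite lef_pV2 ?posrE// (lt_le_trans e0).
Qed.

(** The sum of the two Cauchy kernels is a Poisson kernel of mass 2 pi, and the
    substitution of e t for t concentrates it at the origin. *)
Lemma cvg_poisson :
  cvgC (fun n => Cintegral leb setT (fun t => ((n.+1%:R^-1 : R)%:C + 'i%C * t%:C)^-1 * h t) +
    Cintegral leb setT (fun t => ((n.+1%:R^-1 : R)%:C + - 'i%C * t%:C)^-1 * h t))
   ((2 * pi)%:C * h 0).
Proof.
have ci : unit_im ('i%C : R[i]) by left.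
have cN : unit_im (- 'i%C : R[i]) by right.
pose e n : R := n.+1%:R^-1; have e0 n : 0 < e n by rewrite invr_gt0.
pose P e t : R[i] := (2 * e / (e ^+ 2 + t ^+ 2))%:C * h t.
have sumE d t : 0 < d -> (d%:C + 'i%C * t%:C)^-1 * h t + (d%:C + - 'i%C * t%:C)^-1 * h t = P d t.
  move=> d0; rewrite -mulrDl; congr (_ * _).
  have p : d ^+ 2 + t ^+ 2 != 0 by rewrite gt_eqF// ltr_pwDl ?exprn_gt0 ?sqr_ge0.
  have n1 : normsq (d%:C + 'i%C * t%:C) = d ^+ 2 + t ^+ 2.
    by rewrite /normsq ReD ImD ReM ImM /=; ring.
  have n2 : normsq (d%:C + - 'i%C * t%:C) = d ^+ 2 + t ^+ 2.
    by rewrite /normsq ReD ImD ReM ImM /=; ring.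
  apply: complexP; rewrite ?ReD ?ImD !(ReV,ImV) n1 n2 !(ReD,ImD,ReM,ImM,ReN,ImN)/=; by field.
have iP d : 0 < d -> Cintegrable leb setT (P d).
  move=> d0; have := CintegrableD measurableT (Cintegrable_cauchy ci d0) (Cintegrable_cauchy cN d0).
  by apply: eq_Cintegrable => // t _; rewrite sumE.
pose Q n t : R[i] := (2 * (oneDsqr t)^-1)%:C * h (e n * t).
have step n : Cintegral leb setT (fun t => ((n.+1%:R^-1 : R)%:C + 'i%C * t%:C)^-1 * h t) +
    Cintegral leb setT (fun t => ((n.+1%:R^-1 : R)%:C + - 'i%C * t%:C)^-1 * h t) =
    Cintegral leb setT (Q n).
  rewrite -(CintegralD measurableT (Cintegrable_cauchy ci (e0 n)) (Cintegrable_cauchy cN (e0 n))).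
  transitivity (Cintegral leb setT (P (e n))).
    by apply: eq_Cintegral => t _; rewrite sumE.
  have ei : 0 <= (e n)^-1 by rewrite invr_ge0 ltW.
  have hm A : measurable A -> leb ((fun x => e n * x + 0) @^-1` A) = ((e n)^-1%:E * leb A)%E.
    by move=> mA; exact: lebesgue_measure_affine.
  have [iS hS] := @Cintegral_scale R _ _ leb _ (fun x => e n * x + 0) ei (measurable_affine _ _)
    hm _ (iP _ (e0 n)).
  (* Substitute e t for t. *)
have -> : Cintegral leb setT (P (e n)) =
      (e n)%:C * Cintegral leb setT (P (e n) \o (fun x => e n * x + 0)).
    by rewrite hS mulrA -rmorphM mulfV ?mul1r// gt_eqF.
  rewrite -(CintegralZ measurableT _ iS); apply: eq_Cintegral => t _.
  rewrite /P /Q /= addr0 mulrA -rmorphM; congr (_%:C * _).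
  have n0 : oneDsqr t != 0 by rewrite gt_eqF// oneDsqr_gt0.
  have en : e n != 0 by rewrite gt_eqF.
  have -> : e n ^+ 2 + (e n * t) ^+ 2 = e n ^+ 2 * oneDsqr t by rewrite /oneDsqr; ring.
  by field; rewrite n0 en.
rewrite (funext step).
have lim : Cintegral leb setT (fun t => (2 * (oneDsqr t)^-1)%:C * h 0) = (2 * pi)%:C * h 0.
  transitivity (Cintegral leb setT (fun t : R => (2%:C * h 0) * ((oneDsqr t)^-1)%:C)).
    by apply: eq_Cintegral => t _; rewrite rmorphM; ring.
  rewrite CintegralZ//; last first.
    by split; [exact: integrable_oneDsqrV|exact: integrable0].
  have -> : Cintegral leb setT (fun t : R => ((oneDsqr t)^-1)%:C) = pi%:C.
    apply: complexP => /=; first by rewrite /Rintegral integral_oneDsqrV.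
    by rewrite /Rintegral integral0.
  by rewrite rmorphM; ring.
rewrite -lim.
have mQ n : Cmeas setT (Q n).
  apply: CmeasM.
    apply: CmeasR; apply: measurable_funM => //; apply: measurable_invr => //.
    by apply: measurable_funD => //; exact: measurable_funX.
  have [m1 m2] := mh; have me : measurable_fun setT (fun t : R => e n * t) by exact: measurable_funM.
  by split; [exact: (measurableT_comp m1 me)|exact: (measurableT_comp m2 me)].
apply: (@Cdominated _ _ _ leb setT measurableT Q _ (fun t => 2 * C * (oneDsqr t)^-1)) => //.
- apply: CmeasM; last exact: Cmeas_cst.
  apply: CmeasR; apply: measurable_funM => //; apply: measurable_invr => //.
  by apply: measurable_funD => //; exact: measurable_funX.
- have := integrableZl measurableT (2 * C) integrable_oneDsqrV; by apply: eq_integrable.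
- apply: aeW => t _; apply: cvgCM; first exact: cvgC_cst.
  apply: h0; rewrite -(mul0r t); apply: cvgM; last exact: cvg_cst.
  exact: cvg_harmonic.
- apply: aeW => t _ n; rewrite /Q modCM modCR ger0_norm; last first.
    by rewrite mulr_ge0// invr_ge0 ltW// oneDsqr_gt0.
  by rewrite [leRHS]mulrAC ler_wpM2l// mulr_ge0// invr_ge0 ltW// oneDsqr_gt0.
Qed.

End CauchyKernel.

Section Conclusion.
Context (R : realType) (sigma : 'I_2 -> R).
Hypothesis sigma_gt0 : forall j, 0 < sigma j.
Local Notation leb := (@lebesgue_measure R).
Local Notation hl := (@haar R \x leb)%E.

Lemma kernel_pairing k f : testfun f ->
  Cintegral hl setT (paired_kernel sigma 'i%C k 0 (Box_tr sigma k f)) +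
  Cintegral hl setT (paired_kernel sigma (- 'i%C) (other k) 0 (Box_tr sigma k f)) = (pi ^+ 3)%:C * f 0.
Proof.
move=> hf; have [sf bf] := hf; have cf := smoothC_cont sf.
have ci : unit_im ('i%C : R[i]) by left.
have cN : unit_im (- 'i%C : R[i]) by right.
have ai : admissible ('i%C : R[i]) k k by left.
have aN : admissible (- 'i%C : R[i]) k (other k) by right.
have cv := cvgCD (cvg_regularized sigma_gt0 k k ci hf) (cvg_regularized sigma_gt0 k (other k) cN hf).
apply: (cvgC_unique cv).
have e0 n : 0 < n.+1%:R^-1 :> R by rewrite invr_gt0.
have -> : (fun n => Cintegral hl setT (paired_kernel sigma 'i%C k (n.+1%:R^-1) (Box_tr sigma k f)) +
    Cintegral hl setT (paired_kernel sigma (- 'i%C) (other k) (n.+1%:R^-1) (Box_tr sigma k f))) =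
  (fun n => (pi ^+ 2 / 2)%:C *
    (Cintegral leb setT (fun t => ((n.+1%:R^-1 : R)%:C + 'i%C * t%:C)^-1 * f (0, t)) +
     Cintegral leb setT (fun t => ((n.+1%:R^-1 : R)%:C + - 'i%C * t%:C)^-1 * f (0, t)))).
  apply/funext => n.
  by rewrite mulrDr (regularized_pairing sigma_gt0 ci (e0 n) ai hf)
    (regularized_pairing sigma_gt0 cN (e0 n) aN hf).
have -> : (pi ^+ 3)%:C * f 0 = (pi ^+ 2 / 2)%:C * ((2 * pi)%:C * f (0, 0)).
  rewrite mulrA -rmorphM; congr (_%:C * _); by field.
apply: cvgCM; first exact: cvgC_cst.
have [C _ hC] := bsupp_boundedC cf bf; have [M hM] := bf.
have mt : measurable_fun setT (fun t : R => ((0, t) : G R)) by exact: measurable_fun_pair.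
have [m1 m2] := contC_meas cf.
apply: (@cvg_poisson R (fun t => f (0, t)) C M).
- by split; [exact: (measurableT_comp m1 mt)|exact: (measurableT_comp m2 mt)].
- by move=> t; exact: hC.
- move=> t tM; apply: hM; apply: (lt_le_trans tM).
  by rewrite prod_normE le_max lexx orbT.
- move=> u u0; have [c1 c2] := cf.
  have cu : (fun n => (0, u n) : G R) @ \oo --> ((0, 0) : G R).
    apply: (@cvg_pair_seq ((R * R) * (R * R))%type R _ _ (0 : (R * R) * (R * R)) 0) => //.
    exact: cvg_cst.
  by split; [exact: (cvg_comp _ _ cu (c1 _))|exact: (cvg_comp _ _ cu (c2 _))].
Qed.

Lemma solvable_kernel k :
  solvable_by_convolution sigma k (fun g =>
    ((pi ^+ 3)^-1)%:C * kernel_integral sigma 'i%C k g +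
    ((pi ^+ 3)^-1)%:C * kernel_integral sigma (- 'i%C) (other k) g).
Proof.
have ci : unit_im ('i%C : R[i]) by left.
have cN : unit_im (- 'i%C : R[i]) by right.
have l1 := locint_kernel_integral sigma_gt0 k ci.
have l2 := locint_kernel_integral sigma_gt0 (other k) cN.
apply: fundamental_solvable.
  move=> M; have mB := @measurable_boxG R M.
  exact: (@CintegrableD _ _ _ (@haar R) _ mB _ _
    (@CintegrableZ _ _ _ (@haar R) _ mB _ _ (l1 M)) (@CintegrableZ _ _ _ (@haar R) _ mB _ _ (l2 M))).
move=> f hf; have [sB bB] := testfun_Box_tr sigma k hf; have cB := smoothC_cont sB.
have p1 := pairing_kernel_integral sigma_gt0 k ci cB bB.
have p2 := pairing_kernel_integral sigma_gt0 (other k) cN cB bB.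
have i1 := locint_mul l1 cB bB; have i2 := locint_mul l2 cB bB.
have iZ := fun (h : G R -> R[i]) (c : R[i]) => @CintegrableZ _ _ _ (@haar R) setT measurableT c h.
transitivity (((pi ^+ 3)^-1)%:C * Cintegral (@haar R) setT
     (fun g => kernel_integral sigma 'i%C k g * Box_tr sigma k f g) +
   ((pi ^+ 3)^-1)%:C * Cintegral (@haar R) setT
     (fun g => kernel_integral sigma (- 'i%C) (other k) g * Box_tr sigma k f g)).
  have j1 := iZ _ ((pi ^+ 3)^-1)%:C i1; have j2 := iZ _ ((pi ^+ 3)^-1)%:C i2.
  refine (etrans _ (etrans (@CintegralD _ _ _ (@haar R) setT measurableT _ _ j1 j2)
    (congr2 +%R (@CintegralZ _ _ _ (@haar R) setT measurableT _ _ i1)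
      (@CintegralZ _ _ _ (@haar R) setT measurableT _ _ i2)))).
  apply: eq_Cintegral => g _.
  have alg (p x y z : R[i]) : (p * x + p * y) * z = p * (x * z) + p * (y * z) by ring.
  exact: alg.
rewrite -mulrDr; refine (etrans (congr1 ( *%R _) (congr2 +%R p1 p2)) _).
have p0 : pi ^+ 3 != 0 :> R by rewrite gt_eqF// exprn_gt0// pi_gt0.
by rewrite kernel_pairing// mulrA -rmorphM mulVf// mul1r.
Qed.

End Conclusion.

Theorem theorem1 (R : realType) (sigma : 'I_2 -> R)
    (sigma_gt0 : forall j, 0 < sigma j) :
  (forall g : G R, zc ord0 g != 0 -> zc ord_max g != 0 -> forall m : 'I_2,
     Cintegrable (@lebesgue_measure R) `]0, 1[
       (kernel_integrand sigma 'i%C m g) /\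
     Cintegrable (@lebesgue_measure R) `]0, 1[
       (kernel_integrand sigma (- 'i%C) m g)) /\
  solvable_by_convolution sigma ord0 (kernel1 sigma) /\
  solvable_by_convolution sigma ord_max (kernel2 sigma).
Proof.
split=> [g z0 z1 m|].
  split; rewrite (funext (kernel_integrandE sigma _ m g)).
    by apply: Cintegrable_reg_kernel => //; left.
  by apply: Cintegrable_reg_kernel => //; right.
by split; [exact: (solvable_kernel sigma_gt0 ord0)|exact: (solvable_kernel sigma_gt0 ord_max)].
Qed.
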